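(* Let $G$ be a finite simple connected graph which is complete intersection. Then the edge ring $K[G]$ is normal if and only if $G$ has at most one non-bipartite block, or $G$ has exactly two non-bipartite blocks and they are strongly contiguous.
   Context: For a finite simple graph $G$ with edges $e_1,\dots,e_m$ and a field $K$, the toric ideal $I_G\subseteq K[e_1,\dots,e_m]$ is the kernel of the $K$-algebra map $e_i=\{v_j,v_k\}\mapsto v_jv_k$; $G$ is complete intersection if $I_G$ is generated by $\operatorname{ht}(I_G)$ elements. The edge ring $K[G]$ is the subalgebra of $K[v_1,\dots,v_n]$ generated by the monomials $v_iv_j$ with $\{v_i,v_j\}\in E(G)$. A block is a maximal biconnected subgraph of $G$. A cycle is chordless if no edge of $G$ joins two of its vertices other than its own edges. A block is of type $T_i$ if it contains exactly $i$ odd chordless cycles. Two non-bipartite blocks are strongly contiguous if either both are of type $T_1$ and the distance between them (minimum distance in $G$ between a vertex of one and a vertex of the other) is at most one, or one is of type $T_1$, the other of type $T_2$, and they have a common (cut) vertex. *)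

(* Defs.v *)
From mathcomp Require Import all_boot all_algebra.
From mathcomp Require Import mpoly.
Set Implicit Arguments. Unset Strict Implicit. Unset Printing Implicit Defensive.
Import GRing.Theory.
Local Open Scope ring_scope.

Section Ideals.
Variable R : comNzRingType.

Definition is_ideal (I : R -> Prop) : Prop :=
  I 0 /\ (forall x y, I x -> I y -> I (x + y)) /\ (forall r x, I x -> I (r * x)).

Definition is_prime_ideal (P : R -> Prop) : Prop :=
  is_ideal P /\ ~ P 1 /\ (forall a b, P (a * b) -> P a \/ P b).

Definition prime_chain_to (P : R -> Prop) (k : nat) : Prop :=
  exists Ps : nat -> R -> Prop,
    (forall i, (i <= k)%N -> is_prime_ideal (Ps i)) /\
    (forall i, (i < k)%N ->
       (forall x, Ps i x -> Ps i.+1 x) /\ (exists x, Ps i.+1 x /\ ~ Ps i x)) /\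
    (forall x, Ps k x <-> P x).

Definition height_eq (I : R -> Prop) (h : nat) : Prop :=
  (forall P, is_prime_ideal P -> (forall x, I x -> P x) -> prime_chain_to P h) /\
  (exists P, is_prime_ideal P /\ (forall x, I x -> P x) /\
             (forall k, prime_chain_to P k -> (k <= h)%N)).

Definition generated_by (s : seq R) (I : R -> Prop) : Prop :=
  forall x, I x <-> exists c : nat -> R, x = \sum_(i < size s) c i * s`_i.

Definition complete_intersection_ideal (I : R -> Prop) : Prop :=
  exists s : seq R, generated_by s I /\ height_eq I (size s).
End Ideals.

Section Graphs.
Variable n : nat.
Implicit Types (e : rel 'I_n) (S B : {set 'I_n}).

Definition simple_graph e : Prop := ssrbool.symmetric e /\ irreflexive e.
Definition connected_graph e : Prop := (0 < n)%N /\ forall x y, connect e x y.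

Definition edges e : seq ('I_n * 'I_n) :=
  [seq p : 'I_n * 'I_n <- enum [set: 'I_n * 'I_n] | (p.1 < p.2)%N && e p.1 p.2].

Definition induced e S : rel 'I_n := [rel x y | [&& e x y, x \in S & y \in S]].
Definition connected_on e S : bool :=
  [forall x in S, forall y in S, connect (induced e S) x y].
Definition biconnected e S : bool :=
  [&& (1 < #|S|)%N, connected_on e S & [forall v in S, connected_on e (S :\ v)]].
Definition is_block e B : bool :=
  biconnected e B && [forall B' : {set 'I_n}, (B \subset B') && biconnected e B' ==> (B' == B)].

Definition bipartite_on e B : Prop :=
  exists f : 'I_n -> bool, forall x y, x \in B -> y \in B -> e x y -> f x != f y.

Definition odd_chordless_cycle e (c : seq 'I_n) : bool :=
  [&& uniq c, (2 < size c)%N, odd (size c), cycle e c &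
      [forall x, forall y, [&& x \in c, y \in c & e x y] ==>
                           (y == next c x) || (x == next c y)]].

(* B contains exactly i odd chordless cycles (counted by their vertex sets,
   which determine a chordless cycle) : block of type T_i *)
Definition block_type e B (i : nat) : Prop :=
  exists s : seq {set 'I_n}, uniq s /\ size s = i /\
    forall S, S \in s <-> (S \subset B /\
                          exists c, odd_chordless_cycle e c /\ S = [set x in c]).

Definition nonbip_block e B : Prop := is_block e B /\ ~ bipartite_on e B.

Definition strongly_contiguous e B1 B2 : Prop :=
  (block_type e B1 1 /\ block_type e B2 1 /\
     exists x y, x \in B1 /\ y \in B2 /\ (x = y \/ e x y)) \/
  (((block_type e B1 1 /\ block_type e B2 2) \/ (block_type e B1 2 /\ block_type e B2 1)) /\
     exists v, v \in B1 /\ v \in B2).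
End Graphs.

Section EdgeRing.
Variables (K : fieldType) (n : nat) (e : rel 'I_n).

Definition edge_monomial (p : 'I_n * 'I_n) : {mpoly K[n]} := 'X_p.1 * 'X_p.2.

Definition edge_map (q : {mpoly K[size (edges e)]}) : {mpoly K[n]} :=
  comp_mpoly (map_tuple edge_monomial (in_tuple (edges e))) q.

Definition toric_ideal : {mpoly K[size (edges e)]} -> Prop := fun q => edge_map q = 0.

Definition edge_ring (p : {mpoly K[n]}) : Prop := exists q, p = edge_map q.

(* K[G] (a domain inside K[v]) is integrally closed in its field of fractions:
   every fraction a/b (a, b in K[G], b <> 0) that is a root of a monic polynomial
   with coefficients in K[G] lies in K[G].  Cleared of denominators:
   a^(d+1) + sum_{i<=d} c_i a^i b^(d+1-i) = 0  implies  a = c b with c in K[G]. *)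
Definition edge_ring_normal : Prop :=
  forall a b, edge_ring a -> edge_ring b -> b != 0 ->
    (exists (d : nat) (c : nat -> {mpoly K[n]}),
        (forall i, (i <= d)%N -> edge_ring (c i)) /\
        a ^+ d.+1 + \sum_(i < d.+1) c i * a ^+ i * b ^+ (d.+1 - i) = 0) ->
    exists c, edge_ring c /\ a = c * b.
End EdgeRing.

(* Main.v *)
Require Import Defs.
From Stdlib Require Import Classical.
From mathcomp Require Import all_boot all_order all_algebra.
From mathcomp Require Import mpoly.
From mathcomp Require Import zify.
Set Implicit Arguments. Unset Strict Implicit. Unset Printing Implicit Defensive.
Import GRing.Theory.

(** Normality of K[G] is equivalent to the odd cycle condition of Ohsugi and Hibi: two disjoint
    odd chordless cycles ("odd holes") are joined by an edge.  If C and C' violate it, the product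
    t of their vertices is a fraction of K[G] with t^2 in K[G] and t not in K[G].  Conversely, if
    a / b is integral, comparing leading monomials in b^d a^k = b^k q_k for all k shows that the
    quotient of the leading monomials of a and b has even degree and satisfies Hall's condition;
    hence it is a product of closed walks, and the odd ones pair up by the odd cycle condition.

    When the toric ideal is a complete intersection of a connected non-bipartite graph, it has a
    minimal system of at most |E| - |V| binomials x^u - x^w.  Their classes u + w mod 2 span a
    space of dimension at least |E| - |V|, so they form a basis of it.  Since a binomial of degree
    d only involves generators of degree at most d, the spans Z_D of the classes of degree in D
    satisfy: if z1 = z2 + z3 with zi in Z_(Di), then z1 is a sum of elements of Z_(D1 and D2) and
    Z_(D1 and D3).  The class C + C' of two odd holes lies in Z_D for every D coming from a
    connection of C and C'; intersecting over all connections which avoid a given vertex yields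
    all the restrictions on odd holes inside a block and on pairs of non-bipartite blocks. *)

(** * Closed walks and odd holes *)

Local Open Scope nat_scope.

(** Working modulo 2 makes the connection invisible: the even closed walk through two odd holes C
    and C' traverses the connecting path twice, so its class is C + C' for every path, while the
    degree of its binomial does record the path. Thus the single vector C + C' lies in many spans,
    and uniqueness of coordinates in a basis puts it into the span for their intersection. Once
    enough vertices are excluded, the odd number of edges of C contradicts a parity shared by all
    binomials of the remaining degrees. The given generators are arbitrary polynomials over an
    arbitrary field, and no generating set of binomials is extracted from them. Instead a maximal
    family of binomials is chosen that functionals over F_2 certify as independent modulo the
    product of the irrelevant and the toric ideal; the number of generators bounds its size. The
    block arguments see this family only through [span_system]. The bound |E| - |V| comes from |V|
    elements that are algebraically independent modulo the toric ideal, extended along a chain of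
    primes below it. *)

Section Walks.
Variables (T : eqType) (e : rel T).
Hypothesis esym : ssrbool.symmetric e.

Lemma repeated_vertex (c : seq T) :
  ~~ uniq c -> exists i x p, rot i c = x :: p /\ x \in p.
Proof.
case: c => [//|x0 c0]; set c := x0 :: c0 => /(uniqPn x0)[i [j [ltij ltj eqij]]].
have lti : i < size c by apply: ltn_trans ltj.
exists i, (nth x0 c i), (drop i.+1 c ++ take i c); split.
  by rewrite /rot (drop_nth x0 lti).
rewrite mem_cat eqij; apply/orP; left.
have -> : nth x0 c j = nth x0 (drop i.+1 c) (j - i.+1).
  by rewrite nth_drop subnKC.
by rewrite mem_nth // size_drop ltn_sub2r // (leq_ltn_trans ltij ltj).
Qed.

Lemma cycle_split x p1 y p2 :
  cycle e (x :: p1 ++ y :: p2) -> [/\ path e x p1, e (last x p1) y, path e y p2 & e (last y p2) x].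
Proof.
by rewrite /= rcons_cat cat_path /= rcons_path => /and3P[-> -> /andP[-> ->]].
Qed.

Lemma cycle_split_eq x p1 p2 :
  cycle e (x :: p1 ++ x :: p2) -> cycle e (x :: p1) /\ cycle e (x :: p2).
Proof. by case/cycle_split=> ? ? ? ?; rewrite /= !rcons_path; split; apply/andP. Qed.

Lemma cycle_split_edge x p1 y p2 : e x y ->
  cycle e (x :: p1 ++ y :: p2) -> cycle e (x :: rcons p1 y) /\ cycle e (y :: rcons p2 x).
Proof.
move=> exy /cycle_split[p1P l1 p2P l2]; rewrite /= !rcons_path !last_rcons.
by rewrite p1P l1 p2P l2 esym exy.
Qed.

Lemma rcons_path_rev x p : path e x p -> path e (last x p) (rev (belast x p)).
Proof. by rewrite rev_path; apply: sub_path => a b; rewrite esym. Qed.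
End Walks.

Section OddHoles.
Variables (n : nat) (e : rel 'I_n).
Hypothesis esym : ssrbool.symmetric e.
Hypothesis eirr : irreflexive e.

Definition odd_hole (C : {set 'I_n}) : Prop :=
  exists2 c, odd_chordless_cycle e c & C = [set x in c].

(** A repeated vertex cuts the walk into two closed walks whose lengths add up to the old length; a
    chord cuts it into two whose lengths add up to the old length plus 2. One of the two is odd and
    shorter, so induction on the length ends at a chordless cycle. *)
Lemma odd_closed_walk_hole (c : seq 'I_n) : cycle e c -> odd (size c) ->
  exists2 C, odd_hole C & {subset C <= c}.
Proof.
have [k] := ubnP (size c); elim: k c => // k IH c; rewrite ltnS => lek cyc oddc.
have short c' : cycle e c' -> odd (size c') -> size c' < size c ->
    {subset c' <= c} -> exists2 C, odd_hole C & {subset C <= c}.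
  move=> cy' od' lt' sub'; have [|C hC sC] := IH c' _ cy' od'; first exact: leq_trans lek.
  by exists C => // x /sC/sub'.
case: (boolP (uniq c)) => [Uc|/repeated_vertex[i [x [p [Er xp]]]]]; last first.
  have memr z : (z \in x :: p) = (z \in c) by rewrite -Er mem_rot.
  have sizer : size (x :: p) = size c by rewrite -Er size_rot.
  move: cyc; rewrite -(rot_cycle i e) Er.
  case/splitPr: p / xp => p1 p2 in Er memr sizer * => /cycle_split_eq[c1 c2].
  move: sizer; rewrite /= size_cat /= => sizer.
  case: (boolP (odd (size (x :: p1)))) => o1.
    apply: (short _ c1 o1) => [/=|z zp].
      by rewrite -sizer ltnS addnS ltnS leq_addr.
    by rewrite -memr; move: zp; rewrite !inE mem_cat => /orP[->//|->]; rewrite orbT.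
  apply: (short _ c2) => [/=|/=|z zp].
  - move: o1 oddc; rewrite /= -sizer addnS /= negbK oddD.
    by do 2!case: (odd _).
  - by rewrite -sizer ltnS leq_addl.
  by rewrite -memr; move: zp; rewrite !inE mem_cat inE => /orP[->//|->]; rewrite !orbT.
have sz3 : 2 < size c.
  case: c cyc oddc {lek short Uc} => [|x [|y [|z c]]] //=.
  by rewrite eirr.
case: (boolP (odd_chordless_cycle e c)) => [oc|].
  by exists [set x in c] => [|x]; [exists c|rewrite inE].
move=> nch; have [x [y [[xc yc exy] ynx xny]]] : exists x y : 'I_n,
    [/\ [/\ x \in c, y \in c & e x y], y != next c x & x != next c y].
  move: nch; rewrite /odd_chordless_cycle Uc sz3 oddc cyc /= => /forallPn[x].
  case/forallPn=> y; rewrite negb_imply negb_or => /andP[/and3P[? ? ?] /andP[? ?]].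
  by exists x, y.
have nxy : x != y by apply/eqP=> exy'; move: exy; rewrite exy' eirr.
have [i [p Er]] : exists i (p : seq 'I_n), rot i c = x :: p.
  by have [i p Er] := rot_to xc; exists i, p.
have memr z : (z \in x :: p) = (z \in c) by rewrite -Er mem_rot.
have sizer : size (x :: p) = size c by rewrite -Er size_rot.
have Ur : uniq (x :: p) by rewrite -Er rot_uniq.
have yp : y \in p by move: yc; rewrite -memr inE eq_sym (negPf nxy).
move: (cyc); rewrite -(rot_cycle i e) Er.
rewrite -(next_rot i Uc) Er in ynx; rewrite -(next_rot i Uc) Er in xny.
case/splitPr: p / yp => p1 p2 in Er memr sizer Ur ynx xny * => cycr.
have [c1 c2] := cycle_split_edge esym exy cycr.
move: sizer; rewrite /= size_cat /= => sizer.
(* Both arcs are nonempty because neither end of the chord is the successor of the other; this makes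
   both new cycles strictly shorter. *)
have n1 : p1 != [::] by apply/eqP=> p10; move: ynx; rewrite p10 /= eqxx eqxx.
have n2 : p2 != [::].
  apply/eqP=> p20; move: xny; rewrite p20.
  have -> : p1 ++ [:: y] = rcons p1 y by rewrite cats1.
  have Uy : uniq (x :: rcons p1 y) by rewrite -cats1 -p20.
  suff -> : next (x :: rcons p1 y) y = x by rewrite eqxx.
  rewrite next_nth inE mem_rcons mem_head orbT.
  rewrite -[rcons p1 y]/(behead (x :: rcons p1 y)) -cats1.
  have -> : index y (x :: p1 ++ [:: y]) = (size p1).+1.
    rewrite /= (negPf nxy) index_cat; case: ifP => [yp1|_].
      by move: Uy; rewrite /= rcons_uniq yp1 /= andbF.
    by rewrite /= eqxx addn0.
  by rewrite nth_default // /= size_cat /= addn1.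
have s1 : 0 < size p1 by case: (p1) n1.
have s2 : 0 < size p2 by case: (p2) n2.
case: (boolP (odd (size (x :: rcons p1 y)))) => o1.
  apply: (short _ c1 o1) => [/=|z zp]; first by rewrite size_rcons -sizer addnS !ltnS -[X in X < _]addn0 ltn_add2l.
  rewrite -memr; move: zp; rewrite !inE mem_rcons mem_cat !inE.
  by case/or3P=> ->; rewrite ?orbT.
apply: (short _ c2) => [/=|/=|z zp]; rewrite ?size_rcons //.
- move: o1 oddc; rewrite /= size_rcons /= -sizer addnS /= oddD !negbK.
  by do 2!case: (odd _).
- by rewrite -sizer addnS !ltnS -[X in X < _]add0n ltn_add2r.
rewrite -memr; move: zp; rewrite !inE mem_rcons mem_cat !inE.
by case/or3P=> ->; rewrite ?orbT.
Qed.

End OddHoles.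

(** * Connected sets and blocks *)

Section ConnectedSets.
Variables (n : nat) (e : rel 'I_n).
Hypothesis esym : ssrbool.symmetric e.
Hypothesis eirr : irreflexive e.
Implicit Types (S W B C : {set 'I_n}) (x y z v : 'I_n).

Lemma induced_sym S : ssrbool.symmetric (induced e S).
Proof. by move=> x y; rewrite /induced /= esym [(x \in S) && _]andbC. Qed.

Lemma connect_induced_sym S : connect_sym (induced e S).
Proof. exact/sym_connect_sym/induced_sym. Qed.

Lemma connected_onP S :
  reflect (forall x y, x \in S -> y \in S -> connect (induced e S) x y) (connected_on e S).
Proof.
apply: (iffP forall_inP) => [h x y xS yS|h x xS]; last by apply/forall_inP=> y; apply: h.
by move/forall_inP: (h x xS); apply.
Qed.

Lemma connect_inducedS S W x y : S \subset W ->
  connect (induced e S) x y -> connect (induced e W) x y.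
Proof.
move=> sSW; apply: connect_sub => a b /and3P[eab aS bS]; apply: connect1.
by rewrite /induced /= eab !(subsetP sSW).
Qed.

Lemma connected_on_root S r :
  (forall x, x \in S -> connect (induced e S) r x) -> connected_on e S.
Proof.
move=> h; apply/connected_onP=> x y xS yS.
by apply: connect_trans (h y yS); rewrite connect_induced_sym h.
Qed.

Lemma path_induced S x p : x \in S -> path e x p -> {subset p <= S} ->
  path (induced e S) x p.
Proof.
elim: p x => //= y p IH x xS /andP[exy pyp] sub.
have yS : y \in S by apply: sub; rewrite mem_head.
rewrite {1}/induced /= exy xS yS /=; apply: IH => // z zp; apply: sub.
by rewrite inE zp orbT.
Qed.

Lemma connected_on_path x p : path e x p -> connected_on e [set y in x :: p].
Proof.
move=> pxp; apply: (@connected_on_root _ x) => y; rewrite inE => yp.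
case/splitPl: p / yp pxp => p1 p2 <-; rewrite cat_path => /andP[pp1 _].
apply/connectP; exists p1 => //; apply: path_induced => // [|z zp].
  by rewrite inE mem_head.
by rewrite !inE mem_cat zp orbT.
Qed.

Lemma connected_onU S W z : connected_on e S -> connected_on e W ->
  z \in S -> z \in W -> connected_on e (S :|: W).
Proof.
move=> /connected_onP cS /connected_onP cW zS zW.
apply: (@connected_on_root _ z) => x; rewrite inE => /orP[xS|xW].
  by apply: connect_inducedS (cS _ _ zS xS); apply: subsetUl.
by apply: connect_inducedS (cW _ _ zW xW); apply: subsetUr.
Qed.

Lemma connected_on1 x : connected_on e [set x].
Proof. by apply/connected_onP=> y z /set1P-> /set1P->. Qed.

Lemma connected_onU_edge S W x y : connected_on e S -> connected_on e W ->
  x \in S -> y \in W -> e x y -> connected_on e (S :|: W).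
Proof.
move=> cS cW xS yW exy.
have cxy : connected_on e [set z in [:: x; y]].
  by apply: connected_on_path; rewrite /= exy.
have c1 : connected_on e (S :|: [set z in [:: x; y]]).
  by apply: (@connected_onU _ _ x) => //; rewrite !inE eqxx.
have := @connected_onU _ _ y c1 cW.
rewrite !inE eqxx !orbT => /(_ isT yW).
congr (connected_on _ _); apply/setP=> z; rewrite !inE.
case: (eqVneq z x) => [->|_]; first by rewrite xS.
by case: (eqVneq z y) => [->|_]; rewrite ?yW ?orbT ?orbF.
Qed.

Lemma connected_on_upath S x y : connected_on e S -> x \in S -> y \in S ->
  exists p, [/\ path e x p, last x p = y, uniq (x :: p) & {subset x :: p <= S}].
Proof.
move=> /connected_onP cS xS yS; have /connectP[p pp ->] := cS _ _ xS yS.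
case/shortenP: pp => p' pp' Up' _; exists p'; split=> //.
  by apply: sub_path pp' => a b /and3P[].
move=> z; rewrite inE => /predU1P[->//|zp].
elim: p' x xS pp' zp {Up'} => //= a p' IH x xS /andP[/and3P[_ _ aS] pa].
by rewrite inE => /predU1P[->//|]; apply: (IH a).
Qed.

(** Stopping a path from [x] to [y] at its first vertex in [C] gives [W]. A walk through [W] then
    adds degree on [C] only at [c]. *)
Lemma first_hit S C x y : connected_on e S -> x \in S -> y \in S -> x \notin C -> y \in C ->
  exists W c, [/\ connected_on e W, W \subset S, x \in W, c \in W & W :&: C = [set c]].
Proof.
move=> cS xS yS xC yC; have [p [pp lp _ sp]] := connected_on_upath cS xS yS.
have hC : has (mem C) p.
  apply/hasP; exists y => //; rewrite -lp; case: (p) lp => //= lx.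
    by move: xC; rewrite lx yC.
  by move=> s _; rewrite mem_last.
case: (split_find hC) pp lp sp => c p1 p2 cC nC; rewrite cat_path => /andP[pp1 _] _ sp.
exists [set z in x :: rcons p1 c], c; split.
- exact: connected_on_path.
- apply/subsetP=> z; rewrite inE => zp; apply: sp.
  by move: zp; rewrite !inE mem_cat => /orP[->//|->]; rewrite orbT.
- by rewrite inE mem_head.
- by rewrite !inE mem_rcons mem_head orbT.
apply/setP=> z; rewrite !inE mem_rcons inE; apply/andP/eqP => [[h zC]|->].
  case/or3P: h => [/eqP zx|/eqP//|zp]; first by move: xC; rewrite -zx zC.
  by case/hasP: nC; exists z.
by rewrite eqxx orbT.
Qed.

Lemma biconnected_cycle c : cycle e c -> uniq c -> 1 < size c ->
  biconnected e [set x in c].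
Proof.
move=> cyc Uc sc; apply/and3P; split.
- by rewrite cardsE (card_uniqP Uc).
- case: c cyc Uc sc => //= x p; rewrite rcons_path => /andP[pp _] _ _.
  exact: connected_on_path.
apply/forall_inP=> v; rewrite inE => vc.
have [i p Er] := rot_to vc.
have Up : uniq (v :: p) by rewrite -Er rot_uniq.
have -> : [set x in c] :\ v = [set x in p].
  apply/setP=> z; rewrite !inE -(mem_rot i) Er inE.
  case: (eqVneq z v) => [->|_] //=; first by move: Up => /= /andP[/negPf->].
move: cyc; rewrite -(rot_cycle i) Er /= => {Er Up}.
case: p => [_|y p]; first by apply/connected_onP=> x y; rewrite inE.
rewrite /= rcons_path => /and3P[_ pp _].
exact: connected_on_path.
Qed.

(** Whichever vertex is removed, [x] or [y] survives and still joins the two remaining connected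
    sets. *)
Lemma biconnectedU S W x y : x != y -> biconnected e S -> biconnected e W ->
  x \in S -> x \in W -> y \in S -> y \in W -> biconnected e (S :|: W).
Proof.
move=> nxy /and3P[S1 S2 /forall_inP S3] /and3P[_ W2 /forall_inP W3] xS xW yS yW.
have conD (U : {set 'I_n}) v : connected_on e U -> {in U, forall v, connected_on e (U :\ v)} ->
    connected_on e (U :\ v).
  move=> cU h; case: (boolP (v \in U)) => vU; first exact: h.
  suff -> : U :\ v = U by [].
  by apply/setP=> z; rewrite !inE; case: eqP => // ->; rewrite (negPf vU).
apply/and3P; split.
- by apply: leq_trans S1 _; apply/subset_leq_card/subsetUl.
- exact: (@connected_onU _ _ x).
apply/forall_inP=> v _.
have -> : (S :|: W) :\ v = (S :\ v) :|: (W :\ v) by rewrite setDUl.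
have cSv := conD S v S2 S3; have cWv := conD W v W2 W3.
case: (eqVneq v x) => [vx|nvx].
  by apply: (@connected_onU _ _ y) => //; rewrite !inE vx eq_sym nxy.
by apply: (@connected_onU _ _ x) => //; rewrite !inE eq_sym nvx.
Qed.

Lemma block_biconnected B : is_block e B -> biconnected e B.
Proof. by case/andP. Qed.

Lemma block_connected B : is_block e B -> connected_on e B.
Proof. by move/block_biconnected/and3P=> []. Qed.

Lemma block_connectedD B v : is_block e B -> connected_on e (B :\ v).
Proof.
move=> bB; case: (boolP (v \in B)) => vB.
  by case/block_biconnected/and3P: bB => _ _ /forall_inP; apply.
suff -> : B :\ v = B by apply: block_connected.
by apply/setP=> z; rewrite !inE; case: eqP => // ->; rewrite (negPf vB).
Qed.

Lemma block_maximal B S x y : is_block e B -> biconnected e S -> x != y ->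
  x \in B -> x \in S -> y \in B -> y \in S -> S \subset B.
Proof.
move=> bB bS nxy xB xS yB yS; case/andP: (bB) => _ /forallP/(_ (B :|: S)).
rewrite subsetUl (biconnectedU nxy (block_biconnected bB) bS) //= => /eqP <-.
exact: subsetUr.
Qed.

Lemma blocks_meet B1 B2 x y : is_block e B1 -> is_block e B2 -> B1 <> B2 ->
  x \in B1 -> x \in B2 -> y \in B1 -> y \in B2 -> x = y.
Proof.
move=> b1 b2 nB x1 x2 y1 y2; apply/eqP/negPn/negP=> nxy; apply: nB.
apply/eqP; rewrite eqEsubset; apply/andP; split.
  exact: (block_maximal b2 (block_biconnected b1) nxy).
exact: (block_maximal b1 (block_biconnected b2) nxy).
Qed.

(** If [b] and [b'] differed, a path through [W] followed by a path through [B] would form a cycle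
    with two vertices in [B]. By maximality of the block the cycle would lie in [B], yet it contains
    [w]. *)
Lemma block_attachment B W b b' w w' : is_block e B -> connected_on e W ->
  [disjoint W & B] -> b \in B -> b' \in B -> w \in W -> w' \in W ->
  e b w -> e b' w' -> b = b'.
Proof.
move=> bB cW dWB bB1 bB2 wW wW' ebw ebw'; apply/eqP/negPn/negP=> nbb.
have [p [pp lp Up sp]] := connected_on_upath cW wW wW'.
have [q [pq lq Uq sq]] := connected_on_upath (block_connected bB) bB2 bB1.
have cyc : cycle e ((w :: p) ++ (b' :: q)).
  by rewrite /= rcons_cat cat_path pp lp /= esym ebw' rcons_path pq lq ebw.
have U : uniq ((w :: p) ++ (b' :: q)).
  rewrite cat_uniq Up Uq andbT andTb; apply/hasPn=> z zq; apply/negP=> zp.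
  by have := disjointFr dWB (sp _ zp); rewrite (sq _ zq).
have bic : biconnected e [set z in (w :: p) ++ b' :: q].
  by apply: biconnected_cycle => //; rewrite size_cat /= addSn addnS.
have bq : b \in b' :: q by rewrite -lq mem_last.
have := @block_maximal B _ b b' bB bic nbb bB1.
rewrite !inE !mem_cat !inE eqxx !orbT => h.
have {}h : [set z in (w :: p) ++ b' :: q] \subset B.
  by apply: h => //; move: bq; rewrite inE => ->; rewrite !orbT.
have := subsetP h w; rewrite !inE eqxx => /(_ isT).
by rewrite (disjointFr dWB wW).
Qed.

Lemma biconnected_in_block S : biconnected e S -> exists2 B, is_block e B & S \subset B.
Proof.
move=> bS; have [B /maxsetP[bB maxB] sSB] := maxset_exists (P := biconnected e) bS.
exists B => //; rewrite /is_block bB; apply/forallP=> B'; apply/implyP=> /andP[sB bB'].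
by apply/eqP; apply: maxB.
Qed.

End ConnectedSets.

(** * Degrees in odd holes, and odd holes in non-bipartite sets *)

Section HoleLemmas.
Variables (n : nat) (e : rel 'I_n).
Hypothesis esym : ssrbool.symmetric e.
Hypothesis eirr : irreflexive e.
Implicit Types (S W B C : {set 'I_n}) (x y z v : 'I_n).

Lemma odd_hole_biconnected C : odd_hole e C -> biconnected e C.
Proof.
case=> c /and5P[Uc sc _ cc _] ->; apply: biconnected_cycle => //; exact: ltnW.
Qed.

Lemma odd_hole_connected C : odd_hole e C -> connected_on e C.
Proof. by move/odd_hole_biconnected/and3P=> []. Qed.

Lemma odd_hole_card C : odd_hole e C -> 2 < #|C|.
Proof. by case=> c /and5P[Uc sc _ _ _] ->; rewrite cardsE (card_uniqP Uc). Qed.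

Lemma odd_hole_odd C : odd_hole e C -> odd #|C|.
Proof. by case=> c /and5P[Uc _ oc _ _] ->; rewrite cardsE (card_uniqP Uc). Qed.

Lemma odd_hole_rot C x : odd_hole e C -> x \in C ->
  exists p, [/\ odd_chordless_cycle e (x :: p), C = [set y in x :: p] & ~~ odd (size p)].
Proof.
case=> c hc -> /[!inE] xc; have [i p Er] := rot_to xc.
have [Uc sc oc cc hch] := and5P hc.
exists p; split.
- rewrite -Er; apply/and5P; rewrite rot_uniq size_rot rot_cycle; split=> //.
  apply/forallP=> y; apply/forallP=> z; rewrite !mem_rot !next_rot //.
  by move/forallP: hch => /(_ y)/forallP/(_ z).
- by apply/setP=> z; rewrite [LHS]inE [RHS]inE -Er mem_rot.
by move: oc; rewrite -(size_rot i) Er.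
Qed.

Lemma next_neq_prev (c : seq 'I_n) x : uniq c -> 2 < size c -> x \in c -> next c x != prev c x.
Proof.
move=> Uc sc xc; apply/eqP=> h; have [i p Er] := rot_to xc.
move: h; rewrite -(next_rot i Uc) -(prev_rot i Uc).
have : 2 < size (rot i c) by rewrite size_rot.
have : uniq (rot i c) by rewrite rot_uniq.
rewrite Er.
case: p {Er} => [|y [|z p]] // Ur _.
have -> : next [:: x, y, z & p] x = y by rewrite /= eqxx.
rewrite prev_nth mem_head => h.
have xi : index x (y :: z :: p) = (size p).+2.
  by rewrite memNindex //; case/andP: Ur.
move: h; rewrite xi /= => h.
by move: (Ur) => /= /and3P[_ + _]; rewrite h mem_nth.
Qed.

Lemma odd_hole_deg2 C x : odd_hole e C -> x \in C -> #|[set y in C | e x y]| = 2.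
Proof.
case=> c /and5P[Uc sc oc cc hch] -> /[!inE] xc.
have -> : [set y in [set x0 in c] | e x y] = [set next c x; prev c x].
  apply/setP=> y; rewrite !inE; apply/andP/orP => [[yc exy]|].
    move/forallP: hch => /(_ x)/forallP/(_ y); rewrite xc yc exy /=.
    case/orP=> [->|/eqP->]; first by left.
    by right; rewrite prev_next.
  case=> /eqP->; first by rewrite mem_next next_cycle.
  by rewrite mem_prev esym prev_cycle.
by rewrite cards2 next_neq_prev.
Qed.

(** A vertex of [A] has two neighbours in [A] and two in [C], hence the same ones, so [A] is closed
    under adjacency in the connected set [C]. *)
Lemma odd_hole_sub_eq A C : odd_hole e A -> odd_hole e C -> A \subset C -> A = C.
Proof.
move=> hA hC sAC; apply/eqP; rewrite eqEsubset sAC /=; apply/subsetP=> y yC.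
have /card_gt0P[x xA] : 0 < #|A| by apply: ltn_trans (odd_hole_card hA).
have /connected_onP cC := odd_hole_connected hC.
have clA : closed (induced e C) (mem A).
  apply: (intro_closed (connect_induced_sym esym C)) => a b /and3P[eab aC bC] aA.
  have eqN : [set y in A | e a y] = [set y in C | e a y].
    apply/eqP; rewrite eqEcard !odd_hole_deg2 // andbT.
    by apply/subsetP=> z; rewrite !inE => /andP[/(subsetP sAC)-> ->].
  have : b \in [set y in C | e a y] by rewrite inE bC.
  by rewrite -eqN inE => /andP[].
have := closed_connect clA (cC x y (subsetP sAC _ xA) yC).
by rewrite xA => <-.
Qed.

Lemma odd_hole_nonbipartite C B : odd_hole e C -> C \subset B -> ~ bipartite_on e B.
Proof.
case=> c /and5P[Uc sc oc cc _] -> sCB [f hf].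
case: c cc oc sCB {Uc sc} => //= x p.
have altf q a : path e a q -> a \in B -> {subset q <= B} -> f (last a q) = f a (+) odd (size q).
  elim: q a => [|b q IH] a /=; first by rewrite addbF.
  case/andP=> eab pq aB sub; have bB : b \in B by apply: sub; rewrite mem_head.
  rewrite IH // => [|z zq]; last by apply: sub; rewrite inE zq orbT.
  by have := hf _ _ aB bB eab; do 2!case: (f _); case: odd.
move=> pp oc /subsetP sCB.
have xB : x \in B by apply: sCB; rewrite inE mem_head.
have := altf _ _ pp xB; rewrite last_rcons size_rcons /= oc => h.
have : f x = f x (+) true.
  by apply: h => z; rewrite mem_rcons => zp; apply: sCB; rewrite inE.
by case: (f x).
Qed.

(** Colour each vertex by the parity of a chosen walk from a root. An edge with ends of equal colour
    closes two of these walks into an odd closed walk inside [B]. *)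
Lemma nonbipartite_odd_hole B : connected_on e B -> ~ bipartite_on e B ->
  exists2 C, odd_hole e C & C \subset B.
Proof.
move=> cB nb; case: (set_0Vmem B) => [B0|[r rB]].
  by case: nb; exists (fun=> true) => x y; rewrite B0 inE.
have /all_sig[p hp] x : {p | x \in B -> [/\ path e r p, last r p = x & {subset r :: p <= B}]}.
  case: (boolP (x \in B)) => xB; last by exists [::].
  have /connected_onP/(_ _ _ rB xB)/connectP := cB.
  move=> h; have [q qP] : {q | path (induced e B) r q && (last r q == x)}.
    apply: sigW; case: h => q pq ->; exists q; rewrite pq /= eqxx //.
  exists q => _; case/andP: qP => pq /eqP <-; split=> //.
    by apply: sub_path pq => a b /and3P[].
  move=> z; rewrite inE => /predU1P[->//|].
  elim: q r rB pq {h} => //= a q IH r rB /andP[/and3P[_ _ aB] pa].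
  by rewrite inE => /predU1P[->//|]; apply: (IH a).
case: (boolP [exists x in B, exists y in B, e x y && (odd (size (p x)) == odd (size (p y)))]).
  case/exists_inP=> x xB /exists_inP[y yB /andP[exy /eqP opar]].
  have [px lx sx] := hp x xB; have [py ly sy] := hp y yB.
  have cE : cycle e (r :: p x ++ rev (p y)).
    rewrite /= rcons_cat cat_path px lx /= -rev_cons.
    case/lastP: (p y) py ly sy {opar} => [_ /= ry _|q z].
      by rewrite /= andbT ry.
    rewrite last_rcons => py zy sy; rewrite rev_cons rev_rcons /= zy exy /= -rev_cons.
    have := rcons_path_rev esym py; rewrite last_rcons zy.
    by rewrite belast_rcons.
  have oE : odd (size (r :: p x ++ rev (p y))).
    by rewrite /= size_cat size_rev oddD opar addbb.
  have [C hC sC] := odd_closed_walk_hole esym eirr cE oE.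
  exists C => //; apply/subsetP=> z /sC; rewrite inE mem_cat mem_rev.
  case/or3P=> [/eqP->//|zp|zp]; first by apply: sx; rewrite inE zp orbT.
  by apply: sy; rewrite inE zp orbT.
move=> nex; case: nb; exists (fun x => odd (size (p x))) => x y xB yB exy.
apply: contra nex => h; apply/exists_inP; exists x => //; apply/exists_inP; exists y => //.
by rewrite exy.
Qed.

End HoleLemmas.

(** * Edge monomials and closed walks *)

Section F2.
Local Open Scope ring_scope.
Lemma F2_addrr (V : lmodType 'F_2) (z : V) : z + z = 0.
Proof.
by rewrite -mulr2n -scaler_nat (_ : 2%:R = 0 :> 'F_2) ?scale0r //; apply/val_inj.
Qed.

Lemma F2_oppr (V : lmodType 'F_2) (z : V) : - z = z.
Proof. by apply/esym/eqP; rewrite -addr_eq0 F2_addrr. Qed.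

Lemma F2_double (k : nat) : (k + k)%:R = 0 :> 'F_2.
Proof.
by rewrite addnn -mul2n natrM (_ : 2%:R = 0 :> 'F_2) ?mul0r //; apply/val_inj.
Qed.

Lemma F2_opp (a : 'F_2) : - a = a.
Proof. by case: a => [[|[|a]] lta] //; apply/val_inj. Qed.

Lemma F2_eq1 (a : 'F_2) : a != 0 -> a = 1.
Proof. by case: a => [[|[|a]] lta] // _; apply/val_inj. Qed.

End F2.

Section EdgeMonomials.
Variables (n : nat) (e : rel 'I_n).
Hypothesis esym : ssrbool.symmetric e.
Hypothesis eirr : irreflexive e.
Implicit Types (S W B C : {set 'I_n}) (x y z v : 'I_n).

Local Notation m := (size (edges e)).
Local Notation edge_exp := 'X_{1..m}.

Definition ed (i : 'I_m) : 'I_n * 'I_n := tnth (in_tuple (edges e)) i.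

Lemma ed_edge i : e (ed i).1 (ed i).2.
Proof. by have := mem_tnth i (in_tuple (edges e)); rewrite mem_filter => /andP[/andP[]]. Qed.

Lemma ed_neq i : (ed i).1 != (ed i).2.
Proof. by apply/eqP=> h; have := ed_edge i; rewrite h eirr. Qed.

Lemma edges_uniq : uniq (edges e).
Proof. by rewrite filter_uniq // enum_uniq. Qed.

Lemma ed_inj : injective ed.
Proof. by apply/injectiveP; rewrite /injectiveb /dinjectiveb map_tnth_enum edges_uniq. Qed.

Lemma ed_lt i : (ed i).1 < (ed i).2.
Proof. by have := mem_tnth i (in_tuple (edges e)); rewrite mem_filter => /andP[/andP[]]. Qed.

Definition is_ed (i : 'I_m) x y := (ed i == (x, y)) || (ed i == (y, x)).

Lemma is_edC i x y : is_ed i x y = is_ed i y x.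
Proof. by rewrite /is_ed orbC. Qed.

Lemma is_ed_ex x y : e x y -> exists i, is_ed i x y.
Proof.
move=> exy; have nxy : x != y by apply/eqP=> h; move: exy; rewrite h eirr.
wlog ltxy : x y exy nxy / x < y => [W|].
  case: (ltngtP x y) => [ltxy|ltxy|/val_inj h]; first exact: W.
    have [||//|i] := W y x; rewrite 1?esym 1?eq_sym // is_edC => hi; by exists i.
  by move: nxy; rewrite h eqxx.
have mem : (x, y) \in edges e by rewrite mem_filter mem_enum inE /= ltxy exy.
have /tnthP[i hi] : (x, y) \in in_tuple (edges e) by [].
by exists i; rewrite /is_ed /ed -hi eqxx.
Qed.

Lemma is_ed_inj i j x y : is_ed i x y -> is_ed j x y -> i = j.
Proof.
by move=> /orP[]/eqP hi /orP[]/eqP hj; apply: ed_inj; rewrite hi hj //;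
   have := ed_lt i; have := ed_lt j; rewrite hi hj /= => /ltn_trans h/h; rewrite ltnn.
Qed.

Lemma is_ed_edge i x y : is_ed i x y -> e x y.
Proof. by have := ed_edge i => + /orP[]/eqP h; rewrite h //= esym. Qed.

Lemma ed_is_ed i : is_ed i (ed i).1 (ed i).2.
Proof. by rewrite /is_ed -surjective_pairing eqxx. Qed.

Definition incidence (i : 'I_m) v : nat := ((ed i).1 == v) + ((ed i).2 == v).

Definition deg (u : edge_exp) : 'X_{1..n} :=
  (\sum_i (U_((ed i).1) + U_((ed i).2)) *+ u i)%MM.

Lemma degE u v : deg u v = \sum_i incidence i v * u i.
Proof.
by rewrite /deg mnm_sumE; apply: eq_bigr => i _; rewrite mulmnE mnmDE !mnm1E.
Qed.

Lemma degD u1 u2 : deg (u1 + u2)%MM = (deg u1 + deg u2)%MM.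
Proof.
apply/mnmP=> v; rewrite mnmDE !degE -big_split; apply: eq_bigr => i _.
by rewrite mnmDE mulnDr.
Qed.

Lemma deg0 : deg 0%MM = 0%MM.
Proof. by apply/mnmP=> v; rewrite degE mnm0E big1 // => i _; rewrite mnm0E muln0. Qed.

Lemma degMn u k : deg (u *+ k)%MM = (deg u *+ k)%MM.
Proof. by elim: k => [|k IH]; rewrite ?mulm0n ?deg0 // !mulmS degD IH. Qed.

Lemma mdeg_deg u : mdeg (deg u) = 2 * mdeg u.
Proof.
rewrite /deg mdeg_sum mdegE big_distrr /=; apply: eq_bigr => i _.
by rewrite mdegMn mdegD !mdeg1.
Qed.

Lemma deg_gt0 (u : edge_exp) i v : 0 < u i -> 0 < incidence i v -> 0 < deg u v.
Proof.
by move=> ui iv; rewrite degE (bigD1 i) //= addn_gt0 muln_gt0 iv ui.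
Qed.

Definition vsum (l : seq 'I_n) : 'X_{1..n} := (\sum_(x <- l) U_(x))%MM.

Lemma vsumE l v : vsum l v = count_mem v l.
Proof.
rewrite /vsum mnm_sumE; elim: l => [|x l IH]; first by rewrite big_nil.
by rewrite big_cons IH mnm1E /= eq_sym.
Qed.

Lemma vsum_cons x l : vsum (x :: l) = (U_(x) + vsum l)%MM.
Proof. by rewrite /vsum big_cons. Qed.

Lemma vsum_cat l1 l2 : vsum (l1 ++ l2) = (vsum l1 + vsum l2)%MM.
Proof. by rewrite /vsum big_cat. Qed.

Lemma vsum_perm l1 l2 : perm_eq l1 l2 -> vsum l1 = vsum l2.
Proof. by move=> h; rewrite /vsum (perm_big _ h). Qed.

Definition emon x y : edge_exp :=
  if [pick i | is_ed i x y] is Some i then U_(i)%MM else 0%MM.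

Lemma emonE x y i : e x y -> emon x y i = is_ed i x y :> nat.
Proof.
move=> exy; rewrite /emon; case: pickP => [j hj|h]; last first.
  by have [j] := is_ed_ex exy; rewrite h.
rewrite mnm1E; congr (nat_of_bool _).
by apply/eqP/idP => [<-//|hi]; apply: is_ed_inj hj hi.
Qed.

Lemma deg_emon x y : e x y -> deg (emon x y) = (U_(x) + U_(y))%MM.
Proof.
move=> exy; rewrite /emon; case: pickP => [j hj|h]; last first.
  by have [j] := is_ed_ex exy; rewrite h.
rewrite /deg (bigD1 j) //= mnm1E eqxx mulm1n big1 ?addm0 => [|i /negPf nij].
  by case/orP: hj => /eqP-> //=; rewrite addmC.
by rewrite mnm1E eq_sym nij mulm0n.
Qed.

(* An unpaired last vertex and pairs that are not edges contribute nothing. *)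
Fixpoint pairing (l : seq 'I_n) : edge_exp :=
  if l is x :: l1 then if l1 is y :: l2 then (emon x y + pairing l2)%MM else 0%MM else 0%MM.

Lemma deg_pairing_odd x p : path e x p -> odd (size p) -> deg (pairing (x :: p)) = vsum (x :: p).
Proof.
have [k] := ubnP (size p); elim: k x p => // k IH x [|y [|z p]] //.
  by rewrite /= andbT => _ exy _; rewrite degD deg0 addm0 deg_emon // !vsum_cons addmA /vsum big_nil addm0.
rewrite ltnS => szp /and3P[exy eyz pp] /=; rewrite negbK => op.
rewrite degD deg_emon // IH //; last by rewrite ltnW.
by rewrite !vsum_cons !addmA.
Qed.

Lemma deg_pairing_even x p : path e x p -> ~~ odd (size p) ->
  deg (pairing (x :: p)) = vsum (belast x p).
Proof.
have [k] := ubnP (size p); elim: k x p => // k IH x [|y [|z p]] //.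
  by rewrite /= deg0 /vsum big_nil.
rewrite ltnS => szp /and3P[exy eyz pp] /=; rewrite negbK => op.
rewrite degD deg_emon // IH //; last by rewrite ltnW.
by rewrite !vsum_cons !addmA.
Qed.

(** [pairing (x :: q)] takes the first, third, ... edge of the closed walk and [pairing q] the
    others; each of them covers every visit of a vertex once. This is the binomial of an even closed
    walk. *)
Lemma closed_walk_degrees x q : path e x q -> last x q = x -> ~~ odd (size q) ->
  deg (pairing (x :: q)) = vsum q /\ deg (pairing q) = vsum q.
Proof.
move=> pq lq oq; split.
  rewrite deg_pairing_even //; apply: vsum_perm.
  have : perm_eq (rcons (belast x q) (last x q)) (x :: q) by rewrite -lastI.
  by rewrite lq perm_rcons perm_cons.
case: q pq lq oq => [|y q] //=; first by rewrite deg0 /vsum big_nil.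
by case/andP=> _ pq _; rewrite negbK => /deg_pairing_odd->.
Qed.

Local Open Scope ring_scope.

Definition red (u : edge_exp) : 'rV['F_2]_m := \row_i (u i)%:R.

Lemma redD u1 u2 : red (u1 + u2)%MM = red u1 + red u2.
Proof. by apply/rowP=> i; rewrite !mxE mnmDE natrD. Qed.

Lemma red0 : red 0%MM = 0.
Proof. by apply/rowP=> i; rewrite !mxE mnm0E. Qed.

Definition evec x y : 'rV['F_2]_m := \row_i (is_ed i x y)%:R.

Lemma evecC x y : evec x y = evec y x.
Proof. by apply/rowP=> i; rewrite !mxE is_edC. Qed.

Lemma red_emon x y : e x y -> red (emon x y) = evec x y.
Proof. by move=> exy; apply/rowP=> i; rewrite !mxE emonE. Qed.

Fixpoint wsum x (p : seq 'I_n) : 'rV['F_2]_m :=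
  if p is y :: q then evec x y + wsum y q else 0.

Lemma wsum_cat x p q : wsum x (p ++ q) = wsum x p + wsum (last x p) q.
Proof. by elim: p x => [|y p IH] x /=; rewrite ?add0r // IH addrA. Qed.

Lemma wsum_rev x p : wsum (last x p) (rev (belast x p)) = wsum x p.
Proof.
elim: p x => //= y p IH x; rewrite rev_cons -cats1 wsum_cat IH /= addr0 addrC.
have -> : last (last y p) (rev (belast y p)) = y.
  by case: p {IH} => //= z p; rewrite rev_cons last_rcons.
by rewrite evecC.
Qed.

Lemma red_pairing x p : path e x p -> red (pairing (x :: p)) + red (pairing p) = wsum x p.
Proof.
elim: p x => [|y p IH] x /=; first by rewrite red0 addr0.
by case/andP=> exy pp; rewrite redD red_emon // -addrA [red _ + red _]addrC (IH y pp).
Qed.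

Definition chi C : 'rV['F_2]_m := \row_i (((ed i).1 \in C) && ((ed i).2 \in C))%:R.

Lemma map_next_rot (c : seq 'I_n) : uniq c -> map (next c) c = rot 1 c.
Proof.
case: c => // a p Uc; rewrite rot1_cons.
apply: (@eq_from_nth _ a) => [|k]; rewrite size_map ?size_rcons // => ltk.
rewrite (nth_map a) // next_nth mem_nth // index_uniq // nth_rcons /=.
case: ltnP => // h; case: eqP => // [->|]; first by rewrite nth_default.
by move=> nk; rewrite nth_default.
Qed.

Lemma wsum_zip x p : wsum x p = \sum_(pr <- zip (belast x p) p) evec pr.1 pr.2.
Proof. by elim: p x => [|y p IH] x /=; rewrite ?big_nil // big_cons IH. Qed.

(** Without chords, the edges with both ends on the cycle are those it traverses, each once. *)
Lemma wsum_hole a p : odd_chordless_cycle e (a :: p) ->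
  wsum a (rcons p a) = chi [set x in a :: p].
Proof.
move=> hc; have /and5P[Uc sc oc cc hch] := hc; set c := a :: p in hc Uc sc oc cc hch *.
have -> : wsum a (rcons p a) = \sum_(x <- c) evec x (next c x).
  rewrite wsum_zip belast_rcons -/c.
  have -> : rcons p a = rot 1 c by rewrite rot1_cons.
  rewrite -map_next_rot // -{1}[c]map_id zip_map big_map.
  by apply: eq_bigr.
clearbody c; have inc z : (z \in [set x in c]) = (z \in c) by rewrite inE.
apply/rowP=> i; rewrite summxE mxE !inc.
set s := (ed i).1; set t := (ed i).2.
have nst : s != t := ed_neq i.
have evE x : evec x (next c x) 0 i =
    (x == s)%:R * (next c s == t)%:R + (x == t)%:R * (next c t == s)%:R.
  rewrite mxE /is_ed [ed i]surjective_pairing -/s -/t !xpair_eqE.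
  case: (eqVneq x s) => [->|nxs].
    by rewrite [t == s]eq_sym (negPf nst) andbF orbF mul0r addr0 mul1r eq_sym.
  rewrite /= mul0r add0r [t == x]eq_sym.
  by case: (eqVneq x t) => [->|_]; rewrite ?andbT ?andbF ?mul0r // mul1r eq_sym.
have big1x (z : 'I_n) : \sum_(x <- c) (x == z)%:R = (z \in c)%:R :> 'F_2.
  rewrite -(count_uniq_mem _ Uc) -sum1_count natr_sum [RHS]big_mkcond /=.
  by apply: eq_bigr => x _; case: eqP.
rewrite (eq_bigr _ (fun x _ => evE x)) big_split /= -!mulr_suml !big1x.
have [sc'|nsc] := boolP (s \in c); have [tc|ntc] := boolP (t \in c); rewrite /= ?mul0r ?mul1r ?add0r ?addr0 //.
(* Exactly one end of the edge is the successor of the other, because the cycle has more than two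
   vertices. *)
- move/forallP: hch => /(_ s)/forallP/(_ t); rewrite sc' tc ed_edge /=.
  rewrite ![_ == next c _]eq_sym.
  case: (eqVneq (next c s) t) => h1; case: (eqVneq (next c t) s) => h2;
    rewrite ?addr0 ?add0r //.
  have := next_neq_prev Uc sc sc'; rewrite h1 -h2 prev_next // eqxx //.
- by case: eqP => // h; move: ntc; rewrite -h mem_next sc'.
by case: eqP => // h; move: nsc; rewrite -h mem_next tc.
Qed.

End EdgeMonomials.

(** * Spans of the minimal binomials modulo 2 *)

Section SpanSystem.
Variables (n : nat) (e : rel 'I_n).
Hypothesis esym : ssrbool.symmetric e.
Hypothesis eirr : irreflexive e.
Implicit Types (S W B C A Y : {set 'I_n}) (x y v : 'I_n) (d : 'X_{1..n}).

Local Notation m := (size (edges e)).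

(* Z D stands for the span of the classes mod 2 of the minimal binomials whose degree satisfies D. *)
Record span_system (Z : pred 'X_{1..n} -> 'rV['F_2]_m -> Prop) : Prop := SpanSystem {
  span_pair : forall (D : pred 'X_{1..n}) (u w : 'X_{1..m}), deg u = deg w ->
    (forall d, (d <= deg u)%MM -> D d) -> Z D (red u + red w)%R;
  span_ann : forall (D : pred 'X_{1..n}) (z : 'rV_m) (mu : 'cV_m),
    (forall u w : 'X_{1..m}, deg u = deg w -> D (deg u) -> ((red u + red w) *m mu = 0)%R) ->
    Z D z -> (z *m mu = 0)%R;
  span_split : forall (D1 D2 D3 : pred 'X_{1..n}) (z1 z2 z3 : 'rV_m),
    Z D1 z1 -> Z D2 z2 -> Z D3 z3 -> (z1 = z2 + z3)%R ->
    exists z z' : 'rV_m, [/\ Z (predI D1 D2) z, Z (predI D1 D3) z' & (z1 = z + z')%R];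
  span_mono : forall (D D' : pred 'X_{1..n}) (z : 'rV_m), (forall d, D d -> D' d) -> Z D z -> Z D' z;
  span_zero : forall D, Z D 0%R }.

Variable Z : pred 'X_{1..n} -> 'rV['F_2]_m -> Prop.
Hypothesis HZ : span_system Z.

Definition supp_in S : pred 'X_{1..n} := fun d => [forall v, (0 < d v) ==> (v \in S)].

Lemma supp_inP S d : reflect (forall v, 0 < d v -> v \in S) (supp_in S d).
Proof. by apply: (iffP forallP) => h v; apply/implyP; apply: h. Qed.

Lemma supp_inW S W d : S \subset W -> supp_in S d -> supp_in W d.
Proof. by move=> sSW /supp_inP h; apply/supp_inP=> v /h; apply: subsetP. Qed.

Lemma supp_inI S W d : supp_in S d -> supp_in W d -> supp_in (S :&: W) d.
Proof. by move=> /supp_inP h /supp_inP h'; apply/supp_inP=> v dv; rewrite inE h ?h'. Qed.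

Lemma row_coord (z : 'rV['F_2]_m) i : (z 0 i = (z *m delta_mx i 0) 0 (0 : 'I_1))%R.
Proof.
rewrite mxE (bigD1 i) //= big1 ?mxE ?eqxx ?mulr1 ?addr0 // => j /negPf nij.
by rewrite mxE nij mulr0.
Qed.

(** Split z = z + 0 with the empty predicate for 0: the second summand is then annihilated by every
    functional, hence zero. *)
Lemma span_inter (D1 D2 : pred 'X_{1..n}) z : Z D1 z -> Z D2 z -> Z (predI D1 D2) z.
Proof.
move=> h1 h2; have [|a [b [ha hb ->]]] := span_split HZ h1 h2 (span_zero HZ pred0).
  by rewrite addr0.
suff -> : b = 0%R by rewrite addr0.
apply/rowP=> i; rewrite row_coord (span_ann HZ _ hb) ?mxE // => u v _ /=.
by rewrite andbF.
Qed.

Lemma span_inter_all (T : eqType) (D : pred 'X_{1..n}) (Dv : T -> pred 'X_{1..n}) (l : seq T) z :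
  Z D z -> (forall v : T, v \in l -> Z (Dv v) z) ->
  Z (fun d => D d && all (fun v : T => Dv v d) l) z.
Proof.
move=> h0; elim: l => [|v l IH] h.
  by apply: span_mono h0 => // d; rewrite andbT.
have hv := h v (mem_head _ _).
have := span_inter (IH (fun (w : T) wl => h w (@mem_behead _ (v :: l) _ wl))) hv.
by apply: span_mono => // d /= /andP[/andP[-> ->] ->].
Qed.

(** An edge not contained in [S] does not occur in any monomial whose degree is supported in [S], so
    its coordinate annihilates the span. *)
Lemma span_supp S z i : Z (supp_in S) z -> z 0%R i != 0%R ->
  ((ed i).1 \in S) /\ ((ed i).2 \in S).
Proof.
move=> hz nz; apply/andP/negPn/negP=> nS; case/eqP: nz.
rewrite row_coord (span_ann HZ _ hz) ?mxE // => u v duv /supp_inP hD.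
have h0 w : deg w = deg u -> w i = 0.
  move=> dw; apply/eqP/negPn/negP; rewrite -lt0n => wi; case/negP: nS.
  have h (t : 'I_n) : 0 < incidence i t -> t \in S.
    by move=> it; apply: hD; rewrite -dw; apply: deg_gt0 wi it.
  by rewrite !h // /incidence eqxx ?addn1.
apply/matrixP=> a b; rewrite !mxE (bigD1 i) //= big1 => [|j /negPf nij].
  by rewrite !mxE (h0 u) // (h0 v) // !mulr0n !addr0 mul0r.
by rewrite !mxE nij mulr0.
Qed.

Definition crosses C (i : 'I_m) := ((ed i).1 \in C) != ((ed i).2 \in C).

Lemma incidence_sum C (i : 'I_m) :
  \sum_(c in C) incidence i c = ((ed i).1 \in C) + ((ed i).2 \in C).
Proof.
have one t : \sum_(c in C) (t == c) = (t \in C).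
  rewrite big_mkcond (bigD1 t) //= eqxx big1 ?addn0 => [|j]; first by case: (t \in C).
  by rewrite eq_sym => /negPf->; case: ifP.
by rewrite big_split /= !one.
Qed.

Lemma deg_sum C (u : 'X_{1..m}) : \sum_(c in C) deg u c =
  2 * (\sum_i (((ed i).1 \in C) && ((ed i).2 \in C)) * u i) + \sum_(i | crosses C i) u i.
Proof.
have -> : \sum_(c in C) deg u c = \sum_(c in C) \sum_i incidence i c * u i.
  by apply: eq_bigr => c _; rewrite degE.
rewrite exchange_big /= big_distrr [X in _ = _ + X]big_mkcond -big_split /=.
apply: eq_bigr => i _; rewrite -big_distrl /= incidence_sum /crosses.
by case: (_ \in C); case: (_ \in C); rewrite /= ?mul1n ?mul0n ?muln0 ?addn0.
Qed.

(* The number of edges inside C is determined mod 2 as soon as at most one unit of degree leaves C. *)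
Lemma span_parity C (a : 'I_n) (D : pred 'X_{1..n}) z : Z D z ->
  (forall d i, D d -> crosses C i -> 0 < d (ed i).1 -> 0 < d (ed i).2 ->
     0 < incidence i a /\ d a <= 1) ->
  (z *m (chi e C)^T = 0)%R.
Proof.
move=> hz hD; apply: (span_ann HZ _ hz) => u v duv Du.
pose inside (w : 'X_{1..m}) := \sum_i (((ed i).1 \in C) && ((ed i).2 \in C)) * w i.
pose cross (w : 'X_{1..m}) := \sum_(i | crosses C i) w i.
(* All crossing edges that occur in [w] contain [a], so their number is at most the degree at
   [a]. *)
have cross1 w : deg w = deg u -> cross w <= 1.
  move=> dw; case: (posnP (cross w)) => [->//|].
  rewrite lt0n sum_nat_eq0 => /forallPn[i]; rewrite negb_imply -lt0n => /andP[ci wi].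
  have wpos j : 0 < w j -> 0 < deg u (ed j).1 /\ 0 < deg u (ed j).2.
    move=> wj; rewrite -dw; split; apply: (deg_gt0 wj); rewrite /incidence eqxx ?addn1 //.
  have [di1 di2] := wpos i wi; have [_ da] := hD _ _ Du ci di1 di2.
  apply: leq_trans da; rewrite -dw degE /cross big_mkcond; apply: leq_sum => j _.
  case: ifP => // cj; case: (posnP (w j)) => [->//|wj].
  have [dj1 dj2] := wpos j wj; have [ja _] := hD _ _ Du cj dj1 dj2.
  by rewrite leq_pmull.
(* Twice the inside count plus the crossing count is the same for [u] and [v]; as the latter is 0 or
   1, both counts agree. *)
have eqin : inside u = inside v.
  have := deg_sum C v; rewrite -duv deg_sum -/(inside u) -/(inside v) -/(cross u) -/(cross v).
  have := cross1 u erefl; have := cross1 v (Logic.eq_sym duv).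
  move: (inside u) (inside v) (cross u) (cross v) => a1 a2 b1 b2; clear; lia.
apply/matrixP=> p q; rewrite !ord1 !mxE {p q}.
have -> : (\sum_j (red u + red v)%R 0%R j * (chi e C)^T j 0 = (inside u + inside v)%:R :> 'F_2)%R.
  rewrite natrD !natr_sum -big_split /=; apply: eq_bigr => i _.
  by rewrite !mxE !natrM mulrDl ![((_ && _)%:R * _)%R]mulrC.
by rewrite eqin F2_double.
Qed.

Lemma span_deg D z v : Z D z -> (\sum_i z 0 i * (incidence i v)%:R = 0)%R.
Proof.
move=> hz; have h : (z *m (\col_i (incidence i v)%:R) = 0)%R.
  apply: (span_ann HZ _ hz) => u w duw _; apply/matrixP=> p q; rewrite !ord1 !mxE {p q}.
  have -> : (\sum_j (red u + red w)%R 0%R j * (\col_i (incidence i v)%:R)%R j 0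
      = (deg u v + deg w v)%:R :> 'F_2)%R.
    rewrite natrD !degE !natr_sum -big_split /=; apply: eq_bigr => i _.
    by rewrite !mxE !natrM mulrDl ![(_%:R * (incidence _ _)%:R)%R]mulrC.
  by rewrite duw F2_double.
move/matrixP/(_ 0%R 0%R): h; rewrite !mxE => h; rewrite -[RHS]h.
by apply: eq_bigr => i _; rewrite !mxE.
Qed.

(** This is [span_parity] for the full vertex set, which no edge crosses; hence any vertex serves as
    [a]. *)
Lemma span_total D z : Z D z -> (\sum_i z 0 i = 0)%R.
Proof.
case: (pickP 'I_n) => [a _ hz|no]; last first.
  move=> _; rewrite big1 // => i _; by have := no (ed i).1.
have h : (z *m (chi e setT)^T = 0)%R.
  by apply: (@span_parity setT a D z hz) => d i _; rewrite /crosses !inE.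
move/matrixP/(_ 0%R 0%R): h; rewrite !mxE => h; rewrite -[RHS]h.
by apply: eq_bigr => i _; rewrite !mxE !inE mulr1.
Qed.

(** The bound 1 on [C :\: W] records that the walk runs around [C] only once; it is the source of
    the bound [d a <= 1] demanded by [span_parity]. *)
Definition hole_walk_degrees C W : pred 'X_{1..n} :=
  fun d => supp_in (C :|: W) d && [forall v in C :\: W, d v <= 1].

(* The even closed walk which runs around C, walks through W to C', runs around C' and walks back. *)
Lemma span_hole_pair C C' W a : odd_hole e C -> odd_hole e C' -> connected_on e W ->
  a \in C -> a \in W -> C' \subset W -> Z (hole_walk_degrees C W) (chi e C + chi e C')%R.
Proof.
move=> hC hC' cW aC aW sC'.
have [p [ocp eC op]] := odd_hole_rot hC aC.
have /card_gt0P[b bC'] : 0 < #|C'| by apply: ltn_trans (odd_hole_card hC').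
have [p' [ocp' eC' op']] := odd_hole_rot hC' bC'.
have [q [pq lq _ sq]] := connected_on_upath cW aW (subsetP sC' _ bC').
have cyc : path e a (rcons p a) by case/and5P: ocp.
have cyc' : path e b (rcons p' b) by case/and5P: ocp'.
pose w := rcons p a ++ q ++ rcons p' b ++ rev (belast a q).
have pback : path e b (rev (belast a q)) by rewrite -lq rcons_path_rev.
have lback : last b (rev (belast a q)) = a.
  by rewrite -lq; case: (q) => //= y r; rewrite rev_cons last_rcons.
have pw : path e a w.
  by rewrite !cat_path !last_rcons lq cyc pq cyc' pback.
have lw : last a w = a by rewrite !last_cat !last_rcons.
have ow : ~~ odd (size w).
  rewrite !size_cat !size_rcons size_rev size_belast !oddD /=.
  by rewrite (negPf op) (negPf op') /=; case: (odd _).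
have ww : wsum e a w = (chi e C + chi e C')%R.
  rewrite !wsum_cat !last_rcons lq wsum_hole // -eC wsum_hole // -eC'.
  by rewrite -lq wsum_rev [(chi e C' + _)%R]addrC [(wsum _ _ _ + _)%R]addrA F2_addrr add0r.
have [d1 d2] := closed_walk_degrees esym eirr pw lw ow.
rewrite -ww -(red_pairing esym eirr pw).
apply: (span_pair HZ); first by rewrite d1 d2.
rewrite d1 => d /mnm_lepP led; apply/andP; split.
  apply/supp_inP=> v dv; have : 0 < vsum w v by apply: leq_trans (led v).
  rewrite vsumE -has_count => /hasP[v' vw /eqP ev]; move: vw; rewrite {}ev !mem_cat inE.
  rewrite !mem_rcons mem_rev; case/or4P=> [vp|vq|vp'|vb].
  - by rewrite eC inE vp.
  - by rewrite (sq v) ?orbT // inE vq orbT.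
  - by rewrite (subsetP sC') ?orbT // eC' inE.
  - by rewrite (sq v) ?orbT // mem_belast.
apply/forall_inP=> v; rewrite inE => /andP[vW vC]; apply: leq_trans (led v) _.
have va : v != a by apply: contraNneq vW => ->.
rewrite vsumE !count_cat.
have c0 (l : seq 'I_n) : {subset l <= W} -> count_mem v l = 0.
  move=> sl; apply/eqP; rewrite -leqn0 leqNgt -has_count; apply/hasPn=> y yl.
  by apply: contraNneq vW => <-; apply: sl.
rewrite (c0 q) => [|y yq]; last by apply: sq; rewrite inE yq orbT.
rewrite (c0 (rcons p' b)) => [|y]; last first.
  by rewrite mem_rcons => yp; apply: (subsetP sC'); rewrite eC' inE.
rewrite (c0 (rev _)) => [|y]; last by rewrite mem_rev => /mem_belast/sq.
rewrite !addn0 -cats1 count_cat /= eq_sym (negPf va) !addn0.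
rewrite count_uniq_mem; last by case/and5P: ocp => /= /andP[].
by case: (_ \in _).
Qed.

Lemma span_hole_pair_supp C C' W a : odd_hole e C -> odd_hole e C' -> connected_on e W ->
  a \in C -> a \in W -> C' \subset W -> Z (supp_in (C :|: W)) (chi e C + chi e C')%R.
Proof.
move=> hC hC' cW aC aW sC'; apply: span_mono (span_hole_pair hC hC' cW aC aW sC') => // d.
by case/andP.
Qed.

Lemma chi_total C : odd_hole e C -> (\sum_i chi e C 0 i = 1)%R.
Proof.
move=> hC; have /card_gt0P[a aC] : 0 < #|C| by apply: ltn_trans (odd_hole_card hC).
have [p [ocp -> op]] := odd_hole_rot hC aC.
rewrite -wsum_hole //; have : path e a (rcons p a) by case/and5P: ocp.
have tot x q : path e x q -> (\sum_i wsum e x q 0 i = (size q)%:R)%R.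
  elim: q x => [|y q IH] x /=; first by rewrite big1 // => i _; rewrite mxE.
  case/andP=> exy /IH IHq; rewrite -[(size q).+1]add1n natrD -IHq.
  have [i hi] := is_ed_ex esym eirr exy.
  have <- : (\sum_j evec e x y 0 j = 1%:R)%R.
    rewrite (bigD1 i) //= big1 ?addr0 => [|j nij]; first by rewrite mxE hi.
    by rewrite mxE; case: (boolP (is_ed j x y)) => // hj; rewrite (is_ed_inj hj hi) eqxx in nij.
  by rewrite -big_split; apply: eq_bigr => j _; rewrite mxE.
move/tot->; rewrite size_rcons -[(size p).+1]addn1 natrD.
rewrite -[size p]odd_double_half (negPf op) add0n -addnn F2_double add0r //.
Qed.

Lemma chi_chi C : odd_hole e C -> ((chi e C *m (chi e C)^T) 0 0 = 1)%R.
Proof.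
move=> hC; rewrite mxE -(chi_total hC); apply: eq_bigr => i _; rewrite !mxE.
by case: (_ && _); rewrite ?mulr0 ?mulr1.
Qed.

Lemma chi_disjoint C C' i : (forall x y, x \in C -> y \in C -> x \in C' -> y \in C' -> x = y) ->
  chi e C 0%R i != 0%R -> chi e C' 0%R i = 0%R.
Proof.
move=> h; rewrite !mxE; case: (boolP (_ && _)) => // /andP[c1 c2] _.
case: (boolP (_ && _)) => // /andP[c1' c2'].
by have := ed_neq eirr i; rewrite (h _ _ c1 c2 c1' c2') eqxx.
Qed.

Lemma chi_orth C C' : (forall x y, x \in C -> y \in C -> x \in C' -> y \in C' -> x = y) ->
  ((chi e C' *m (chi e C)^T) 0 0 = 0)%R.
Proof.
move=> h; rewrite mxE big1 // => i _; rewrite [(_^T)%R _ _]mxE.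
by case: (eqVneq (chi e C 0 i) 0)%R => [->|/(chi_disjoint h)->]; rewrite ?mulr0 ?mul0r.
Qed.

Lemma odd_hole_edge C x : odd_hole e C -> x \in C ->
  exists i, chi e C 0%R i != 0%R /\ ((ed i).1 = x \/ (ed i).2 = x).
Proof.
move=> hC xC; have : 0 < #|[set y in C | e x y]| by rewrite odd_hole_deg2.
case/card_gt0P=> y; rewrite inE => /andP[yC exy].
have [i hi] := is_ed_ex esym eirr exy; exists i.
by rewrite mxE; case/orP: hi => /eqP->; rewrite /= xC yC; split=> //; [left|right].
Qed.

(** The edges available to [z] are those of [C] and at most one pendant edge at [w]. Since [z] has
    even degree at every vertex, the pendant edge drops out and [z] is constant along [C]. It is not
    [chi e C], which has an odd number of edges, contrary to [span_total]. *)
Lemma span_hole_trivial C w (X : {set 'I_n}) (z : 'rV['F_2]_m) : odd_hole e C -> X \subset w |: C ->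
  (w \in C) || (#|[set y in C | e w y]| <= 1) -> Z (supp_in X) z -> z = 0%R.
Proof.
move=> hC sX hw hz; pose zf x y : 'F_2 := (\sum_i z 0 i * (is_ed i x y)%:R)%R.
have zfC x y : zf x y = zf y x by apply: eq_bigr => i _; rewrite is_edC.
have zfE x y i : is_ed i x y -> zf x y = z 0%R i.
  move=> hi; rewrite /zf (bigD1 i) //= hi mulr1 big1 ?addr0 // => j nij.
  case: (boolP (is_ed j x y)) => [hj|_]; last by rewrite mulr0.
  by rewrite (is_ed_inj hj hi) eqxx in nij.
have zf0 x y : ~~ [&& e x y, x \in X & y \in X] -> zf x y = 0%R.
  move=> h; rewrite /zf big1 // => i _; case: (boolP (is_ed i x y)) => hi; rewrite ?mulr0 // mulr1.
  apply/eqP/negPn/negP => /(span_supp hz) [s1 s2]; case/negP: h.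
  rewrite (is_ed_edge esym hi) /=.
  by case/orP: hi => /eqP hi; move: s1 s2; rewrite hi /= => -> ->.
have zfdeg v : (\sum_y zf v y = 0)%R.
  rewrite -[RHS](span_deg v hz) exchange_big /=; apply: eq_bigr => i _; rewrite -mulr_sumr.
  congr (_ * _)%R; rewrite -natr_sum; congr (_%:R)%R.
  rewrite /incidence /is_ed; have := ed_neq eirr i; case: (ed i) => s t /= nst.
  rewrite (eq_bigr (fun y => (s == v) * (t == y) + (t == v) * (s == y))) => [|y _].
    rewrite big_split /= -!big_distrr /=.
    have one u : \sum_y (u == y) = 1.
      by rewrite (bigD1 u) //= eqxx big1 ?addn0 // => j; rewrite eq_sym => /negPf->.
    by rewrite !one !muln1.
  rewrite !xpair_eqE; case: (eqVneq s v) => [esv|nsv] /=.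
    have ntv : (t == v) = false by rewrite -esv eq_sym (negPf nst).
    by rewrite ntv mul1n mul0n addn0 andbF orbF.
  by rewrite mul0n add0n; case: (t == v); case: (s == y).
have zfw y : w \notin C -> zf w y = 0%R.
  move=> wC; move: hw; rewrite (negPf wC) /= => N1.
  have inN y' : zf w y' != 0%R -> y' \in [set y in C | e w y].
    move=> nz; have : [&& e w y', w \in X & y' \in X] by apply: contraNT nz => /zf0->.
    case/and3P=> ewy _ /(subsetP sX); rewrite !inE ewy => /orP[/eqP ey|->//].
    by move: ewy; rewrite ey eirr.
  apply/eqP/negPn/negP=> nz; case/eqP: (nz); rewrite -[RHS](zfdeg w) (bigD1 y) //= big1 ?addr0 // => y' nyy.
  apply/eqP/negPn/negP=> nz'; case/negP: nyy; apply/eqP.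
  by move/card_le1_eqP: N1 => /(_ y' y (inN _ nz') (inN _ nz)).
have zfnC x y : x \notin C -> zf x y = 0%R.
  move=> xC; case: (eqVneq x w) => [exw|nxw]; first by rewrite exw zfw // -exw.
  apply: zf0; apply/and3P=> -[_ /(subsetP sX)]; rewrite !inE (negPf nxw) /=.
  by rewrite (negPf xC).
have zfeq v y y' : v \in C -> y \in C -> y' \in C -> e v y -> e v y' -> zf v y = zf v y'.
  move=> vC yC yC' evy evy'; case: (eqVneq y y') => [->//|nyy].
  have N2 : [set y in C | e v y] = [set y; y'].
    apply/eqP; rewrite eq_sym eqEcard odd_hole_deg2 // cards2 nyy andbT.
    by apply/subsetP=> t; rewrite !inE => /orP[]/eqP->; rewrite ?yC ?yC' ?evy ?evy'.
  have := zfdeg v; rewrite (bigD1 y) //= (bigD1 y') 1?eq_sym //= big1 ?addr0.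
    by move/eqP; rewrite addr_eq0 F2_opp => /eqP.
  move=> t /andP[nty nty']; case: (boolP (t \in C)) => tC; last by rewrite zfC zfnC.
  apply: zf0; apply/and3P=> -[evt _ _].
  have : t \in [set y in C | e v y] by rewrite inE tC.
  by rewrite N2 !inE (negPf nty) (negPf nty').
apply/eqP/negPn/negP=> nz.
have [i zi] : exists i, z 0%R i != 0%R.
  apply/existsP; apply: contraNT nz; rewrite negb_exists => /forallP h.
  by apply/eqP/rowP=> i; rewrite mxE; apply/eqP/negPn.
(* Constancy of [z] at each vertex makes [T] closed under adjacency in [C], so one nonzero edge
   forces all of them. *)
pose T := [set v in C | [exists y in C, e v y && (zf v y != 0%R)]].
have clT : closed (induced e C) (mem T).
  apply: (intro_closed (connect_induced_sym esym C)) => a b /and3P[eab aC bC].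
  rewrite !inE aC bC /= => /exists_inP[y yC /andP[eay nzy]].
  apply/exists_inP; exists a => //; rewrite esym eab zfC.
  by rewrite (zfeq a b y).
have h12 := ed_is_ed i; have zf12 := zfE _ _ _ h12.
have sC : (ed i).1 \in C by apply: contraNT zi => /(zfnC _ (ed i).2); rewrite zf12 => ->.
have tC : (ed i).2 \in C.
  by apply: contraNT zi => /(zfnC _ (ed i).1); rewrite zfC zf12 => ->.
have sT : (ed i).1 \in T.
  rewrite inE sC; apply/exists_inP; exists (ed i).2 => //.
  by rewrite (ed_edge i) zf12.
have TC v : v \in C -> v \in T.
  move=> vC; have /connected_onP cC := odd_hole_connected esym hC.
  by have := closed_connect clT (cC _ _ sC vC); rewrite sT => <-.
have zE : z = chi e C.
  apply/rowP=> j; rewrite mxE; have zfj := zfE _ _ _ (ed_is_ed j).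
  case: (boolP (_ \in C)) => s1 /=; last by rewrite -zfj zfnC.
  case: (boolP (_ \in C)) => s2 /=; last by rewrite -zfj zfC zfnC.
  apply: F2_eq1; rewrite -zfj; have := TC _ s1; rewrite inE => /andP[_ /exists_inP[y yC /andP[ey nz']]].
  by rewrite (zfeq _ _ y) // (ed_edge j).
have := span_total hz; rewrite zE chi_total // => /eqP; by rewrite oner_eq0.
Qed.

End SpanSystem.

(** * Odd holes in and across blocks *)

Section BlocksAndHoles.
Variables (n : nat) (e : rel 'I_n).
Hypothesis esym : ssrbool.symmetric e.
Hypothesis eirr : irreflexive e.
Implicit Types (S W B C A Y : {set 'I_n}) (x y v : 'I_n) (d : 'X_{1..n}).

Definition odd_cycle_condition : Prop := forall C C' : {set 'I_n},
  odd_hole e C -> odd_hole e C' -> [disjoint C & C'] -> exists x y, [/\ x \in C, y \in C' & e x y].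

(** Cut a simple path from [t] to [x] just before [x]. When [Y] meets a block only in [x], the
    result is a set outside the block to which [block_attachment] applies. *)
Lemma adjacent_part Y x t : connected_on e Y -> x \in Y -> t \in Y -> t != x ->
  exists W w, [/\ connected_on e W, W \subset Y :\ x, t \in W, w \in W & e x w].
Proof.
move=> cY xY tY ntx; have [p [pp lp Up sp]] := connected_on_upath cY tY xY.
case/lastP: p pp lp Up sp => [|p y] /=; first by move=> _ tx; rewrite tx eqxx in ntx.
rewrite rcons_path last_rcons => /andP[pp ey] yx; rewrite yx in ey * => {y yx}.
rewrite mem_rcons inE negb_or rcons_uniq => /andP[/andP[_ tp] /andP[xp Up]] sp.
exists [set z in t :: p], (last t p); split.
- exact: connected_on_path.
- apply/subsetP=> z; rewrite !inE => zp; apply/andP; split.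
    by apply: contraTneq zp => ->; rewrite negb_or eq_sym ntx.
  by apply: sp; rewrite inE mem_rcons inE; case/orP: zp => ->; rewrite ?orbT.
- by rewrite inE mem_head.
- by rewrite inE mem_last.
by rewrite esym.
Qed.

(** The two arcs of [C] between [a] and [a'] have inner lengths of different parity. Closing the
    even one through [x] gives an odd closed walk that misses a vertex of the other arc. A hole on
    this walk contains [x]: otherwise it would be contained in [C], hence equal to [C], which has
    the missed vertex. *)
Lemma two_neighbours_hole C x a a' : odd_hole e C -> x \notin C ->
  a \in C -> a' \in C -> a != a' -> e x a -> e x a' ->
  exists2 A, odd_hole e A & (x \in A) && (A :\ x \subset C).
Proof.
move=> hC xC aC aC' naa exa exa'; have [p [ocp eC op]] := odd_hole_rot hC aC.
have ap : a' \in p by move: aC'; rewrite eC !inE eq_sym (negPf naa).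
have /and5P[Uc _ _ cc _] := ocp.
case/splitPr: p / ap => p1 p2 in ocp eC op Uc cc *.
have [pp1 l1 pp2 l2] := cycle_split cc.
have c1 : cycle e (x :: a :: rcons p1 a').
  by rewrite /= exa rcons_path last_rcons rcons_path pp1 l1 esym exa'.
have c2 : cycle e (x :: a' :: rcons p2 a).
  by rewrite /= exa' rcons_path last_rcons rcons_path pp2 l2 esym exa.
have ext (c : seq 'I_n) y : cycle e (x :: c) -> ~~ odd (size c) -> {subset c <= C} ->
    y \in C -> y \notin c -> exists2 A, odd_hole e A & (x \in A) && (A :\ x \subset C).
  move=> cyc oc sc yC yc; have [A hA sA] := odd_closed_walk_hole esym eirr cyc oc.
  have sAC : A :\ x \subset C.
    by apply/subsetP=> z; rewrite !inE => /andP[nzx /sA]; rewrite inE (negPf nzx) => /sc.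
  exists A => //; rewrite sAC andbT; apply/negPn/negP=> xA.
  have eAC : A = C.
    apply: (odd_hole_sub_eq esym hA hC); apply: subset_trans sAC.
    by apply/subsetP=> z zA; rewrite !inE zA andbT; apply: contraNneq xA => <-.
  have := sA y; rewrite eAC yC inE (negPf yc) orbF => /(_ isT)/eqP eyx.
  by rewrite -eyx yC in xC.
move: op; rewrite size_cat /= addnS /= oddD.
have memC z : (z \in C) = [|| z == a, z \in p1, z == a' | z \in p2].
  by rewrite eC !inE mem_cat inE.
move: (Uc); rewrite /= mem_cat inE !negb_or cat_uniq /= => /and3P[/and3P[ap1 _ ap2] Up1].
rewrite negb_or => /and3P[/andP[a'p1 /hasPn dis] a'p2 Up2].
case o1: (odd (size p1)); case o2: (odd (size p2)) => // _.
- have [y yp] : exists y, y \in p1 by case: (p1) o1 => // y ? _; exists y; rewrite mem_head.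
  apply: (ext (a' :: rcons p2 a) y) => //=.
  + by rewrite size_rcons /= o2.
  + by move=> z; rewrite memC !inE mem_rcons inE => /or3P[]->; rewrite ?orbT.
  + by rewrite memC yp orbT.
  rewrite !inE mem_rcons inE !negb_or; apply/and3P; split.
  + by apply: contraNneq a'p1 => <-.
  + by apply: contraNneq ap1 => <-.
  by apply/negP=> /dis; rewrite yp.
have [y yp] : exists y, y \in p2 by case: (p2) o2 => // y ? _; exists y; rewrite mem_head.
apply: (ext (a :: rcons p1 a') y) => //=.
+ by rewrite size_rcons /= o1.
+ by move=> z; rewrite memC !inE mem_rcons inE => /or3P[]->; rewrite ?orbT.
+ by rewrite memC yp !orbT.
rewrite !inE mem_rcons inE !negb_or; apply/and3P; split.
+ by apply: contraNneq ap2 => <-.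
+ by apply: contraNneq a'p2 => <-.
exact: dis.
Qed.

Variable Z : pred 'X_{1..n} -> 'rV['F_2]_(size (edges e)) -> Prop.
Hypothesis HZ : span_system Z.

(** For each vertex v of [B] outside both holes, the holes are connected inside B minus v.
    Intersecting over all v confines the class to degrees supported on the two holes. If no edge
    joined them, nothing would cross [C], and the class would have an even number of edges in
    [C]. *)
Lemma holes_in_block_adjacent B C C' : is_block e B -> odd_hole e C -> odd_hole e C' ->
  C \subset B -> C' \subset B -> [disjoint C & C'] -> exists x y, [/\ x \in C, y \in C' & e x y].
Proof.
move=> bB hC hC' sC sC' dis.
case: (boolP [exists x in C, exists y in C', e x y]) => [/exists_inP[x xC /exists_inP[y yC exy]]|nex].
  by exists x, y.
have nadj x y : x \in C -> y \in C' -> e x y = false.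
  move=> xC yC; apply: contraNF nex => exy.
  by apply/exists_inP; exists x => //; apply/exists_inP; exists y.
have /card_gt0P[a aC] : 0 < #|C| by apply: ltn_trans (odd_hole_card hC).
have aB := subsetP sC _ aC.
have hB : Z (supp_in B) (chi e C + chi e C')%R.
  have := span_hole_pair_supp esym eirr HZ hC hC' (block_connected bB) aC aB sC'.
  by apply: (span_mono HZ) => d; apply: supp_inW; rewrite subUset sC subxx.
have hv v : v \in enum (B :\: (C :|: C')) ->
    Z (fun d => d v == 0) (chi e C + chi e C')%R.
  rewrite mem_enum !inE negb_or => /andP[/andP[vC vC'] vB].
  have := @span_hole_pair_supp _ _ esym eirr _ HZ C C' (B :\ v) a hC hC' (block_connectedD v bB) aC.
  have -> : a \in B :\ v by rewrite !inE aB andbT; apply: contraNneq vC => <-.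
  have -> : C' \subset B :\ v.
    apply/subsetP=> z zC; rewrite !inE (subsetP sC') // andbT.
    by apply: contraNneq vC' => <-.
  move=> /(_ isT isT); apply: (span_mono HZ) => d /supp_inP/(_ v).
  by rewrite lt0n !inE (negPf vC) eqxx /=; case: eqP => // _ /(_ isT).
have h := span_inter_all HZ hB hv.
have h0 : ((chi e C + chi e C') *m (chi e C)^T = 0)%R.
  apply: (span_parity HZ (a := a) h) => d i /andP[/supp_inP sd /allP zd].
  rewrite /crosses => ci d1 d2.
  have inCC t : 0 < d t -> (t \in C) || (t \in C').
    move=> dt; have tB := sd _ dt; apply/negPn/negP=> nt.
    have := zd t; rewrite mem_enum !inE tB andbT nt => /(_ isT).
    by rewrite eqn0Ngt dt.
  have := inCC _ d1; have := inCC _ d2; move: ci; have := ed_edge i.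
  case s1: ((ed i).1 \in C); case s2: ((ed i).2 \in C) => //= ee _.
    by move=> s2'; rewrite nadj in ee.
  by move=> _ s1'; rewrite esym nadj in ee.
have : (((chi e C + chi e C') *m (chi e C)^T) 0 0 = 1)%R.
  rewrite mulmxDl [LHS]mxE (chi_chi esym eirr hC) (chi_orth eirr) ?addr0 // => x y xC _ xC'.
  by rewrite (disjointFr dis xC) in xC'.
by rewrite h0 mxE => /eqP; rewrite eq_sym oner_eq0.
Qed.

(** The holes are connected through [x] while avoiding any given vertex v of [B] other than [x].
    Intersecting over v leaves degrees that vanish on [B] off [C] and [x], and are at most 1 on [C].
    If [x] had at most one neighbour [a] in [C], all edges leaving [C] in such degrees would contain
    [a], and [span_parity] would apply. *)
Lemma attachment_two_neighbours B C C' Y x : is_block e B -> odd_hole e C -> C \subset B ->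
  x \in B -> x \notin C -> connected_on e Y -> Y :&: B = [set x] ->
  odd_hole e C' -> C' \subset Y -> 1 < #|[set y in C | e x y]|.
Proof.
move=> bB hC sC xB xC cY YB hC' sC'; rewrite ltnNge; apply/negP=> N1.
have xY : x \in Y by have := set11 x; rewrite -YB inE => /andP[].
have YBx y : y \in Y -> y \in B -> y = x by move=> yY yB; apply/set1P; rewrite -YB inE yY.
(* The boolean bound means degree 0 off [C] and at most 1 on [C]. For [v] in [C] it holds because
   the connection enters [C] at another vertex. *)
have hv v : v \in enum (B :\ x) ->
    Z (fun d => supp_in (B :|: Y) d && (d v <= (v \in C))) (chi e C + chi e C')%R.
  rewrite mem_enum !inE => /andP[nvx vB].
  have [y yC nyv] : exists2 y, y \in C & y != v.
    have : 0 < #|C :\ v|.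
      by have := odd_hole_card hC; rewrite (cardsD1 v); case: (v \in C); case: #|C :\ v|.
    by case/card_gt0P=> y; rewrite !inE => /andP[nyv yC]; exists y.
  have xBv : x \in B :\ v by rewrite !inE xB eq_sym nvx.
  have yBv : y \in B :\ v by rewrite !inE nyv (subsetP sC).
  have [W [c [cW sW xW cW' WC]]] := first_hit esym (block_connectedD v bB) xBv yBv xC yC.
  have cC : c \in C by have := set11 c; rewrite -WC inE => /andP[].
  have cWY : connected_on e (W :|: Y) by apply: (connected_onU esym cW cY xW xY).
  have := span_hole_pair esym eirr HZ hC hC' cWY cC.
  rewrite inE cW' => /(_ isT (subset_trans sC' (subsetUr _ _))).
  apply: (span_mono HZ) => d /andP[sd d1]; apply/andP; split.
    apply: supp_inW sd; rewrite !subUset subsetUr (subset_trans sC) ?subsetUl //= andbT.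
    by apply: subset_trans (subset_trans sW (subD1set _ _)) (subsetUl _ _).
  have vW : v \notin W by apply/negP=> /(subsetP sW); rewrite !inE eqxx.
  have vY : v \notin Y by apply: contraNN nvx => vY; rewrite (YBx v).
  case: (boolP (v \in C)) => vC.
    by move/forall_inP: d1 => /(_ v); rewrite !inE vC (negPf vW) (negPf vY) => /(_ isT).
  rewrite leqn0 eqn0Ngt; apply/negP => /(supp_inP _ _ sd).
  by rewrite !inE (negPf vC) (negPf vW) (negPf vY).
have /card_gt0P[y0 yC0] : 0 < #|C| by apply: ltn_trans (odd_hole_card hC).
have h0 : Z (supp_in (B :|: Y)) (chi e C + chi e C')%R.
  have := hv y0; rewrite mem_enum !inE (subsetP sC) // andbT => /(_ _).
  have -> : y0 != x by apply: contraNneq xC => <-.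
  by move=> /(_ isT); apply: (span_mono HZ) => d /andP[].
have h := span_inter_all HZ h0 hv.
have [a aC Na] : exists2 a, a \in C & forall y, y \in C -> e x y -> y = a.
  case: (set_0Vmem [set y in C | e x y]) => [N0|[a]].
    by exists y0 => // y yC exy; move/setP/(_ y): N0; rewrite !inE yC exy.
  rewrite inE => /andP[aC exa]; exists a => // y yC exy.
  by move/card_le1_eqP: N1 => /(_ a y); apply; rewrite inE ?yC ?aC.
have hz : ((chi e C + chi e C') *m (chi e C)^T = 0)%R.
  apply: (span_parity HZ (a := a) h) => d i /andP[/supp_inP sd /allP zd].
  have d1 : d a <= 1.
    have := zd a; rewrite mem_enum !inE (subsetP sC) // aC andbT => /(_ _)/andP[|//].
    by apply: contraNneq xC => <-.
  (* An edge leaving [C] ends at [x], or in [Y] outside [B]; in the latter case [block_attachment]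
     would make its end in [B] equal to [x]. *)
  have key s t : s \in C -> t \notin C -> e s t -> 0 < d t -> s = a.
    move=> sCs tC est dt; have := sd _ dt; rewrite inE => tBY.
    have stx : t = x -> s = a by move=> etx; apply: Na => //; rewrite -etx esym.
    case: (boolP (t \in B)) => tB.
      case: (eqVneq t x) => [//|ntx]; have := zd t; rewrite mem_enum !inE tB ntx => /(_ isT).
      by rewrite (negPf tC) leqn0 eqn0Ngt dt andbF.
    move: tBY; rewrite (negPf tB) /= => tY.
    have ntx : t != x by apply: contraNneq tB => ->.
    have [W [w [cW sW tW wW exw]]] := adjacent_part cY xY tY ntx.
    have dWB : [disjoint W & B].
      rewrite disjoint_subset; apply/subsetP=> z /(subsetP sW); rewrite !inE => /andP[nzx zY].
      by apply: contraNN nzx => zB; rewrite (YBx z).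
    have esx := block_attachment esym bB cW dWB (subsetP sC _ sCs) xB tW wW est exw.
    by rewrite -esx sCs in xC.
  rewrite /crosses => ci di1 di2; split=> //.
  have := ed_edge i; move: ci; rewrite /incidence.
  case s1: ((ed i).1 \in C); case s2: ((ed i).2 \in C) => //= _ ee.
    by rewrite (key _ _ s1 _ ee) ?s2 ?eqxx.
  by rewrite esym in ee; rewrite (key _ _ s2 _ ee) ?s1 ?eqxx ?addn1.
have : (((chi e C + chi e C') *m (chi e C)^T) 0 0 = 1)%R.
  rewrite mulmxDl [LHS]mxE (chi_chi esym eirr hC) (chi_orth eirr) ?addr0 // => z y zC _ zC'.
  have zx := YBx z (subsetP sC' _ zC') (subsetP sC _ zC).
  by rewrite -zx zC in xC.
by rewrite hz mxE => /eqP; rewrite eq_sym oner_eq0.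
Qed.

Lemma attachment_hole B C C' Y x : is_block e B -> odd_hole e C -> C \subset B ->
  x \in B -> x \notin C -> connected_on e Y -> Y :&: B = [set x] ->
  odd_hole e C' -> C' \subset Y ->
  exists2 A, odd_hole e A & [/\ x \in A, A :\ x \subset C & A \subset B].
Proof.
move=> bB hC sC xB xC cY YB hC' sC'.
have := attachment_two_neighbours bB hC sC xB xC cY YB hC' sC'.
case/card_gt1P=> a [a' [/[!inE] /andP[aC exa] /andP[aC' exa'] naa]].
have [A hA /andP[xA sA]] := two_neighbours_hole hC xC aC aC' naa exa exa'.
exists A => //; split=> //; apply/subsetP=> z zA; case: (eqVneq z x) => [->//|nzx].
by apply: (subsetP sC); apply: (subsetP sA); rewrite !inE nzx.
Qed.

(** Split A1 + C' as (A2 + C') + (A1 + A2). The second part is confined to [A1], hence zero, so A1 +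
    C' is supported in the union of [A2] and [Y]. As [Y] meets [B] only in [x], this puts [A1]
    inside [A2], and symmetrically. *)
Lemma attachment_hole_unique B A A' C' Y x : is_block e B -> odd_hole e A -> odd_hole e A' ->
  A \subset B -> A' \subset B -> x \in A -> x \in A' -> connected_on e Y -> Y :&: B = [set x] ->
  odd_hole e C' -> C' \subset Y -> A = A'.
Proof.
move=> bB hA hA' sA sA' xA xA' cY YB hC' sC'.
have xY : x \in Y by have := set11 x; rewrite -YB inE => /andP[].
have YBx y : y \in Y -> y \in B -> y = x by move=> yY yB; apply/set1P; rewrite -YB inE yY.
suff sub A1 A2 : odd_hole e A1 -> odd_hole e A2 -> A1 \subset B -> A2 \subset B ->
    x \in A1 -> x \in A2 -> A1 \subset A2.
  by apply/eqP; rewrite eqEsubset (sub A A') // (sub A' A).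
move=> {A A' hA hA' sA sA' xA xA'} h1 h2 s1 s2 x1 x2.
have z1 := span_hole_pair_supp esym eirr HZ h1 hC' cY x1 xY sC'.
have z2 := span_hole_pair_supp esym eirr HZ h2 hC' cY x2 xY sC'.
have z3 := span_hole_pair_supp esym eirr HZ h1 h2 (odd_hole_connected esym h2) x1 x2 (subxx _).
have [|al [be [hal hbe eq1]]] := span_split HZ z1 z2 z3.
  rewrite [(chi e A1 + chi e A2)%R]addrC addrACA F2_addrr add0r addrC //.
have be0 : be = 0%R.
  apply: (@span_hole_trivial _ _ esym eirr _ HZ A1 x ((A1 :|: Y) :&: (A1 :|: A2))) => //.
  - apply/subsetP=> z; rewrite !inE; case: (z \in A1) => /=; rewrite ?orbT // !orbF.
    by case/andP=> zY z2'; rewrite (YBx z zY) // (subsetP s2).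
  - by rewrite x1.
  by apply: (span_mono HZ) hbe => d /andP[]; apply: supp_inI.
move: eq1 hal; rewrite be0 addr0 => <- hal.
apply/subsetP=> y y1; case: (eqVneq y x) => [->//|nyx].
have [i [ci ei]] := odd_hole_edge esym eirr h1 y1.
have : (chi e A1 + chi e C')%R 0%R i != 0%R.
  rewrite mxE (@chi_disjoint _ _ eirr A1 C' i) ?addr0 // => s t s1' t1 sC tC.
  have -> := YBx s (subsetP sC' _ sC) (subsetP s1 _ s1').
  by have -> := YBx t (subsetP sC' _ tC) (subsetP s1 _ t1).
have hal' : Z (supp_in (A2 :|: Y)) (chi e A1 + chi e C')%R.
  by apply: (span_mono HZ) hal => d /andP[].
move/(span_supp HZ hal') => [p1 p2].
have : y \in A2 :|: Y by case: ei => <-.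
rewrite inE => /orP[//|yY].
by have eyx := YBx y yY (subsetP s1 _ y1); rewrite eyx eqxx in nyx.
Qed.

(** Split C + C' as (A + C) + (A + C'). Apart from [x], the hole [A] lies in both [C] and [C'], so
    the two parts are confined to [C] and to [C']. Both vanish by [span_hole_trivial]. *)
Lemma avoiding_hole_unique A C C' x : odd_hole e A -> odd_hole e C -> odd_hole e C' ->
  x \in A -> x \notin C -> x \notin C' -> A :\ x \subset C -> A :\ x \subset C' -> C = C'.
Proof.
move=> hA hC hC' xA xC xC' sC sC'.
have [a aA] : exists a, a \in A :\ x.
  have : 0 < #|A :\ x| by have := odd_hole_card hA; rewrite (cardsD1 x) xA; case: #|A :\ x|.
  by case/card_gt0P=> a; exists a.
have aC := subsetP sC _ aA; have aC' := subsetP sC' _ aA.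
have aA' : a \in A by case/setD1P: aA.
have sAx (X : {set 'I_n}) : A :\ x \subset X -> A :|: X \subset x |: X.
  move=> sX; apply/subsetP=> z; rewrite !inE => /orP[zA|->]; last by rewrite orbT.
  case: (eqVneq z x) => //= nzx; by apply: (subsetP sX); rewrite !inE nzx.
have z1 := span_hole_pair_supp esym eirr HZ hC hC' (odd_hole_connected esym hC') aC aC' (subxx _).
have z2 := span_hole_pair_supp esym eirr HZ hA hC (odd_hole_connected esym hC) aA' aC (subxx _).
have z3 := span_hole_pair_supp esym eirr HZ hA hC' (odd_hole_connected esym hC') aA' aC' (subxx _).
have [|al [be [hal hbe eq1]]] := span_split HZ z1 z2 z3.
  by rewrite addrACA F2_addrr add0r.
have al0 : al = 0%R.
  apply: (@span_hole_trivial _ _ esym eirr _ HZ C a ((C :|: C') :&: (x |: C))) => //.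
  - apply/subsetP=> z; rewrite !inE; case: (z \in C) => /=; rewrite ?orbT // orbF.
    by case/andP=> zC' /eqP zx; rewrite zx (negPf xC') in zC'.
  - by rewrite aC.
  apply: (span_mono HZ) hal => d /andP[d1 d2]; apply: supp_inI => //.
  by apply: supp_inW d2; apply: sAx.
have be0 : be = 0%R.
  apply: (@span_hole_trivial _ _ esym eirr _ HZ C' a ((C :|: C') :&: (x |: C'))) => //.
  - apply/subsetP=> z; rewrite !inE; case: (z \in C') => /=; rewrite ?orbT // !orbF.
    by case/andP=> zC /eqP zx; rewrite zx (negPf xC) in zC.
  - by rewrite aC'.
  apply: (span_mono HZ) hbe => d /andP[d1 d2]; apply: supp_inI => //.
  by apply: supp_inW d2; apply: sAx.
have chiE : chi e C = chi e C'.
  by move/eqP: eq1; rewrite al0 be0 addr0 addr_eq0 F2_oppr => /eqP.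
suff sub : C \subset C' by apply: (odd_hole_sub_eq esym).
apply/subsetP=> y yC; have [i [ci ei]] := odd_hole_edge esym eirr hC yC.
move: ci; rewrite chiE mxE; case: (boolP (_ && _)) => // /andP[p1 p2] _.
by case: ei => <-.
Qed.

(** By the odd cycle condition the union of two of the holes is connected, so the class of each pair
    is supported on the pair alone. In C1 + C2 = (C1 + C3) + (C3 + C2) neither part can vanish. Each
    nonzero part forces a vertex common to [B1] and [B2], in [C2] for one part and outside [C2] for
    the other, although two blocks share at most one vertex. *)
Lemma at_most_two_blocks B1 B2 B3 C1 C2 C3 : odd_cycle_condition ->
  is_block e B1 -> is_block e B2 -> is_block e B3 ->
  B1 <> B2 -> B1 <> B3 -> B2 <> B3 ->
  odd_hole e C1 -> odd_hole e C2 -> odd_hole e C3 ->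
  C1 \subset B1 -> C2 \subset B2 -> C3 \subset B3 -> False.
Proof.
move=> occ b1 b2 b3 n12 n13 n23 h1 h2 h3 s1 s2 s3.
have conU C C' : odd_hole e C -> odd_hole e C' -> connected_on e (C :|: C').
  move=> hC hC'; have cC := odd_hole_connected esym hC; have cC' := odd_hole_connected esym hC'.
  case: (boolP [disjoint C & C']) => [dis|].
    have [x [y [xC yC exy]]] := occ _ _ hC hC' dis.
    exact: (connected_onU_edge esym cC cC' xC yC exy).
  rewrite -setI_eq0 => /set0Pn[z]; rewrite inE => /andP[zC zC'].
  exact: (connected_onU esym cC cC' zC zC').
have zz C C' : odd_hole e C -> odd_hole e C' -> Z (supp_in (C :|: C')) (chi e C + chi e C')%R.
  move=> hC hC'; have /card_gt0P[a aC] : 0 < #|C| by apply: ltn_trans (odd_hole_card hC).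
  have := span_hole_pair_supp esym eirr HZ hC hC' (conU C C' hC hC') aC.
  rewrite inE aC subsetUr => /(_ isT isT).
  by apply: (span_mono HZ) => d; apply: supp_inW; rewrite setUA setUid.
have meet C C' B B' x y : is_block e B -> is_block e B' -> B <> B' -> C \subset B -> C' \subset B' ->
    x \in C -> x \in C' -> y \in C -> y \in C' -> x = y.
  move=> bB bB' nB sC sC' xC xC' yC yC'; by apply: (blocks_meet esym bB bB' nB);
    rewrite ?(subsetP sC _ xC) ?(subsetP sC' _ xC') ?(subsetP sC _ yC) ?(subsetP sC' _ yC').
have [|al [be [hal hbe eq1]]] := span_split HZ (zz _ _ h1 h2) (zz _ _ h1 h3) (zz _ _ h3 h2).
  by rewrite addrA -[(_ + chi e C3 + chi e C3)%R]addrA F2_addrr addr0.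
(* [z] lives on [C] and the at most one vertex common to [C'] and [C'']. If that vertex lies outside
   [B], it has at most one neighbour in [C] by [block_attachment], and [span_hole_trivial]
   applies. *)
have triv C C' C'' B B' B'' z : is_block e B -> is_block e B' -> is_block e B'' -> B' <> B'' ->
    odd_hole e C -> C \subset B -> C' \subset B' -> C'' \subset B'' ->
    Z (predI (supp_in (C :|: C')) (supp_in (C :|: C''))) z -> z != 0%R ->
    exists w, [/\ w \in C', w \in C'', w \notin C & w \in B].
  move=> bB bB' bB'' nB hC sC sC' sC'' hz nz.
  have {}hz : Z (supp_in ((C :|: C') :&: (C :|: C''))) z.
    by apply: (span_mono HZ) hz => d /andP[]; apply: supp_inI.
  have [w wI] : exists w, (w \in C' :&: C'') && (w \notin C).
    apply/existsP; apply: contraNT nz; rewrite negb_exists => /forallP hI.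
    have /card_gt0P[a aC] : 0 < #|C| by apply: ltn_trans (odd_hole_card hC).
    apply/eqP/(@span_hole_trivial _ _ esym eirr _ HZ C a _ _ hC _ _ hz).
      apply/subsetP=> t; rewrite -setUIr !inE => /orP[->|tI]; first by rewrite orbT.
      by have := hI t; rewrite inE tI /= negbK => ->; rewrite orbT.
    by rewrite aC.
  case/andP: wI; rewrite inE => /andP[wC' wC''] wC; exists w; split=> //.
  apply/negPn/negP=> wB; case/eqP: nz.
  apply: (@span_hole_trivial _ _ esym eirr _ HZ C w _ _ hC _ _ hz).
    apply/subsetP=> t; rewrite -setUIr !inE => /orP[->|/andP[t' t'']]; first by rewrite orbT.
    by rewrite (@meet C' C'' B' B'' t w) ?eqxx.
  apply/orP; right; apply/card_le1_eqP=> a b; rewrite !inE => /andP[aC ewa] /andP[bC ewb].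
  rewrite esym in ewa; rewrite esym in ewb.
  have dis : [disjoint [set w] & B] by rewrite disjoints1.
  by apply: (block_attachment esym bB (connected_on1 e w) dis _ _ _ _ ewb ewa);
    rewrite ?inE // (subsetP sC).
(* The edges of [C] survive in the sum, so [C] would be covered by its intersections with [C'] and
   [C''], of at most one vertex each. *)
have contra C C' C'' B B' B'' : odd_hole e C -> is_block e B -> is_block e B' -> is_block e B'' ->
    B <> B' -> B <> B'' -> C \subset B -> C' \subset B' -> C'' \subset B'' ->
    Z (supp_in (C' :|: C'')) (chi e C + chi e C')%R -> False.
  move=> hC bB bB' bB'' nB nB' sC sC' sC'' hz.
  have sCC : C \subset (C :&: C') :|: (C :&: C'').
    apply/subsetP=> y yC; rewrite -setIUr inE yC.
    have [i [ci ei]] := odd_hole_edge esym eirr hC yC.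
    have : (chi e C + chi e C')%R 0%R i != 0%R.
      rewrite mxE (@chi_disjoint _ _ eirr C C' i) ?addr0 // => s t sC1 tC1 sC2 tC2.
      exact: (@meet C C' B B').
    by move/(span_supp HZ hz) => [p1 p2]; case: ei => <-.
  have card1 (X B0 : {set 'I_n}) : is_block e B0 -> B <> B0 -> X \subset B0 -> #|C :&: X| <= 1.
    move=> bB0 nB0 sX; apply/card_le1_eqP=> s t; rewrite !inE => /andP[? ?] /andP[? ?].
    exact: (@meet C X B B0).
  have := leq_trans (subset_leq_card sCC) (leq_card_setU _ _).
  have := leq_add (card1 C' B' bB' nB sC') (card1 C'' B'' bB'' nB' sC'').
  move=> c2 c3; have := leq_trans (odd_hole_card hC) (leq_trans c3 c2).
  by rewrite ltnn.
have hal0 : al != 0%R.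
  apply/eqP=> al0; move: eq1; rewrite al0 add0r => eq1.
  apply: (contra C1 C2 C3 B1 B2 B3) => //; rewrite eq1.
  by apply: (span_mono HZ) hbe => d /andP[_]; apply: supp_inW; rewrite setUC.
have hbe0 : be != 0%R.
  apply/eqP=> be0; move: eq1; rewrite be0 addr0 => eq1.
  apply: (contra C2 C1 C3 B2 B1 B3) => //; first exact: nesym; rewrite addrC eq1.
  by apply: (span_mono HZ) hal => d /andP[_].
have [w [w2 w3 w1 wB]] := triv C1 C2 C3 B1 B2 B3 al b1 b2 b3 n23 h1 s1 s2 s3 hal hal0.
have hbe' : Z (predI (supp_in (C2 :|: C1)) (supp_in (C2 :|: C3))) be.
  by apply: (span_mono HZ) hbe => d /=; rewrite [C2 :|: C1]setUC [C2 :|: C3]setUC.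
have [w' [w1' w3' w2' wB']] := triv C2 C1 C3 B2 B1 B3 be b2 b1 b3 n13 h2 s2 s1 s3 hbe' hbe0.
have eww : w = w'.
  by apply: (blocks_meet esym b1 b2 n12); rewrite // ?(subsetP s2 _ w2) ?(subsetP s1 _ w1').
by rewrite -eww w2 in w2'.
Qed.

End BlocksAndHoles.

(** * The odd cycle condition and the block structure *)

Section BlockStructure.
Variables (n : nat) (e : rel 'I_n).
Hypothesis esym : ssrbool.symmetric e.
Hypothesis eirr : irreflexive e.
Implicit Types (S W B C A Y : {set 'I_n}) (x y v : 'I_n) (d : 'X_{1..n}).

Definition few_nonbipartite_blocks : Prop :=
  (forall B1 B2, nonbip_block e B1 -> nonbip_block e B2 -> B1 = B2) \/
  (exists B1 B2 : {set 'I_n}, B1 <> B2 /\ nonbip_block e B1 /\ nonbip_block e B2 /\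
     (forall B, nonbip_block e B -> B = B1 \/ B = B2) /\ strongly_contiguous e B1 B2).

Lemma odd_holeE S : (exists c, odd_chordless_cycle e c /\ S = [set x in c]) <-> odd_hole e S.
Proof. by split=> [[c [hc ->]]|[c hc ->]]; exists c. Qed.

Lemma block_type1 B A : odd_hole e A -> A \subset B ->
  (forall C, odd_hole e C -> C \subset B -> C = A) -> block_type e B 1.
Proof.
move=> hA sA uA; exists [:: A]; split=> //; split=> // S; split.
  by move/[!inE]/eqP->; split=> //; apply/odd_holeE.
by case=> sS /odd_holeE hS; rewrite inE (uA S hS sS).
Qed.

Lemma block_type2 B A A' : A != A' -> odd_hole e A -> A \subset B ->
  odd_hole e A' -> A' \subset B ->
  (forall C, odd_hole e C -> C \subset B -> C = A \/ C = A') -> block_type e B 2.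
Proof.
move=> nA hA sA hA' sA' uA; exists [:: A; A']; split; first by rewrite /= inE nA.
split=> // S; split.
  by rewrite !inE => /orP[]/eqP->; split=> //; apply/odd_holeE.
by case=> sS /odd_holeE hS; case: (uA S hS sS) => ->; rewrite !inE eqxx ?orbT.
Qed.

Lemma block_type1_unique B C C' : block_type e B 1 -> odd_hole e C -> odd_hole e C' ->
  C \subset B -> C' \subset B -> C = C'.
Proof.
case=> s [_ [s1 h]] hC hC' sC sC'; case: s s1 h => [|A [|? ?]] // _ h.
have in1 S : odd_hole e S -> S \subset B -> S = A.
  move=> hS sS; apply/eqP; rewrite -mem_seq1; apply/h.
  by split=> //; apply/odd_holeE.
by rewrite (in1 C) // (in1 C').
Qed.

Lemma nonbip_block_hole B : nonbip_block e B -> exists2 C, odd_hole e C & C \subset B.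
Proof.
by case=> bB nb; apply: (nonbipartite_odd_hole esym eirr) => //; apply: block_connected.
Qed.

Lemma odd_hole_nonbip_block C : odd_hole e C -> exists2 B, nonbip_block e B & C \subset B.
Proof.
move=> hC; have [B bB sC] := biconnected_in_block (odd_hole_biconnected esym hC).
by exists B => //; split=> //; apply: odd_hole_nonbipartite hC sC.
Qed.

Lemma shared_vertexI B1 B2 x : is_block e B1 -> is_block e B2 -> B1 <> B2 ->
  x \in B1 -> x \in B2 -> B2 :&: B1 = [set x].
Proof.
move=> b1 b2 nB x1 x2; apply/setP=> y; rewrite !inE; apply/andP/eqP => [[y2 y1]|->//].
exact: (blocks_meet esym b1 b2 nB).
Qed.

(** If [c2] is not [x], a path in [B2] from [c2] to a neighbour of [x] is a set outside [B1]
    attached at both [c1] and [x]. *)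
Lemma shared_vertex_edge B1 B2 x c1 c2 : is_block e B1 -> is_block e B2 -> B1 <> B2 ->
  x \in B1 -> x \in B2 -> c1 \in B1 -> c2 \in B2 -> e c1 c2 -> c1 = x \/ c2 = x.
Proof.
move=> b1 b2 nB x1 x2 c1B c2B ec; case: (eqVneq c2 x) => [|nc2]; [by right|left].
have I12 := shared_vertexI b1 b2 nB x1 x2.
have [W [w [cW sW c2W wW exw]]] := adjacent_part esym (block_connected b2) x2 c2B nc2.
have dis : [disjoint W & B1].
  rewrite disjoint_subset; apply/subsetP=> z /(subsetP sW); rewrite !inE => /andP[nzx z2].
  by apply: contraNN nzx => z1; rewrite -in_set1 -I12 inE z2.
exact: (block_attachment esym b1 cW dis c1B x1 c2W wW ec exw).
Qed.

(** Turns two blocks joined by an edge into a block with a connected set hanging at [x], the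
    situation of the attachment lemmas. *)
Lemma edge_attachment B1 B2 x y : connected_on e B2 -> is_block e B1 -> [disjoint B2 & B1] ->
  x \in B1 -> y \in B2 -> e x y -> connected_on e (x |: B2) /\ (x |: B2) :&: B1 = [set x].
Proof.
move=> c2 b1 dis x1 y2 exy; split.
  exact: (connected_onU_edge esym (connected_on1 e x) c2 (set11 x) y2 exy).
apply/setP=> z; rewrite !inE; apply/andP/eqP => [[/orP[/eqP//|z2] z1]|->]; last by rewrite eqxx x1.
by rewrite (disjointFr dis z2) in z1.
Qed.

Variable Z : pred 'X_{1..n} -> 'rV['F_2]_(size (edges e)) -> Prop.
Hypothesis HZ : span_system Z.

(** Each block has at most one hole through [x]. A hole of [B2] avoiding [x] extends, by
    [attachment_hole], the same hole through [x], so at most one of these exists too. *)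
Lemma shared_vertex_types B1 B2 x : is_block e B1 -> is_block e B2 -> B1 <> B2 ->
  x \in B1 -> x \in B2 ->
  (exists2 C, odd_hole e C & C \subset B1) -> (exists2 C, odd_hole e C & C \subset B2) ->
  (forall C, odd_hole e C -> C \subset B1 -> x \in C) ->
  block_type e B1 1 /\ (block_type e B2 1 \/ block_type e B2 2).
Proof.
move=> b1 b2 nB x1 x2 [C1 h1 s1] [C2 h2 s2] all1.
have I21 := shared_vertexI b1 b2 nB x1 x2.
have I12 : B1 :&: B2 = [set x] by rewrite setIC.
have k1 := block_connected b1; have k2 := block_connected b2.
split.
  apply: (block_type1 h1 s1) => C hC sC.
  apply: (attachment_hole_unique esym eirr HZ b1 hC h1 sC s1 _ _ k2 I21 h2 s2); exact: all1.
case: (classic (forall C, odd_hole e C -> C \subset B2 -> x \in C)) => [all2|nall].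
  left; apply: (block_type1 h2 s2) => C hC sC.
  apply: (attachment_hole_unique esym eirr HZ b2 hC h2 sC s2 _ _ k1 I12 h1 s1); exact: all2.
have [C hC [sC xC]] : exists2 C, odd_hole e C & C \subset B2 /\ x \notin C.
  apply: NNPP => h; apply: nall => C hC sC; apply/negPn/negP=> xC; apply: h.
  by exists C.
have [A hA [xA sAC sA]] := attachment_hole esym eirr HZ b2 hC sC x2 xC k1 I12 h1 s1.
right; apply: (@block_type2 _ A C) => //; first by apply: contraNneq xC => <-.
move=> C' hC' sC'; case: (boolP (x \in C')) => xC'; [left|right].
  exact: (attachment_hole_unique esym eirr HZ b2 hC' hA sC' sA xC' xA k1 I12 h1 s1).
have [A' hA' [xA' sAC' sA']] := attachment_hole esym eirr HZ b2 hC' sC' x2 xC' k1 I12 h1 s1.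
have eA : A' = A := attachment_hole_unique esym eirr HZ b2 hA' hA sA' sA xA' xA k1 I12 h1 s1.
rewrite eA in sAC'.
exact: (avoiding_hole_unique esym eirr HZ hA hC' hC xA xC' xC sAC' sAC).
Qed.

Lemma odd_cycle_condition_blocks : odd_cycle_condition e -> few_nonbipartite_blocks.
Proof.
move=> occ; case: (classic (forall B1 B2, nonbip_block e B1 -> nonbip_block e B2 -> B1 = B2)).
  by left.
move=> nall; right.
have [B1 [B2 [nB N1 N2]]] : exists B1 B2, [/\ B1 <> B2, nonbip_block e B1 & nonbip_block e B2].
  apply: NNPP => h; apply: nall => B1 B2 N1 N2; apply: NNPP => nB.
  by apply: h; exists B1, B2.
have [C1 h1 s1] := nonbip_block_hole N1; have [C2 h2 s2] := nonbip_block_hole N2.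
have [b1 _] := N1; have [b2 _] := N2.
exists B1, B2; do !split=> //.
  move=> B NB; case: (eqVneq B B1) => [|/eqP n1]; [by left|right].
  apply/eqP/negPn/negP=> /eqP n2; have [C hC sC] := nonbip_block_hole NB; have [bB _] := NB.
  by apply: (at_most_two_blocks esym eirr HZ occ bB b1 b2 n1 n2 nB hC h1 h2 sC s1 s2).
case: (set_0Vmem (B1 :&: B2)) => [I0|[x]].
  have dis12 : [disjoint B1 & B2] by rewrite -setI_eq0 I0.
  have dis21 : [disjoint B2 & B1] by rewrite disjoint_sym.
  have sdis C C' : C \subset B1 -> C' \subset B2 -> [disjoint C & C'].
    by move=> sC sC'; apply: disjointWl sC (disjointWr sC' dis12).
  have [x [y [xC yC exy]]] := occ _ _ h1 h2 (sdis _ _ s1 s2).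
  have x1 := subsetP s1 _ xC; have y2 := subsetP s2 _ yC.
  have eyx : e y x by rewrite esym.
  have k1 := block_connected b1; have k2 := block_connected b2.
  have [cY YB] := edge_attachment k2 b1 dis21 x1 y2 exy.
  have [cY' YB'] := edge_attachment k1 b2 dis12 y2 x1 eyx.
  (* All edges from [B1] to [B2] leave [B1] at the same vertex, and every hole of [B1] needs such an
     edge to reach [C2]. *)
  have all1 C : odd_hole e C -> C \subset B1 -> x \in C.
    move=> hC sC; have [c [c' [cC cC' ecc]]] := occ _ _ hC h2 (sdis _ _ sC s2).
    have <- := block_attachment esym b1 k2 dis21 (subsetP sC _ cC) x1 (subsetP s2 _ cC') y2 ecc exy.
    by [].
  have all2 C : odd_hole e C -> C \subset B2 -> y \in C.
    move=> hC sC; have [c' [c [cC' cC ecc]]] := occ _ _ h1 hC (sdis _ _ s1 sC).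
    rewrite esym in ecc.
    have <- := block_attachment esym b2 k1 dis12 (subsetP sC _ cC) y2 (subsetP s1 _ cC') x1 ecc eyx.
    by [].
  left; split; [|split].
  - apply: (block_type1 h1 s1) => C hC sC.
    apply: (attachment_hole_unique esym eirr HZ b1 hC h1 sC s1 (all1 _ hC sC) xC cY YB h2).
    by apply: subset_trans s2 (subsetUr _ _).
  - apply: (block_type1 h2 s2) => C hC sC.
    apply: (attachment_hole_unique esym eirr HZ b2 hC h2 sC s2 (all2 _ hC sC) yC cY' YB' h1).
    by apply: subset_trans s1 (subsetUr _ _).
  by exists x, y; do !split=> //; right.
rewrite inE => /andP[x1 x2].
(* It follows that in one of the two blocks every hole contains [x]. *)
have or12 C C' : odd_hole e C -> odd_hole e C' -> C \subset B1 -> C' \subset B2 ->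
    x \in C \/ x \in C'.
  move=> hC hC' sC sC'; case: (boolP [disjoint C & C']) => [dis|].
    have [c [c' [cC cC' ecc]]] := occ _ _ hC hC' dis.
    have [<-|<-] := shared_vertex_edge b1 b2 nB x1 x2 (subsetP sC _ cC) (subsetP sC' _ cC') ecc.
      by left.
    by right.
  rewrite -setI_eq0 => /set0Pn[z]; rewrite inE => /andP[zC zC']; left.
  by rewrite (blocks_meet esym b1 b2 nB x1 x2 (subsetP sC _ zC) (subsetP sC' _ zC')).
case: (classic (forall C, odd_hole e C -> C \subset B1 -> x \in C)) => [all1|nall1].
  have [||T1 [T2|T2]] := shared_vertex_types b1 b2 nB x1 x2 _ _ all1.
  - by exists C1.
  - by exists C2.
  - by left; do !split=> //; exists x, x; do !split=> //; left.
  by right; split; [left|exists x].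
have all2 C : odd_hole e C -> C \subset B2 -> x \in C.
  move=> hC sC; apply: NNPP => xC; apply: nall1 => C' hC' sC'.
  by case: (or12 C' C hC' hC sC' sC).
have [||T2 [T1|T1]] := shared_vertex_types b2 b1 (nesym nB) x2 x1 _ _ all2.
- by exists C2.
- by exists C1.
- by left; do !split=> //; exists x, x; do !split=> //; left.
by right; split; [right|exists x].
Qed.

Lemma blocks_odd_cycle_condition : few_nonbipartite_blocks -> odd_cycle_condition e.
Proof.
have same B C C' : nonbip_block e B -> odd_hole e C -> odd_hole e C' ->
    C \subset B -> C' \subset B -> [disjoint C & C'] -> exists x y, [/\ x \in C, y \in C' & e x y].
  by case=> bB _; apply: (holes_in_block_adjacent esym eirr HZ bB).
case=> [uniqB|[B1 [B2 [nB [N1 [N2 [only sc]]]]]]] C C' hC hC' dis.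
  have [B NB sC] := odd_hole_nonbip_block hC; have [B' NB' sC'] := odd_hole_nonbip_block hC'.
  by apply: (same B) => //; rewrite (uniqB B B').
have [b1 _] := N1; have [b2 _] := N2.
have k1 := block_connected b1; have k2 := block_connected b2.
(* A hole avoiding [x] would give a second hole of the block by [attachment_hole]. *)
have type1 B D D' Y x : is_block e B -> block_type e B 1 -> odd_hole e D -> D \subset B -> x \in B ->
    connected_on e Y -> Y :&: B = [set x] -> odd_hole e D' -> D' \subset Y -> x \in D.
  move=> bB T1 hD sD xB cY YB hD' sD'; apply/negPn/negP=> xD.
  have [A hA [xA _ sA]] := attachment_hole esym eirr HZ bB hD sD xB xD cY YB hD' sD'.
  by rewrite (block_type1_unique T1 hD hA sD sA) xA in xD.
(* [D] contains [x], so [D'] does not; the neighbours of [x] in [D'] supply the edge. *)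
have shared B B' x D D' : is_block e B -> is_block e B' -> B <> B' -> x \in B -> x \in B' ->
    block_type e B 1 -> odd_hole e D -> odd_hole e D' -> D \subset B -> D' \subset B' ->
    [disjoint D & D'] -> exists a b, [/\ a \in D, b \in D' & e a b].
  move=> bB bB' nBB xB xB' T1 hD hD' sD sD' disD.
  have I21 := shared_vertexI bB bB' nBB xB xB'.
  have xD := type1 B D D' B' x bB T1 hD sD xB (block_connected bB') I21 hD' sD'.
  have xD' : x \notin D' by rewrite (disjointFr disD xD).
  have I12 : B :&: B' = [set x] by rewrite setIC.
  have := attachment_two_neighbours esym eirr HZ bB' hD' sD' xB' xD' (block_connected bB) I12 hD sD.
  by case/ltnW/card_gt0P=> y; rewrite inE => /andP[yD exy]; exists x, y.
have cross D D' : odd_hole e D -> odd_hole e D' -> D \subset B1 -> D' \subset B2 ->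
    [disjoint D & D'] -> exists a b, [/\ a \in D, b \in D' & e a b].
  move=> hD hD' s1 s2 disD.
  have disD' : [disjoint D' & D] by rewrite disjoint_sym.
  have swap : (exists a b, [/\ a \in D', b \in D & e a b]) -> exists a b, [/\ a \in D, b \in D' & e a b].
    by case=> a [b [? ? ?]]; exists b, a; rewrite esym.
  case: sc => [[T1 [T2 [x [y [x1 [y2 exy]]]]]]|[[[T1 _]|[_ T2]] [v [v1 v2]]]]; last first.
  - by apply/swap/(shared B2 B1 v) => //; apply: nesym.
  - exact: (shared B1 B2 v).
  case: (set_0Vmem (B1 :&: B2)) => [I0|[v]]; last first.
    by rewrite inE => /andP[v1 v2]; apply: (shared B1 B2 v).
  have dis12 : [disjoint B1 & B2] by rewrite -setI_eq0 I0.
  have dis21 : [disjoint B2 & B1] by rewrite disjoint_sym.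
  case: exy => [exy|exy]; first by rewrite -exy (disjointFr dis12 x1) in y2.
  have eyx : e y x by rewrite esym.
  have [cY YB] := edge_attachment k2 b1 dis21 x1 y2 exy.
  have [cY' YB'] := edge_attachment k1 b2 dis12 y2 x1 eyx.
  exists x, y; split=> //.
    by apply: (type1 B1 D D' (x |: B2)) => //; apply: subset_trans s2 (subsetUr _ _).
  by apply: (type1 B2 D' D (y |: B1)) => //; apply: subset_trans s1 (subsetUr _ _).
have [B NB sC] := odd_hole_nonbip_block hC; have [B' NB' sC'] := odd_hole_nonbip_block hC'.
case: (only B NB) => eB; case: (only B' NB') => eB'; rewrite {}eB in NB sC; rewrite {}eB' in NB' sC'.
- exact: (same B1).
- exact: cross.
- have [a [b [? ? ?]]] : exists a b, [/\ a \in C', b \in C & e a b].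
    by apply: cross => //; rewrite disjoint_sym.
  by exists b, a; rewrite esym.
exact: (same B2).
Qed.

End BlockStructure.

(** * The edge ring; normality implies the odd cycle condition *)

Local Open Scope ring_scope.

Section EdgeRingBasics.
Variables (K : fieldType) (n : nat) (e : rel 'I_n).
Local Notation m := (size (edges e)).
Local Notation edge_map := (@edge_map K n e).
Local Notation edge_ring := (@edge_ring K n e).

Definition edge_degree (d : 'X_{1..n}) : Prop := exists u : 'X_{1..m}, deg u = d.

Lemma edge_mapX (u : 'X_{1..m}) : edge_map 'X_[u] = 'X_[deg u].
Proof.
rewrite /edge_map /Defs.edge_map comp_mpolyX /deg -mprodXnE.
by apply: eq_bigr => i _; rewrite tnth_map /edge_monomial mpolyXD.
Qed.

Lemma edge_mapE q : edge_map q = \sum_(u <- msupp q) q@_u *: 'X_[deg u].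
Proof.
rewrite {1}[q]mpolyE /edge_map /Defs.edge_map raddf_sum; apply: eq_bigr => u _ /=.
by rewrite comp_mpolyZ -[comp_mpoly _ _]/(edge_map _) edge_mapX.
Qed.

Lemma edge_map_coeff q d : (edge_map q)@_d = \sum_(u <- msupp q | deg u == d) q@_u.
Proof.
rewrite edge_mapE raddf_sum [RHS]big_mkcond; apply: eq_bigr => u _ /=.
by rewrite mcoeffZ mcoeffX; case: eqP; rewrite ?mulr1 ?mulr0.
Qed.

Lemma edge_map0 : edge_map 0 = 0. Proof. exact: comp_mpoly0. Qed.
Lemma edge_map1 : edge_map 1 = 1. Proof. exact: comp_mpoly1. Qed.
Lemma edge_mapD p q : edge_map (p + q) = edge_map p + edge_map q.
Proof. exact: comp_mpolyD. Qed.
Lemma edge_mapN p : edge_map (- p) = - edge_map p. Proof. exact: comp_mpolyN. Qed.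
Lemma edge_mapM p q : edge_map (p * q) = edge_map p * edge_map q.
Proof. by rewrite /edge_map /Defs.edge_map rmorphM. Qed.
Lemma edge_mapZ c p : edge_map (c *: p) = c *: edge_map p. Proof. exact: comp_mpolyZ. Qed.

Lemma edge_ring0 : edge_ring 0. Proof. by exists 0; rewrite edge_map0. Qed.
Lemma edge_ring1 : edge_ring 1. Proof. by exists 1; rewrite edge_map1. Qed.
Lemma edge_ringD p q : edge_ring p -> edge_ring q -> edge_ring (p + q).
Proof. by case=> p' -> [q' ->]; exists (p' + q'); rewrite edge_mapD. Qed.
Lemma edge_ringM p q : edge_ring p -> edge_ring q -> edge_ring (p * q).
Proof. by case=> p' -> [q' ->]; exists (p' * q'); rewrite edge_mapM. Qed.
Lemma edge_ringN p : edge_ring p -> edge_ring (- p).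
Proof. by case=> p' ->; exists (- p'); rewrite edge_mapN. Qed.
Lemma edge_ringZ c p : edge_ring p -> edge_ring (c *: p).
Proof. by case=> p' ->; exists (c *: p'); rewrite edge_mapZ. Qed.
Lemma edge_ring_exp p k : edge_ring p -> edge_ring (p ^+ k).
Proof.
move=> hp; elim: k => [|k IH]; rewrite ?expr0 ?exprS; [exact: edge_ring1|exact: edge_ringM].
Qed.
Lemma edge_ringX d : edge_degree d -> edge_ring 'X_[d].
Proof. by case=> u <-; exists 'X_[u]; rewrite edge_mapX. Qed.

Lemma edge_ring_supp p d : edge_ring p -> d \in msupp p -> edge_degree d.
Proof.
case=> q ->; rewrite mcoeff_msupp edge_map_coeff => nz.
case: (boolP (has (fun u => deg u == d) (msupp q))) => [/hasP[u _ /eqP <-]|nh].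
  by exists u.
case/eqP: nz; rewrite -big_filter; suff -> : [seq u <- msupp q | deg u == d] = [::].
  by rewrite big_nil.
by apply/eqP; rewrite -size_eq0 size_filter eqn0Ngt -has_count.
Qed.

Lemma edge_degree0 : edge_degree 0%MM. Proof. by exists 0%MM; rewrite deg0. Qed.
Lemma edge_degreeD d1 d2 : edge_degree d1 -> edge_degree d2 -> edge_degree (d1 + d2)%MM.
Proof. by case=> u1 <- [u2 <-]; exists (u1 + u2)%MM; rewrite degD. Qed.

Hypothesis esym : ssrbool.symmetric e.
Hypothesis eirr : irreflexive e.

Lemma path_edge_degree x p : path e x p -> odd (size p) -> edge_degree (vsum (x :: p)).
Proof. by move=> pp op; exists (pairing e (x :: p)); rewrite deg_pairing_odd. Qed.

Lemma inner_edge_degree x p : path e x p -> ~~ odd (size p) -> edge_degree (vsum p).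
Proof.
case: p => [_ _|y p] /=; first by rewrite /vsum big_nil; apply: edge_degree0.
by case/andP=> _ pp; rewrite negbK; apply: path_edge_degree.
Qed.

Lemma odd_walk a b p : connect e a b -> cycle e (a :: p) -> ~~ odd (size p) ->
  exists q, [/\ path e a q, last a q = b & odd (size q)].
Proof.
case/connectP=> q pq lq cyc op.
case: (boolP (odd (size q))) => oq; first by exists q.
exists (rcons p a ++ q); rewrite cat_path last_cat !last_rcons pq -lq; split=> //.
  by rewrite andbT.
by rewrite size_cat size_rcons oddD /= (negPf op) (negPf oq).
Qed.

Lemma normal_odd_cycle_condition : connected_graph e -> @edge_ring_normal K n e ->
  odd_cycle_condition e.
Proof.
move=> [_ conn] norm C C' hC hC' dis.
case: (boolP [exists x in C, exists y in C', e x y]) => [/exists_inP[x xC /exists_inP[y yC exy]]|nex].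
  by exists x, y.
have nadj x y : x \in C -> y \in C' -> e x y = false.
  move=> xC yC; apply: contraNF nex => exy.
  by apply/exists_inP; exists x => //; apply/exists_inP; exists y.
have /card_gt0P[a aC] : (0 < #|C|)%N by apply: ltn_trans (odd_hole_card hC).
have /card_gt0P[b bC] : (0 < #|C'|)%N by apply: ltn_trans (odd_hole_card hC').
have [p [ocp eC op]] := odd_hole_rot hC aC; have [p' [ocp' eC' op']] := odd_hole_rot hC' bC.
have /and5P[Uc _ _ cyc _] := ocp; have /and5P[Uc' _ _ cyc' _] := ocp'.
have [q [pq lq oq]] := odd_walk (conn a b) cyc op.
case/lastP: q pq lq oq => [//|q b'] pq; rewrite last_rcons => eb; rewrite {b'}eb in pq *.
rewrite size_rcons /= => oq.
have pq' : path e a q by move: pq; rewrite rcons_path => /andP[].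
pose t := (vsum (a :: p) + vsum (b :: p'))%MM.
have dp : edge_degree (vsum p).
  by apply: (@inner_edge_degree a) op; move: cyc; rewrite /= rcons_path => /andP[].
have dp' : edge_degree (vsum p').
  by apply: (@inner_edge_degree b) op'; move: cyc'; rewrite /= rcons_path => /andP[].
have dg : edge_degree (vsum q) by apply: inner_edge_degree pq' oq.
(* The odd walk from [a] to [b] has an even number of vertices, and so have [C] without [a] and [C']
   without [b]. The inner vertices [q] of the walk form the denominator. *)
have df : edge_degree (t + vsum q)%MM.
  have -> : (t + vsum q = vsum (a :: rcons q b) + (vsum p + vsum p'))%MM.
    rewrite /t !vsum_cons -[rcons q b]cats1 vsum_cat vsum_cons [vsum [::]]/vsum big_nil.
    by apply/mnmP=> v; rewrite !mnmDE mnm0E; clear; lia.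
  apply: edge_degreeD; last exact: edge_degreeD.
  by apply: path_edge_degree pq _; rewrite size_rcons.
have dt2 : edge_degree (t + t)%MM.
  have one c l : cycle e (c :: l) -> ~~ odd (size l) -> edge_degree (vsum l) ->
      edge_degree (vsum (c :: l) + vsum (c :: l))%MM.
    move=> cl ol dl.
    have -> : (vsum (c :: l) + vsum (c :: l) = vsum (c :: rcons l c) + vsum l)%MM.
      rewrite !vsum_cons -[rcons l c]cats1 vsum_cat vsum_cons [vsum [::]]/vsum big_nil.
      by apply/mnmP=> v; rewrite !mnmDE mnm0E; clear; lia.
    by apply: edge_degreeD => //; apply: path_edge_degree cl _; rewrite size_rcons.
  have -> : (t + t = (vsum (a :: p) + vsum (a :: p)) + (vsum (b :: p') + vsum (b :: p')))%MM.
    by rewrite /t; apply/mnmP=> v; rewrite !mnmDE; clear; lia.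
  by apply: edge_degreeD; apply: one.
have nzX (d : 'X_{1..n}) : 'X_[K, d] != 0 by rewrite -msupp_eq0 msuppX.
have [|c [hc ec]] := norm 'X_[t + vsum q]%MM 'X_[vsum q] (edge_ringX df) (edge_ringX dg) (nzX _).
  (* The fraction is a root of the monic quadratic with constant term minus the square of the
     monomial of [t] and no linear term. *)
  exists 1%N, (fun i => if i == 0%N then - 'X_[t + t]%MM else 0); split=> [i _|].
    by case: ifP => _; [apply/edge_ringN/edge_ringX | apply: edge_ring0].
  rewrite 2!big_ord_recl big_ord0 /= subn0 expr0 mulr1 mul0r mul0r !addr0 mulNr.
  rewrite !mpolyXn -!mpolyXD; apply/eqP; rewrite subr_eq0; apply/eqP; congr ('X_[_]).
  by apply/mnmP=> v; rewrite !mnmDE; clear; lia.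
have ct : c = 'X_[t].
  by apply: (mulIf (nzX (vsum q))); rewrite -ec mpolyXD.
have [u du] : edge_degree t by apply: (edge_ring_supp hc); rewrite ct msuppX mem_head.
have tE v : t v = ((v \in C) + (v \in C'))%N.
  by rewrite mnmDE !vsumE !count_uniq_mem // eC eC' !inE.
(* No edge occurring in [u] crosses [C], so the degree of [t] on [C] would be even, but it is the
   odd number of vertices of [C]. *)
have := deg_sum C u; rewrite du.
rewrite [X in (_ + X)%N]big1 => [|i ci]; last first.
  apply/eqP/negPn/negP; rewrite -lt0n => ui; move: ci; rewrite /crosses.
  have pos v : (0 < incidence i v)%N -> (v \in C) || (v \in C').
    by move=> iv; have := deg_gt0 ui iv; rewrite du tE; case: (v \in C); case: (v \in C').
  have := pos (ed i).1; have := pos (ed i).2; rewrite /incidence !eqxx addn1 => /(_ isT) + /(_ isT).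
  have := ed_edge i; case s1: ((ed i).1 \in C); case s2: ((ed i).2 \in C) => //= ee.
    by move=> s2'; rewrite nadj in ee.
  by move=> _ s1'; rewrite esym nadj in ee.
have -> : (\sum_(c in C) t c = #|C|)%N.
  rewrite -sum1_card; apply: eq_bigr => v vC; rewrite tE vC (disjointFr dis vC) //.
by move=> h; have := odd_hole_odd hC; rewrite h addn0 oddM.
Qed.

End EdgeRingBasics.

(** * Hall's theorem and saturated degrees *)

Local Open Scope nat_scope.

Section Hall.
Variables (T U : finType) (r : T -> U -> bool).
Implicit Types (A S : {set T}) (R : {set U}).

Definition joined S : {set U} := [set u | [exists t in S, r t u]].

Lemma joinedP S u : reflect (exists2 t, t \in S & r t u) (u \in joined S).
Proof. by rewrite inE; apply: exists_inP. Qed.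

Lemma joinedU S S' : joined (S :|: S') = joined S :|: joined S'.
Proof.
apply/setP=> u; rewrite !inE; apply/exists_inP/orP => [[t]|].
  by rewrite inE => /orP[tS|tS] rtu; [left|right]; apply/exists_inP; exists t.
by case=> /exists_inP[t tS rtu]; exists t; rewrite // inE tS ?orbT.
Qed.

(** Induction on [A]. A nonempty proper subset with exactly as many partners in [R] as elements is
    matched first and its partners are removed. If there is none, every such subset has a partner to
    spare, so any single pair may be matched. *)
Lemma hall_on (u0 : U) A R :
  (forall S, S \subset A -> #|S| <= #|joined S :&: R|) ->
  exists f : T -> U, {in A &, injective f} /\ {in A, forall t, f t \in R /\ r t (f t)}.
Proof.
have [k] := ubnP #|A|; elim: k A R => // k IH A R; rewrite ltnS => leA hall.
case: (set_0Vmem A) => [->|[t tA]]; first by exists (fun=> u0); split=> x; rewrite inE.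
case: (boolP [exists S : {set T}, [&& S \proper A, S != set0 & #|S| == #|joined S :&: R|]]).
  case/existsP=> S /and3P[pSA S0 /eqP eS].
  have sSA := proper_sub pSA.
  have [||f [fi fr]] := IH S R.
  - exact: leq_trans (proper_card pSA) leA.
  - by move=> S' sS'; apply: hall; apply: subset_trans sSA.
  have [||g [gi gr]] := IH (A :\: S) (R :\: joined S).
  - apply: leq_trans leA; rewrite cardsD (setIidPr sSA) ltn_subrL.
    by rewrite card_gt0 S0 (leq_trans _ (subset_leq_card sSA)) ?card_gt0.
  - move=> S' sS'; have dis : S' :&: S = set0.
      apply/setP=> x; rewrite !inE; apply/andP=> -[/(subsetP sS')]; rewrite inE.
      by case/andP=> /negP.
    have := hall (S' :|: S); rewrite subUset sSA (subset_trans sS' (subsetDl _ _)) => /(_ isT).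
    rewrite cardsU dis cards0 subn0 joinedU setIUl.
    have -> : joined S' :&: R :|: joined S :&: R =
              (joined S' :&: (R :\: joined S)) :|: (joined S :&: R).
      apply/setP=> u; rewrite !(in_setU, in_setI, in_setD).
      by case: (u \in joined S'); case: (u \in joined S); case: (u \in R).
    rewrite cardsU eS => h.
    by have := leq_trans h (leq_subr _ _); rewrite leq_add2r.
  exists (fun x => if x \in S then f x else g x); split=> [x y xA yA|x xA]; last first.
    case: ifP => xS; first exact: fr.
    by have [] := gr x; rewrite inE ?xS ?xA // inE => /andP[].
  have inD z : z \in A -> z \in S = false -> z \in A :\: S by rewrite inE => -> ->.
  have disj z w : z \in S -> w \in A :\: S -> f z != g w.
    move=> zS wD; have [zR rz] := fr z zS; have [] := gr w wD; rewrite inE => /andP[nj _] _.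
    by apply: contraNneq nj => <-; apply/joinedP; exists z.
  case: ifP => xS; case: ifP => yS eq.
  - exact: fi.
  - by have := disj x y xS (inD y yA yS); rewrite eq eqxx.
  - by have := disj y x yS (inD x xA xS); rewrite eq eqxx.
  - by apply: gi => //; apply: inD.
rewrite negb_exists => /forallP strict.
have : 0 < #|joined [set t] :&: R| by have := hall [set t]; rewrite sub1set tA cards1 => /(_ isT).
case/card_gt0P=> u; rewrite inE => /andP[/joinedP[t' /set1P-> rtu] uR].
have [||f [fi fr]] := IH (A :\ t) (R :\ u).
- by move: leA; rewrite (cardsD1 t) tA.
- move=> S sS; case: (set_0Vmem S) => [->|[s sS0]]; first by rewrite cards0.
  have : ~~ [&& S \proper A, S != set0 & #|S| == #|joined S :&: R|] := strict S.
  have -> : S \proper A by apply: sub_proper_trans sS (properD1 tA).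
  have -> : S != set0 by apply/set0Pn; exists s.
  move=> /= nS; have sSA : S \subset A := subset_trans sS (subD1set _ _).
  have := hall S sSA; rewrite leq_eqVlt (negPf nS) /= => lt.
  have -> : joined S :&: (R :\ u) = (joined S :&: R) :\ u.
    by apply/setP=> w; rewrite !inE andbCA.
  by move: lt; rewrite (cardsD1 u (joined S :&: R)); case: (u \in _); rewrite //= add0n => /ltnW.
exists (fun x => if x == t then u else f x).
have inD z : z \in A -> (z == t) = false -> z \in A :\ t by rewrite !inE => -> ->.
split=> [x y xA yA|x xA]; last first.
  case: ifP => [/eqP->//|xt]; have [] := fr x (inD x xA xt).
  by rewrite inE => /andP[].
have neu z : z \in A :\ t -> f z != u by move=> /fr[]; rewrite !inE => /andP[].
case: ifP => [/eqP->|xt]; case: ifP => [/eqP->|yt] // eq.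
- by have := neu y (inD y yA yt); rewrite -eq eqxx.
- by have := neu x (inD x xA xt); rewrite eq eqxx.
by apply: fi => //; apply: inD.
Qed.

Lemma hall : (forall S, #|S| <= #|joined S|) ->
  exists2 f : T -> U, injective f & forall t, r t (f t).
Proof.
move=> h; case: (pickP T) => [t _|T0]; last first.
  have f (t : T) : U by have := T0 t.
  by exists f => t; have := T0 t.
have : 0 < #|joined [set t]| by apply: leq_trans (h _); rewrite cards1.
case/card_gt0P=> u0 _.
have [|f [fi fr]] := @hall_on u0 setT setT.
  by move=> S _; rewrite setIT.
by exists f => [x y|x]; [apply: fi|case: (fr x)].
Qed.
End Hall.

Section ClosedWalks.
Variables (n : nat) (e : rel 'I_n).
Hypothesis esym : ssrbool.symmetric e.
Hypothesis eirr : irreflexive e.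
Hypothesis occ : odd_cycle_condition e.
Local Notation edge_degree := (@edge_degree n e).

Lemma closed_walk_rot c x : cycle e c -> x \in c ->
  exists p, [/\ cycle e (x :: p), vsum c = vsum (x :: p) & size c = (size p).+1].
Proof.
move=> cyc xc; have [i p Er] := rot_to xc; exists p; split.
- by rewrite -Er rot_cycle.
- by rewrite -Er; apply: vsum_perm; rewrite perm_sym perm_rot.
by rewrite -[size c](size_rot i) Er.
Qed.

Lemma even_closed_walk c : cycle e c -> ~~ odd (size c) -> edge_degree (vsum c).
Proof.
case: c => [_ _|x p]; first by rewrite /vsum big_nil; apply: edge_degree0.
rewrite /= rcons_path negbK => /andP[pp _] op; exact: path_edge_degree.
Qed.

(** If holes on the two walks are disjoint, an edge between them leaves an even number of
    consecutive vertices on each walk. If they share a vertex, the two walks concatenate into an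
    even one. *)
Lemma odd_closed_walks c c' : cycle e c -> cycle e c' -> odd (size c) -> odd (size c') ->
  edge_degree (vsum c + vsum c')%MM.
Proof.
move=> cyc cyc' oc oc'.
have [C hC sC] := odd_closed_walk_hole esym eirr cyc oc.
have [C' hC' sC'] := odd_closed_walk_hole esym eirr cyc' oc'.
case: (boolP [disjoint C & C']) => [dis|].
  have [x [y [/sC xc /sC' yc exy]]] := occ hC hC' dis.
  have [p [cp -> sp]] := closed_walk_rot cyc xc.
  have [p' [cp' -> sp']] := closed_walk_rot cyc' yc.
  move: oc oc' cp cp'; rewrite sp sp' /= !rcons_path => op op' /andP[pp _] /andP[pp' _].
  have -> : (vsum (x :: p) + vsum (y :: p') = vsum [:: x; y] + (vsum p + vsum p'))%MM.
    rewrite !vsum_cons [vsum [::]]/vsum big_nil.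
    by apply/mnmP=> v; rewrite !mnmDE mnm0E; clear; lia.
  apply: edge_degreeD; first by apply: path_edge_degree; rewrite //= exy.
  by apply: edge_degreeD; [apply: (inner_edge_degree esym eirr pp)|apply: (inner_edge_degree esym eirr pp')].
rewrite -setI_eq0 => /set0Pn[z]; rewrite inE => /andP[/sC zc /sC' zc'].
have [p [cp -> sp]] := closed_walk_rot cyc zc.
have [p' [cp' -> sp']] := closed_walk_rot cyc' zc'.
move: oc oc' cp cp'; rewrite sp sp' /= !rcons_path => op op' /andP[pp lp] /andP[pp' _].
rewrite -vsum_cat; apply: path_edge_degree => //=.
  by rewrite cat_path /= pp lp pp'.
by rewrite size_cat /= oddD /= (negPf op) (negPf op').
Qed.

Lemma closed_walks_edge_degree (L : seq (seq 'I_n)) : all (cycle e) L ->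
  ~~ odd (\sum_(c <- L) size c) -> edge_degree (\sum_(c <- L) vsum c)%MM.
Proof.
have [k] := ubnP (size L); elim: k L => // k IH [|c L] /=.
  by rewrite !big_nil => _ _ _; apply: edge_degree0.
rewrite ltnS => szL /andP[cyc cycL]; rewrite !big_cons oddD.
case oc: (odd (size c)) => /= osum; last first.
  by apply: edge_degreeD; [apply: even_closed_walk; rewrite ?oc|apply: IH].
have [c' cL oc'] : exists2 c', c' \in L & odd (size c').
  apply/hasP; apply: contraNT osum => /hasPn h.
  elim: L h {szL cycL} => [|c1 L IHL] h; rewrite ?big_nil // big_cons oddD.
  rewrite (negPf (h _ (mem_head _ _))) /= IHL // => c2 c2L; apply: h.
  by rewrite inE c2L orbT.
have pL := perm_to_rem cL.
rewrite (perm_big _ pL) big_cons addmA; apply: edge_degreeD.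
  by apply: odd_closed_walks => //; apply: (allP cycL).
apply: IH.
- by rewrite size_rem //; case: (L) cL szL => //= ? ? _; apply: ltn_trans.
- by apply/allP=> c2 /mem_rem; apply: (allP cycL).
by move: osum; rewrite (perm_big _ pL) big_cons oddD oc' negbK.
Qed.

Variable d : 'X_{1..n}.
Local Notation copies := {v : 'I_n & 'I_(d v)}.

Lemma orbit_decomposition (f : copies -> copies) : injective f ->
  (forall t, e (tag t) (tag (f t))) -> forall A : {set copies}, (forall t, t \in A -> f t \in A) ->
  exists L, [/\ all (cycle e) L, (\sum_(t in A) U_(tag t) = \sum_(c <- L) vsum c)%MM
     & #|A| = \sum_(c <- L) size c].
Proof.
move=> fi fe A; have [k] := ubnP #|A|; elim: k A => // k IH A; rewrite ltnS => leA clA.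
case: (set_0Vmem A) => [->|[x xA]].
  by exists [::]; rewrite cards0 !big_nil big_set0.
pose O : {set copies} := [set y in orbit f x].
have OA : O \subset A.
  apply/subsetP=> y; rewrite inE -fconnect_orbit => /iter_findex <-.
  by elim: (findex f x y) => //= i; apply: clA.
have [||L [cL vL sL]] := IH (A :\: O).
- apply: leq_trans leA; rewrite cardsD (setIidPr OA) ltn_subrL.
  have xO : x \in O by rewrite inE -fconnect_orbit.
  by apply/andP; split; apply/card_gt0P; exists x.
- move=> t; rewrite !inE => /andP[tO tA]; rewrite clA // andbT.
  apply: contraNN tO; rewrite -!fconnect_orbit => h.
  by apply: (connect_trans h); rewrite fconnect_sym // fconnect1.
exists (map tag (orbit f x) :: L); split.
- rewrite /= cL andbT; have := cycle_orbit fi x.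
  by rewrite cycle_map; apply: sub_cycle => a b /eqP <- /=; apply: fe.
- rewrite big_cons -vL (big_setID O) (setIidPr OA) /=; congr (_ + _)%MM.
  rewrite /vsum big_map big_uniq ?orbit_uniq //=.
  by apply: eq_bigl => t; rewrite inE.
rewrite big_cons -sL -(cardsID O A) (setIidPr OA) size_map; congr (_ + _).
by rewrite cardsE; apply/card_uniqP/orbit_uniq.
Qed.

Definition neighbours (S : {set 'I_n}) : {set 'I_n} := [set w | [exists v in S, e v w]].

(** Take [d v] copies of each vertex v. Hall's theorem sends every copy to a copy of a neighbour
    injectively, hence by a permutation, whose orbits are closed walks visiting each v exactly [d v]
    times in total. *)
Lemma edge_degree_saturated :
  (forall S : {set 'I_n}, \sum_(v in S) d v <= \sum_(v in neighbours S) d v) ->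
  ~~ odd (mdeg d) -> edge_degree d.
Proof.
move=> hall_d od.
have cardT (S : {set 'I_n}) : #|[set t : copies | tag t \in S]| = \sum_(v in S) d v.
  rewrite -sum1_card (eq_bigr (fun v => \sum_(i : 'I_(d v)) 1)); last first.
    by move=> v _; rewrite sum1_card card_ord.
  rewrite (sig_big_dep _ _ (fun v (i : 'I_(d v)) => 1)) /=.
  by apply: eq_bigl => t; rewrite inE andbT.
have [|f fi fe] := @hall copies copies (fun t t' => e (tag t) (tag t')).
  move=> S; pose S0 := [set tag t | t in S].
  apply: (@leq_trans #|[set t : copies | tag t \in S0]|).
    by apply/subset_leq_card/subsetP=> t tS; rewrite inE; apply: imset_f.
  rewrite cardT; apply: leq_trans (hall_d S0) _; rewrite -cardT.
  apply/subset_leq_card/subsetP=> t; rewrite !inE => /exists_inP[v /imsetP[t' tS ->] ee].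
  by apply/exists_inP; exists t'.
have [|L [cL vL sL]] := orbit_decomposition fi fe (A := setT).
  by move=> t _; rewrite inE.
have dE : d = (\sum_(t in [set: copies]) U_(tag t))%MM.
  rewrite [LHS]multinomUE_id.
  rewrite (eq_bigr (fun v => (\sum_(i : 'I_(d v)) U_(v))%MM)); last first.
    by move=> v _; rewrite big_const card_ord -Monoid.iteropE.
  rewrite (sig_big_dep _ _ (fun v (i : 'I_(d v)) => U_(v)%MM)) /=.
  by apply: eq_bigl => t; rewrite inE.
suff : edge_degree (\sum_(t in [set: copies]) U_(tag t))%MM by rewrite -dE.
rewrite vL; apply: closed_walks_edge_degree => //.
rewrite -sL; suff -> : #|[set: copies]| = mdeg d by [].
have -> : [set: copies] = [set t | tag t \in [set: 'I_n]] by apply/setP=> t; rewrite !inE.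
by rewrite cardT mdegE; apply: eq_bigl => v; rewrite inE.
Qed.

End ClosedWalks.

(** * The odd cycle condition implies normality *)

Local Open Scope ring_scope.

Section Normality.
Import Order.TTheory.
Variables (K : fieldType) (n : nat) (e : rel 'I_n).
Hypothesis esym : ssrbool.symmetric e.
Hypothesis eirr : irreflexive e.
Local Notation edge_ring := (@edge_ring K n e).
Local Notation edge_degree := (@edge_degree n e).

Lemma edge_degree_neighbours d (S : {set 'I_n}) : edge_degree d ->
  (\sum_(v in S) d v <= \sum_(v in neighbours e S) d v)%N.
Proof.
case=> u <-; have key (X : {set 'I_n}) : (\sum_(v in X) deg u v =
    \sum_i (((ed i).1 \in X) + ((ed i).2 \in X)) * u i)%N.
  rewrite (eq_bigr (fun v => (\sum_i incidence i v * u i)%N)); last by move=> v _; rewrite degE.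
  by rewrite exchange_big; apply: eq_bigr => i _; rewrite -big_distrl incidence_sum.
rewrite !key; apply: leq_sum => i _; rewrite leq_mul2r; apply/orP; right.
have nb x y : e x y -> ((x \in S) <= (y \in neighbours e S))%N.
  move=> exy; case: (boolP (x \in S)) => // xS; rewrite inE.
  by have -> : [exists v in S, e v y] by apply/exists_inP; exists x.
by rewrite addnC leq_add // nb // ?ed_edge // esym ed_edge.
Qed.

Lemma edge_degree_even d : edge_degree d -> ~~ odd (mdeg d).
Proof. by case=> u <-; rewrite mdeg_deg oddM. Qed.

(** Comparing slopes is how inequalities valid for all powers pass to the quotient of leading
    monomials. *)
Lemma linear_growth (a b c d : nat) : (forall k, a + k * b <= c + k * d)%N -> (b <= d)%N.
Proof.
move=> h; rewrite leqNgt; apply/negP=> ltdb; have := h c.+1.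
by have := leq_mul (leqnn c.+1) ltdb; clear h ltdb; nia.
Qed.

Hypothesis occ : odd_cycle_condition e.

(* The quotient a / b is almost integral: a fixed g clears all the denominators of its powers. *)
Lemma almost_integral_in_ring (b g : {mpoly K[n]}) : edge_ring b -> b != 0 -> g != 0 ->
  forall a, edge_ring a ->
  (forall k, exists2 q, edge_ring q & g * a ^+ k = b ^+ k * q) ->
  exists c, edge_ring c /\ a = c * b.
Proof.
move=> hb nzb nzg; elim/mleadrect=> a IH ha hq.
case: (eqVneq a 0) => [->|nza].
  by exists 0; split; [exact: edge_ring0|rewrite mul0r].
pose al := mlead a; pose be := mlead b; pose ga := mlead g.
have lead k : exists2 de, edge_degree de & (ga + al *+ k = be *+ k + de)%MM.
  have [q hq1 eq] := hq k; have nzq : q != 0.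
    apply/eqP=> q0; move/eqP: eq; rewrite q0 mulr0 mulf_eq0 (negPf nzg) /=.
    by rewrite expf_eq0 (negPf nza) andbF.
  exists (mlead q); first exact: (edge_ring_supp hq1 (mlead_supp nzq)).
  have := congr1 (@mlead n K) eq.
  by rewrite !mleadM ?expf_neq0 // !mleadX.
have le_be v : (be v <= al v)%N.
  apply: (@linear_growth 0 _ (ga v)) => k; have [de _ /mnmP/(_ v)] := lead k.
  rewrite !mnmDE !mulmnE add0n ![(_ * k)%N]mulnC => ->; exact: leq_addr.
pose d := (al - be)%MM.
have alE : al = (d + be)%MM by rewrite submK //; apply/mnm_lepP.
have deE k : edge_degree (ga + d *+ k)%MM.
  have [de hde eq] := lead k; suff -> : (ga + d *+ k)%MM = de by [].
  apply/mnmP=> v; move/mnmP/(_ v): eq; rewrite !mnmDE !mulmnE alE mnmDE mulnDl.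
  by rewrite addnA [RHS]addnC => /addIn.
have hd : edge_degree d.
  (* Hall's inequality for all degrees [ga + d *+ k] yields it for [d] by comparing slopes in [k];
     the parity comes from k = 0 and k = 1. *)
  apply: (edge_degree_saturated esym eirr occ) => [S|].
    apply: (@linear_growth (\sum_(v in S) ga v) _ (\sum_(v in neighbours e S) ga v)) => k.
    have := edge_degree_neighbours S (deE k).
    have lin (X : {set 'I_n}) :
        (\sum_(v in X) (ga + d *+ k)%MM v = \sum_(v in X) ga v + k * \sum_(v in X) d v)%N.
      rewrite big_distrr -big_split; apply: eq_bigr => v _.
      by rewrite mnmDE mulmnE mulnC.
    by rewrite !lin.
  have := edge_degree_even (deE 1%N); have := edge_degree_even (deE 0%N).
  by rewrite mulm0n addm0 mulm1n mdegD oddD => /negPf->.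
pose r := (mleadc a / mleadc b) *: 'X_[d] : {mpoly K[n]}.
have hr : edge_ring r by apply/edge_ringZ/edge_ringX.
case: (eqVneq a (r * b)) => [ea|nea]; first by exists r.
have nza' : a - r * b != 0 by rewrite subr_eq0.
have lcb : mleadc b != 0 by rewrite mleadc_eq0.
have lca : mleadc a != 0 by rewrite mleadc_eq0.
have nzr : r != 0.
  by rewrite scaler_eq0 -msupp_eq0 msuppX orbF mulf_neq0 // invr_eq0.
have mr : mlead r = d.
  rewrite /r mleadZ_proper ?mleadXm // mcoeffX eqxx mulr1.
  by rewrite mulf_neq0 // invr_eq0.
have mrb : mlead (r * b) = al by rewrite mleadM // mr -alE.
have crb : (r * b)@_al = mleadc a.
  rewrite -[in LHS]mrb mleadM // mleadcM mr /r mcoeffZ mcoeffX eqxx mulr1.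
  by rewrite divfK.
have lt : (mlead (a - r * b)%R < al)%O.
  rewrite lt_neqAle; apply/andP; split.
    apply/eqP=> h; have := mleadc_eq0 (a - r * b); rewrite (negPf nza') h mcoeffB crb.
    by rewrite subrr eqxx.
  have := mleadB_le a (r * b); rewrite mrb -/al.
  by rewrite joinxx.
have [|k|c [hc ec]] := IH _ lt.
- by apply: edge_ringD => //; apply/edge_ringN/edge_ringM.
(* Induction on the power of [a - r * b] needs mixed powers: one factor is expanded, and both
   resulting terms keep the right power of [b]. *)
- suff key : forall k j, exists2 q, edge_ring q &
      g * a ^+ j * (a - r * b) ^+ k = b ^+ (j + k) * q.
    by have [q hq1 eq] := key k 0%N; exists q => //; move: eq; rewrite expr0 mulr1.
  elim=> [|k' IHk] j.
    by have [q hq1 eq] := hq j; exists q; rewrite // expr0 mulr1 addn0.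
  have [q1 hq1 eq1] := IHk j.+1; have [q2 hq2 eq2] := IHk j.
  exists (q1 - r * q2); first by apply: edge_ringD => //; apply/edge_ringN/edge_ringM.
  have -> : g * a ^+ j * (a - r * b) ^+ k'.+1 = g * a ^+ j.+1 * (a - r * b) ^+ k'
      - r * b * (g * a ^+ j * (a - r * b) ^+ k').
    rewrite exprSr mulrA [X in X = _]mulrBr; congr (_ - _); last by rewrite mulrC.
    by rewrite exprSr mulrAC !mulrA.
  rewrite eq1 eq2 addSn addnS mulrBr; congr (_ - _).
  by rewrite [r * b]mulrC -mulrA exprS -[RHS]mulrA; congr (_ * _); rewrite mulrCA.
exists (c + r); split; first exact: edge_ringD.
by rewrite mulrDl -ec subrK.
Qed.

(** The common denominator is [b ^+ d]: powers of [a] up to d are clear, and a higher one is lowered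
    by the integral equation. *)
Lemma odd_cycle_condition_normal : @edge_ring_normal K n e.
Proof.
move=> a b ha hb nzb [d [c [hc eq]]].
apply: (@almost_integral_in_ring b (b ^+ d)) => //; first exact: expf_neq0.
pose Q k x := exists2 q, edge_ring q & x = b ^+ k * q.
suff : forall k, Q k (b ^+ d * a ^+ k) by [].
move=> k; have [N] := ubnP k; elim: N k => // N IH k; rewrite ltnS => leN.
case: (leqP k d) => [lekd|ltdk].
  exists (b ^+ (d - k) * a ^+ k).
    by apply: edge_ringM; apply: edge_ring_exp.
  by rewrite mulrA -exprD subnKC.
pose j := (k - d.+1)%N; have kE : k = (d.+1 + j)%N by rewrite subnKC.
have -> : b ^+ d * a ^+ k = \sum_(i < d.+1) - (c i * b ^+ (d.+1 - i) * (b ^+ d * a ^+ (i + j))).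
  have -> : a ^+ k = - (\sum_(i < d.+1) c i * a ^+ i * b ^+ (d.+1 - i)) * a ^+ j.
    by rewrite kE exprD; congr (_ * _); apply/eqP; rewrite -addr_eq0 eq.
  rewrite sumrN mulNr mulrN; congr (- _).
  rewrite mulr_suml mulr_sumr; apply: eq_bigr => i _; rewrite exprD.
  rewrite [RHS]mulrCA; congr (_ * _); rewrite -!mulrA; congr (_ * _); exact: mulrCA.
apply: big_ind => [|x y [q1 h1 ->] [q2 h2 ->]|i _].
- by exists 0; [exact: edge_ring0|rewrite mulr0].
- by exists (q1 + q2); [exact: edge_ringD|rewrite mulrDr].
have [|q hq1 ->] := IH (i + j)%N.
  by apply: leq_trans leN; rewrite kE ltn_add2r.
exists (- (c i * q)).
  by apply/edge_ringN/edge_ringM => //; apply: hc; rewrite -ltnS.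
have -> : k = (d.+1 - i + (i + j))%N by rewrite addnA subnK ?kE // ltnW.
by rewrite mulrN (exprD b (d.+1 - i)) [c i * b ^+ _]mulrC -!mulrA; congr (- (_ * _)); rewrite mulrCA.
Qed.

End Normality.

(** * Chains of primes in a polynomial ring *)

Section PrimeChains.
Variables (K : fieldType) (m : nat).
Local Notation R := {mpoly K[m]}.

Fixpoint exponent_box (N t : nat) : seq (seq nat) :=
  if t is t'.+1 then [seq j :: k | j <- iota 0 N, k <- exponent_box N t'] else [:: [::]].

Fixpoint power_product (ys : seq R) (k : seq nat) : R :=
  match ys, k with
  | y :: ys', j :: k' => y ^+ j * power_product ys' k'
  | _, _ => 1
  end.

(* Exponents are bounded by N so that the sums are finite; c is irrelevant outside the box. *)
Definition alg_indep (P : R -> Prop) (ys : seq R) : Prop := forall N (c : seq nat -> K),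
  P (\sum_(k <- exponent_box N (size ys)) c k *: power_product ys k) ->
  {in exponent_box N (size ys), forall k, c k = 0}.

Lemma exponent_box_size N t : size (exponent_box N t) = (N ^ t)%N.
Proof. by elim: t => [|t IH] //=; rewrite size_allpairs size_iota IH expnS. Qed.

Lemma exponent_box_uniq N t : uniq (exponent_box N t).
Proof.
by elim: t => //= t IH; apply: allpairs_uniq; rewrite ?iota_uniq // => -[a b] [c d] _ _ [-> ->].
Qed.

Lemma exponent_boxP N t k : k \in exponent_box N t -> size k = t /\ all (fun j => j < N)%N k.
Proof.
elim: t k => [|t IH] k /=; first by rewrite inE => /eqP->.
case/allpairsP=> -[j k'] /= [+ /IH[sk ak] ->]; rewrite mem_iota add0n => /andP[_ lj].
by rewrite /= sk lj ak.
Qed.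

(** The constant term lies in [Q], because [f] and the whole sum do, so it is zero; then [f] can be
    cancelled modulo the prime [P]. *)
Lemma power_sum_prime (P Q : R -> Prop) f : is_prime_ideal P -> is_ideal Q ->
  (forall x, P x -> Q x) -> Q f -> ~ P f ->
  forall N (A : nat -> R), (forall i, (i < N)%N -> Q (A i) -> A i = 0) ->
  P (\sum_(i < N) f ^+ i * A i) -> forall i, (i < N)%N -> Q (A i).
Proof.
move=> [[P0 [PD PM]] [_ Pprime]] [Q0 [QD QM]] PQ Qf nPf; elim=> // N IH A hA.
rewrite big_ord_recl expr0 mul1r /=.
have -> : \sum_(i < N) f ^+ (bump 0 i) * A (bump 0 i) = f * \sum_(i < N) f ^+ i * A i.+1.
  by rewrite mulr_sumr; apply: eq_bigr => i _; rewrite mulrA -exprS.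
set S := \sum_(i < N) _ => hP.
have QA0 : Q (A 0%N).
  have -> : A 0%N = (A 0%N + f * S) + (- S) * f.
    by rewrite mulNr [S * f]mulrC addrK.
  by apply: QD; [apply: PQ|apply: QM].
have A0 := hA 0%N isT QA0.
move: hP; rewrite A0 add0r => /Pprime[//|hS] [_|i]; first by rewrite A0.
rewrite ltnS => lti; apply: (IH (fun i => A i.+1)) => // j ltj; exact: hA.
Qed.

(** A strict inclusion of primes raises the transcendence degree of the quotient by at least one; a
    relation is regrouped by powers of [f]. *)
Lemma alg_indep_cons (P Q : R -> Prop) f ys : is_prime_ideal P -> is_ideal Q ->
  (forall x, P x -> Q x) -> Q f -> ~ P f -> alg_indep Q ys -> alg_indep P (f :: ys).
Proof.
move=> pP iQ PQ Qf nPf indep N c /= hP.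
pose A j := \sum_(k <- exponent_box N (size ys)) c (j :: k) *: power_product ys k.
have hP' : P (\sum_(i < N) f ^+ i * A i).
  move: hP; have -> : iota 0 N = index_iota 0 N by rewrite /index_iota subn0.
  rewrite big_allpairs_dep /= big_mkord.
  congr (P _); apply: eq_bigr => i _; rewrite mulr_sumr; apply: eq_bigr => k _.
  by rewrite -scalerAr.
have A0 i : (i < N)%N -> Q (A i) -> A i = 0.
  move=> _ /(indep N (fun k => c (i :: k))) h; rewrite /A big_seq big1 // => k kb.
  by rewrite h // scale0r.
have QA := power_sum_prime pP iQ PQ Qf nPf A0 hP'.
move=> k /allpairsP[[j k'] /= [+ kb ->]]; rewrite mem_iota add0n => /andP[_ ltj].
exact: (indep N (fun k => c (j :: k)) (QA j ltj)).
Qed.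

Lemma alg_indep_chain (I : R -> Prop) h ys : prime_chain_to I h -> alg_indep I ys ->
  exists (P : R -> Prop) ys', [/\ is_prime_ideal P, alg_indep P ys' & size ys' = (h + size ys)%N].
Proof.
case=> Ps [prim [inc last]] hI.
have hh : alg_indep (Ps h) ys by move=> N c /last; apply: hI.
have key j : (j <= h)%N -> exists2 ys', alg_indep (Ps (h - j)%N) ys' & size ys' = (j + size ys)%N.
  elim: j => [|j IH] lej; first by exists ys => //; rewrite subn0.
  have [ys' hys sys] := IH (ltnW lej).
  have lt : (h - j.+1 < h)%N by rewrite ltn_subrL (leq_ltn_trans _ lej).
  have [sub [f [fQ fP]]] := inc _ lt; rewrite -subSn // subSS in sub fQ.
  exists (f :: ys'); last by rewrite /= sys.
  apply: (alg_indep_cons _ _ sub fQ fP hys); first by apply: prim; apply: ltnW.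
  by have [] := prim (h - j)%N (leq_subr _ _).
have [ys' hys sys] := key h (leqnn h); rewrite subnn in hys.
by exists (Ps 0%N), ys'; split=> //; apply: prim.
Qed.

Lemma card_bmultinom L : (#|{: 'X_{1..m < L.+1}}| <= L.+1 ^ m)%N.
Proof.
have <- : #|{: {ffun 'I_m -> 'I_L.+1}}| = (L.+1 ^ m)%N by rewrite card_ffun !card_ord.
pose f (b : 'X_{1..m < L.+1}) : {ffun 'I_m -> 'I_L.+1} := [ffun i => inord (b i)].
apply: (@leq_card _ _ f) => b b' /ffunP eq; apply/val_inj/mnmP=> i.
have bnd (d : 'X_{1..m < L.+1}) : (d i < L.+1)%N.
  by apply: leq_ltn_trans (bmdeg d); rewrite mdegE (bigD1 i) //= leq_addr.
have := congr1 val (eq i); rewrite !ffunE /= !inordK //; exact: bnd.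
Qed.

Lemma power_product_size ys D N k : (forall y, y \in ys -> (msize y <= D.+1)%N) ->
  size k = size ys -> all (fun j => j < N)%N k ->
  (msize (power_product ys k) <= (D * N * size ys).+1)%N.
Proof.
elim: ys k => [|y ys IH] [|j k] //= hD; rewrite ?msize1 //.
move=> [sk] /andP[ltj ak].
have szM (p q : R) a b : (msize p <= a.+1 -> msize q <= b.+1 -> msize (p * q) <= (a + b).+1)%N.
  move=> hp hq; case: (eqVneq p 0) => [->|nzp]; first by rewrite mul0r msize0.
  case: (eqVneq q 0) => [->|nzq]; first by rewrite mulr0 msize0.
  have nzpq : p * q != 0 by rewrite mulf_neq0.
  move: hp hq; rewrite -!mlead_deg // !ltnS mleadM // mdegD; exact: leq_add.
have szX i : (msize (y ^+ i) <= (D * i).+1)%N.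
  elim: i => [|i IHi]; first by rewrite expr0 msize1.
  rewrite exprS mulnS; apply: szM IHi; apply: hD; exact: mem_head.
rewrite mulnS; apply: szM; last first.
  by apply: IH => // y' y'ys; apply: hD; rewrite inE y'ys orbT.
by apply: leq_trans (szX j) _; rewrite ltnS leq_mul2l (ltnW ltj) orbT.
Qed.

(** Dimension count: the N^t independent power products have degree at most D N t, and the
    polynomials of that degree form a space of dimension at most (D N t + 1)^m. For t > m this fails
    when N is large. *)
Lemma alg_indep_count (P : R -> Prop) ys : P 0 -> alg_indep P ys -> (size ys <= m)%N.
Proof.
move=> P0 indep; pose D := (\max_(y <- ys) msize y)%N.
have hD y : y \in ys -> (msize y <= D.+1)%N.
  by move=> yys; apply: leqW; rewrite /D (big_rem y) //= leq_maxl.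
pose t := size ys.
have bound N : (N ^ t <= (D * N * t).+1 ^ m)%N.
  pose L := (D * N * t)%N; pose B := exponent_box N t.
  apply: leq_trans (card_bmultinom L); rewrite leqNgt; apply/negP=> lt.
  pose M : 'M[K]_(size B, #|{: 'X_{1..m < L.+1}}|) :=
    \matrix_(i, j) (power_product ys (nth [::] B i))@_(enum_val j : 'X_{1..m < L.+1}).
  have nfree : ~~ row_free M.
    rewrite /row_free; apply/eqP=> rk; have := rank_leq_col M; rewrite rk.
    by rewrite exponent_box_size leqNgt lt.
  rewrite -kermx_eq0 in nfree; have /rowV0Pn[v vM nzv] := nfree.
  move/sub_kermxP: vM => vM; case/eqP: nzv.
  pose c (k : seq nat) : K := if insub (index k B) is Some i then v 0 i else 0.
  have cE (i : 'I_(size B)) : c (nth [::] B i) = v 0 i.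
    by rewrite /c index_uniq ?exponent_box_uniq // valK.
  have sum0 : \sum_(k <- B) c k *: power_product ys k = 0.
    apply/mpolyP=> d; rewrite mcoeff0 raddf_sum /= (big_nth [::]) big_mkord.
    case: (ltnP (mdeg d) L.+1) => ld.
      have := congr1 (fun A : 'rV_ _ => A 0 (enum_rank (BMultinom ld))) vM; rewrite !mxE => h.
      rewrite -[RHS]h; apply: eq_bigr => i _.
      by rewrite mcoeffZ cE mxE enum_rankK.
    rewrite big1 // => i _; rewrite mcoeffZ memN_msupp_eq0 ?mulr0 //.
    apply: msize_mdeg_ge; apply: leq_trans ld.
    have [sk ak] := exponent_boxP (mem_nth [::] (ltn_ord i)).
    exact: power_product_size.
  have c0 := indep N c; rewrite sum0 in c0.
  apply/rowP=> i; rewrite mxE -cE; apply: (c0 P0); exact: mem_nth.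
rewrite leqNgt; apply/negP=> ltmt.
(* As D t N + 1 <= E N, the bound would give N <= E^m, which this [N] violates. *)
pose E := (D * t).+1; pose N := (E ^ m).+1.
have := bound N; have -> : (D * N * t = D * t * N)%N by rewrite -!mulnA [(N * t)%N]mulnC.
move=> h; have h1 : (N ^ t <= (E * N) ^ m)%N.
  apply: leq_trans h _; case: (posnP m) => [m0|m0]; first by rewrite [X in (_ <= _ ^ X)%N]m0 [X in (_ ^ X <= _)%N]m0.
  by rewrite leq_exp2r // /E mulSn -add1n leq_add2r.
have h2 : (N * N ^ m <= E ^ m * N ^ m)%N.
  rewrite -expnMn; apply: leq_trans h1; rewrite -expnS; exact: leq_pexp2l.
by move: h2; rewrite leq_pmul2r ?expn_gt0 // ltnn.
Qed.

End PrimeChains.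

(** * The height of the toric ideal *)

Section ToricHeight.
Variables (K : fieldType) (n : nat) (e : rel 'I_n).
Hypothesis esym : ssrbool.symmetric e.
Hypothesis eirr : irreflexive e.
Local Notation m := (size (edges e)).
Local Notation toric := (@toric_ideal K n e).
Local Notation edge_map := (@edge_map K n e).

Lemma toric_prime : is_prime_ideal toric.
Proof.
rewrite /toric_ideal; split; [split|split].
- exact: edge_map0.
- split=> [x y|r x]; first by rewrite edge_mapD => -> ->; rewrite addr0.
  by rewrite edge_mapM => ->; rewrite mulr0.
- by rewrite edge_map1 => /eqP; rewrite oner_eq0.
by move=> a b /eqP; rewrite edge_mapM mulf_eq0 => /orP[]/eqP; [left|right].
Qed.

Hypothesis conn : connected_graph e.
Variable C : {set 'I_n}.
Hypothesis hC : odd_hole e C.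

Lemma odd_closed_walk_through x : exists p, cycle e (x :: p) /\ ~~ odd (size p).
Proof.
have /card_gt0P[a aC] : (0 < #|C|)%N by apply: ltn_trans (odd_hole_card hC).
have [p [ocp _ op]] := odd_hole_rot hC aC; have /and5P[_ _ _ cyc _] := ocp.
have /connectP[q pq lq] := proj2 conn x a.
case: q pq lq => [_ /= eax|y q pq lq]; first by exists p; rewrite -eax.
exists (y :: q ++ rcons p a ++ rev (belast y q)); split; last first.
  rewrite /= !size_cat size_rcons size_rev size_belast !oddD /= (negPf op).
  by case: (odd (size q)).
have eq : rcons (y :: q ++ rcons p a ++ rev (belast y q)) x
    = (y :: q) ++ rcons p a ++ rev (belast x (y :: q)) by rewrite /= rev_cons -!rcons_cat.
rewrite /cycle eq !cat_path pq -lq last_rcons; apply/and3P; split=> //.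
by rewrite lq rcons_path_rev.
Qed.

Fixpoint weighted_sum (ws : seq 'X_{1..n}) (k : seq nat) : 'X_{1..n} :=
  match ws, k with
  | w :: ws', j :: k' => (w *+ j + weighted_sum ws' k')%MM
  | _, _ => 0%MM
  end.

Lemma power_product_edge_map (us : seq 'X_{1..m}) k :
  edge_map (power_product [seq 'X_[u] | u <- us] k) = 'X_[weighted_sum [seq deg u | u <- us] k].
Proof.
elim: us k => [|u us IH] [|j k] /=; rewrite ?edge_map1 ?mpolyX0 //.
by rewrite edge_mapM IH mpolyXD mpolyXn edge_mapX degMn.
Qed.

Lemma weighted_sumE (be : 'X_{1..n}) l k v : uniq l -> v \in l -> size k = size l ->
  weighted_sum [seq (U_(x) *+ 2 + be)%MM | x <- l] k v = (2 * nth 0 k (index v l) + sumn k * be v)%N.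
Proof.
have out l' k' : v \notin l' -> size k' = size l' ->
    weighted_sum [seq (U_(x) *+ 2 + be)%MM | x <- l'] k' v = (sumn k' * be v)%N.
  elim: l' k' => [|x l' IH] [|j k'] //=; rewrite ?mnm0E //.
  rewrite inE negb_or => /andP[nvx nl] [sk].
  rewrite mnmDE IH // mulmnE mnmDE mulmnE mnm1E eq_sym (negPf nvx) mulnDl.
  by rewrite !mul0n add0n mulnDl [(be v * j)%N]mulnC.
elim: l k => [|x l IH] [|j k] //= /andP[xl Ul]; rewrite inE => vl [sk].
rewrite mnmDE mulmnE mnmDE mulmnE mnm1E eq_sym.
case: (eqVneq v x) vl => [evx|nvx] /= vl.
  rewrite out // ?evx // -evx; move: (be v) (sumn k) => b s; clear; nia.
rewrite IH //; move: (be v) (sumn k) (nth _ _ _) => b s t; clear; nia.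
Qed.

Lemma mdeg_weighted_sum be l k : size k = size l ->
  mdeg (weighted_sum [seq (U_(x) *+ 2 + be)%MM | x <- l] k) = (sumn k * (2 + mdeg be))%N.
Proof.
elim: l k => [|x l IH] [|j k] //=; rewrite ?mdeg0 // => -[sk].
by rewrite mdegD IH // mdegMn mdegD mdegMn mdeg1 mul1n [RHS]mulnDl [(_ * j)%N]mulnC.
Qed.

(** The total degree determines the sum of [k], hence the multiple of [be]; what remains at each
    vertex is twice an entry of [k]. *)
Lemma weighted_sum_inj be k k' : size k = n -> size k' = n ->
  weighted_sum [seq (U_(x) *+ 2 + be)%MM | x <- enum 'I_n] k =
  weighted_sum [seq (U_(x) *+ 2 + be)%MM | x <- enum 'I_n] k' -> k = k'.
Proof.
move=> sk sk' eq; have sE : size (enum 'I_n) = n by rewrite size_enum_ord.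
have eqs : sumn k = sumn k'.
  have := congr1 mdeg eq; rewrite !mdeg_weighted_sum ?sE // => /eqP.
  by rewrite eqn_pmul2r // => /eqP.
apply: (@eq_from_nth _ 0%N) => [|i]; rewrite sk ?sk' // => lti.
have := congr1 (fun d : 'X_{1..n} => d (Ordinal lti)) eq.
rewrite !weighted_sumE ?enum_uniq ?mem_enum ?sE // eqs => /addIn/eqP.
by rewrite eqn_pmul2l // index_enum_ord => /eqP.
Qed.

(** An odd closed walk through x shows that the square of x is a quotient of two edge monomials. A
    common denominator [be] turns these squares into edge monomials of degrees 2x + [be], whose
    power products have distinct degrees. *)
Lemma toric_alg_indep : exists2 ys, alg_indep toric ys & size ys = n.
Proof.
have ex x : exists uu : 'X_{1..m} * 'X_{1..m}, deg uu.1 = (U_(x) *+ 2 + deg uu.2)%MM.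
  have [p [cyc op]] := odd_closed_walk_through x.
  have pp : path e x p by move: cyc; rewrite /= rcons_path => /andP[].
  have [u2 d2] := inner_edge_degree esym eirr pp op.
  have [|u1 d1] := path_edge_degree esym eirr cyc; first by rewrite size_rcons.
  exists (u1, u2); rewrite /= d1 d2 vsum_cons -cats1 vsum_cat vsum_cons [vsum [::]]/vsum big_nil.
  by apply/mnmP=> v; rewrite !mnmDE mnm0E; clear; lia.
have [uu huu] := fin_all_exists ex.
pose be := deg (\sum_x (uu x).2)%MM.
pose us := [seq ((uu x).1 + \sum_(y | y != x) (uu y).2)%MM | x <- enum 'I_n].
have dus : [seq deg u | u <- us] = [seq (U_(x) *+ 2 + be)%MM | x <- enum 'I_n].
  rewrite -map_comp; apply: eq_map => x /=.
  by rewrite degD huu -addmA -degD /be [in RHS](bigD1 x).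
have sus : size us = n by rewrite size_map -cardE card_ord.
exists [seq 'X_[u] | u <- us]; last by rewrite size_map.
move=> N c; rewrite size_map sus /toric_ideal => h0 k0 kb0.
have := congr1 (mcoeff (weighted_sum [seq deg u | u <- us] k0)) h0.
have -> : edge_map (\sum_(k <- exponent_box N n) c k *: power_product [seq 'X_[u] | u <- us] k) =
    \sum_(k <- exponent_box N n) c k *: 'X_[weighted_sum [seq deg u | u <- us] k].
  rewrite /edge_map /Defs.edge_map raddf_sum; apply: eq_bigr => k _ /=.
  by rewrite comp_mpolyZ -[comp_mpoly _ _]/(edge_map _) power_product_edge_map.
rewrite mcoeff0 raddf_sum /= (bigD1_seq k0) ?exponent_box_uniq //=.
rewrite mcoeffZ mcoeffX eqxx mulr1 big_seq_cond big1 ?addr0 // => k /andP[kb nk].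
rewrite mcoeffZ mcoeffX; case: eqP => [eq|]; last by rewrite mulr0.
have [sk _] := exponent_boxP kb; have [sk0 _] := exponent_boxP kb0.
by case/eqP: nk; apply: (@weighted_sum_inj be k k0 sk sk0); rewrite dus in eq.
Qed.

Lemma toric_height h : height_eq toric h -> (h + n <= m)%N.
Proof.
case=> /(_ toric toric_prime (fun x hx => hx)) chain _.
have [ys iy sy] := toric_alg_indep.
have [P [ys' [pP iP sP]]] := alg_indep_chain chain iy.
rewrite sy in sP; rewrite -sP; apply: alg_indep_count iP.
by case: pP => -[].
Qed.

End ToricHeight.

(** * Minimal binomials of a complete intersection *)

Lemma F2P (a : 'F_2) : a = 0 \/ a = 1.
Proof. by case: (eqVneq a 0) => [|/F2_eq1]; [left|right]. Qed.

Lemma F2_edge (a b c k : 'F_2) (o1 o2 : bool) : a + (c + b) = (~~ (o1 (+) o2))%:R * k ->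
  c = k + ((a + o1%:R * k) + (b + o2%:R * k)).
Proof.
case: o1; case: o2; case: (F2P a) => ->; case: (F2P b) => ->; case: (F2P c) => ->;
  case: (F2P k) => -> /eqP h; apply/eqP; move: h; by vm_compute.
Qed.

Section MinimalGenerators.
Variables (K : fieldType) (n : nat) (e : rel 'I_n).
Hypothesis esym : ssrbool.symmetric e.
Hypothesis eirr : irreflexive e.
Local Notation m := (size (edges e)).
Local Notation exps := 'X_{1..m}.
Local Notation toric := (@toric_ideal K n e).
Local Notation edge_map := (@edge_map K n e).

Definition dotp (z : 'rV['F_2]_m) (lam : 'cV['F_2]_m) : 'F_2 := (z *m lam) 0 0.

Lemma dotpD z z' lam : dotp (z + z') lam = dotp z lam + dotp z' lam.
Proof. by rewrite /dotp mulmxDl mxE. Qed.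

Lemma dotpBr z lam mu (a : 'F_2) : dotp z (lam - a *: mu) = dotp z lam - a * dotp z mu.
Proof. by rewrite /dotp mulmxBr -scalemxAr !mxE. Qed.

Definition kills_below (lam : 'cV['F_2]_m) (b : 'X_{1..n}) : Prop := forall u w : exps,
  deg u = deg w -> (deg u <= b)%MM -> deg u != b -> dotp (red u + red w) lam = 0.

Definition selected (lam : 'cV['F_2]_m) (b : 'X_{1..n}) (q : exps) : bool :=
  (deg q == b) && (dotp (red q) lam == 1).

(** Sums the coefficients of the monomials of degree [b] on one side of [lam]; it detects a binomial
    of degree [b] exactly when [lam] separates its two terms. The range is finite but contains every
    monomial of degree [b]. *)
Definition psi lam b (f : {mpoly K[m]}) : K :=
  \sum_(q : 'X_{1..m < (mdeg b).+1}) f@_q * (selected lam b q)%:R.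

Lemma psi_sum lam b (I : Type) (r : seq I) (F : I -> {mpoly K[m]}) :
  psi lam b (\sum_(i <- r) F i) = \sum_(i <- r) psi lam b (F i).
Proof.
rewrite /psi exchange_big; apply: eq_bigr => q _ /=.
by rewrite raddf_sum mulr_suml.
Qed.

Lemma psiB lam b f g : psi lam b (f - g) = psi lam b f - psi lam b g.
Proof. by rewrite /psi -sumrB; apply: eq_bigr => q _; rewrite mcoeffB mulrBl. Qed.

Lemma psiZ lam b c f : psi lam b (c *: f) = c * psi lam b f.
Proof. by rewrite /psi mulr_sumr; apply: eq_bigr => q _; rewrite mcoeffZ mulrA. Qed.

Lemma psiX lam b u : psi lam b 'X_[u] = (selected lam b u)%:R.
Proof.
rewrite /psi; case: (ltnP (mdeg u) (mdeg b).+1) => [ltu|leu].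
  rewrite (bigD1 (BMultinom ltu)) //= mcoeffX eqxx mul1r big1 ?addr0 // => q nq.
  rewrite mcoeffX; case: eqP => [eq|]; rewrite ?mul0r //.
  by case/eqP: nq; apply/val_inj.
rewrite big1 => [|q _].
  rewrite /selected; case: eqP => //= db; move: leu; rewrite -db mdeg_deg mul2n -addnn ltnNge.
  by rewrite leq_addr.
rewrite mcoeffX; case: eqP => [eq|]; rewrite ?mul0r //.
by have := bmdeg q; rewrite -eq ltnNge leu.
Qed.

(** Two exponents u with p + u of degree [b] differ by a binomial of strictly smaller degree, which
    [lam] kills. So [psi] selects all of them or none, and the coefficients of [t] in one degree add
    up to 0. *)
Lemma psiXM lam b (p : exps) t : kills_below lam b -> toric t -> p != 0%MM ->
  psi lam b ('X_[p] * t) = 0.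
Proof.
move=> low ht np; rewrite [t in LHS]mpolyE mulr_sumr psi_sum.
have -> : \sum_(u <- msupp t) psi lam b ('X_[p] * (t@_u *: 'X_[u])) =
    \sum_(u <- msupp t) t@_u * (selected lam b (p + u))%:R.
  by apply: eq_bigr => u _; rewrite -scalerAr -mpolyXD psiZ psiX.
case: (boolP (has (fun u => selected lam b (p + u)) (msupp t))) => [/hasP[u0 _ s0]|nh]; last first.
  rewrite big_seq big1 // => u ut; case: (boolP (selected _ _ _)) => [su|]; rewrite ?mulr0 //.
  by case/hasP: nh; exists u.
have [/eqP d0 /eqP l0] := andP s0.
have sel u : selected lam b (p + u) = (deg u == deg u0).
  rewrite /selected -{1}d0 !degD eqm_add2l; case: eqP => //= du.
  have : dotp (red u + red u0) lam = 0.
    apply: low => //; first by rewrite du -d0 degD lem_addl.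
    rewrite du -d0 degD -{1}[deg u0]add0m eqm_add2r eq_sym -mdeg_eq0 mdeg_deg muln_eq0 /=.
    by rewrite mdeg_eq0.
  move: l0; rewrite !redD !dotpD => l0 /eqP; rewrite addr_eq0 F2_opp => /eqP->.
  by rewrite l0 eqxx.
rewrite (eq_bigr (fun u => if deg u == deg u0 then t@_u else 0)); last first.
  by move=> u _; rewrite sel; case: eqP; rewrite ?mulr1 ?mulr0.
by rewrite -big_mkcond -edge_map_coeff ht mcoeff0.
Qed.

(* Hence psi vanishes on the product of the irrelevant ideal with the toric ideal. *)
Lemma psiM lam b c t : kills_below lam b -> toric t ->
  psi lam b (c * t) = c@_0%MM * psi lam b t.
Proof.
move=> low ht; rewrite [c in LHS]mpolyE mulr_suml psi_sum.
rewrite (eq_bigr (fun p => if p == 0%MM then c@_0%MM * psi lam b t else 0)); last first.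
  move=> p _; rewrite -scalerAl psiZ; case: eqP => [->|/eqP np].
    by rewrite mpolyX0 mul1r.
  by rewrite psiXM // mulr0.
case: (boolP (0%MM \in msupp c)) => c0.
  rewrite (bigD1_seq 0%MM) ?msupp_uniq //= eqxx big1 ?addr0 // => p.
  by move/negPf->.
rewrite memN_msupp_eq0 // mul0r big1 // => p _; exact: if_same.
Qed.

Definition pair_vec (p : exps * exps) : 'rV['F_2]_m := red p.1 + red p.2.

(* The functionals psi (lam j) are dual to the binomials of s and certify that these are
   independent modulo the product of the irrelevant ideal with the toric ideal. *)
Definition good_family (s : seq (exps * exps)) : Prop :=
  exists lam : nat -> 'cV['F_2]_m, forall j, (j < size s)%N ->
    let p := nth (0%MM, 0%MM) s j in
    [/\ deg p.1 = deg p.2, kills_below (lam j) (deg p.1), dotp (pair_vec p) (lam j) = 1 &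
        forall l, (l < size s)%N -> l != j ->
          let q := nth (0%MM, 0%MM) s l in
          deg q.1 = deg p.1 -> dotp (pair_vec q) (lam j) = 0].

(** The matrix of the functionals on the binomials is diagonal and invertible. By [psiM] it factors
    through the constant terms of the coefficients over the generators, so its rank is at most their
    number. *)
Lemma good_family_size s gens : generated_by gens toric -> good_family s ->
  (size s <= size gens)%N.
Proof.
move=> gen [lam hlam]; set x0 := (0%MM, 0%MM) in hlam.
pose p (j : 'I_(size s)) := nth x0 s j.
have gent l : (l < size gens)%N -> toric gens`_l.
  move=> ltl; apply/gen; exists (fun i => (i == l)%:R).
  rewrite (bigD1 (Ordinal ltl)) //= eqxx mul1r big1 ?addr0 // => i.
  by rewrite -val_eqE => /negPf->; rewrite mul0r.
have bin j : toric ('X_[(p j).1] - 'X_[(p j).2]).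
  have [dp _ _ _] := hlam j (ltn_ord j).
  by rewrite /toric_ideal edge_mapD edge_mapN !edge_mapX dp subrr.
have /fin_all_exists[c hc] j : exists c : nat -> {mpoly K[m]},
    'X_[(p j).1] - 'X_[(p j).2] = \sum_(i < size gens) c i * gens`_i by apply/gen.
pose A : 'M[K]_(size s) := \matrix_(i, j)
  psi (lam j) (deg (p j).1) ('X_[(p i).1] - 'X_[(p i).2]).
pose G : 'M[K]_(size s, size gens) := \matrix_(i, l) (c i l)@_0%MM.
pose H : 'M[K]_(size gens, size s) := \matrix_(l, j) psi (lam j) (deg (p j).1) gens`_l.
have AE : A = G *m H.
  apply/matrixP=> i j; rewrite !mxE hc psi_sum; apply: eq_bigr => l _; rewrite !mxE.
  have [_ low _ _] := hlam j (ltn_ord j).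
  by rewrite (psiM _ low) //; apply: gent.
have Adiag : A = diag_mx (\row_j A j j).
  apply/matrixP=> i j; rewrite !mxE; case: (eqVneq i j) => [->|nij] /=; rewrite ?mulr1n ?mulr0n //.
  have [_ _ _ off] := hlam j (ltn_ord j); have [di _ _ _] := hlam i (ltn_ord i).
  rewrite psiB !psiX /selected -/(p i) -/(p j) -[deg (p i).2]di.
  case: eqP => [dij|_] /=; rewrite ?subrr //.
  have := off i (ltn_ord i) nij dij; rewrite /pair_vec dotpD => /eqP.
  by rewrite addr_eq0 F2_opp => /eqP->; rewrite subrr.
have Aunit : A \in unitmx.
  rewrite Adiag unitmxE det_diag unitfE; apply/prodf_neq0 => j _; rewrite !mxE.
  have [dj _ one _] := hlam j (ltn_ord j).
  rewrite psiB !psiX /selected -/(p j) -[deg (p j).2]dj eqxx /=.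
  move: one; rewrite /pair_vec dotpD -/(p j); move: (dotp _ _) (dotp _ _) => a1 a2.
  case: (eqVneq a1 1) => [->|n1]; case: (eqVneq a2 1) => [->|n2] h.
  - by move/eqP: h; rewrite -subr_eq0 addrK oner_eq0.
  - by rewrite mulr0n ?sub0r ?subr0 ?oppr_eq0 oner_eq0.
  - by rewrite mulr0n ?sub0r ?subr0 ?oppr_eq0 oner_eq0.
  have z a : a != 1 :> 'F_2 -> a = 0 by move=> na; apply/eqP; apply: contraNT na => /F2_eq1->.
  by move/eqP: h; rewrite (z a1) // (z a2) // addr0 eq_sym oner_eq0.
have := mxrank_unit Aunit; rewrite AE => <-.
exact: leq_trans (mxrankM_maxl G H) (rank_leq_col G).
Qed.

Lemma maximal_good_family h : (forall s, good_family s -> (size s <= h)%N) ->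
  exists2 s, good_family s & forall p, ~ good_family (rcons s p).
Proof.
move=> bnd; apply: NNPP => nmax.
have ext s : good_family s -> exists p, good_family (rcons s p).
  move=> gs; apply: NNPP => np; apply: nmax; exists s => // p gp; apply: np.
  by exists p.
have all k : exists2 s, good_family s & size s = k.
  elim: k => [|k [s gs sk]]; first by exists [::] => //; exists (fun=> 0).
  by have [p gp] := ext s gs; exists (rcons s p) => //; rewrite size_rcons sk.
by have [s gs sk] := all h.+1; have := bnd s gs; rewrite sk ltnn.
Qed.

Variable s : seq (exps * exps).
Hypothesis gs : good_family s.
Hypothesis maxs : forall p, ~ good_family (rcons s p).

Definition pair_deg (l : 'I_(size s)) : 'X_{1..n} := deg (tnth (in_tuple s) l).1.

(** Rows of degree outside [D] are zeroed rather than dropped, so that coordinates for different [D]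
    share one index set. *)
Definition pair_mx (D : pred 'X_{1..n}) : 'M['F_2]_(size s, m) :=
  \matrix_(l, i) if D (pair_deg l) then pair_vec (tnth (in_tuple s) l) 0 i else 0.

Lemma row_pair_mx D l :
  row l (pair_mx D) = if D (pair_deg l) then pair_vec (tnth (in_tuple s) l) else 0.
Proof. by apply/rowP=> i; rewrite mxE mxE; case: ifP => // _; rewrite mxE. Qed.

Lemma pair_mxS (D D' : pred 'X_{1..n}) : (forall d, D d -> D' d) -> (pair_mx D <= pair_mx D')%MS.
Proof.
move=> sDD; apply/row_subP=> l; rewrite row_pair_mx; case: ifP => Dl; last exact: sub0mx.
by have := row_sub l (pair_mx D'); rewrite row_pair_mx (sDD _ Dl).
Qed.

Lemma good_pair_deg l : deg (tnth (in_tuple s) l).1 = deg (tnth (in_tuple s) l).2.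
Proof.
have [lam h] := gs; rewrite (tnth_nth (0%MM, 0%MM)).
by have [] := h l (ltn_ord l).
Qed.

Lemma separating_functional k (A : 'M['F_2]_(k, m)) (z : 'rV['F_2]_m) : ~~ (z <= A)%MS ->
  exists2 lam : 'cV['F_2]_m, A *m lam = 0 & dotp z lam = 1.
Proof.
rewrite submxE => nz; have [j nj] : exists j, (z *m cokermx A) 0 j != 0.
  apply/existsP; apply: contraNT nz; rewrite negb_exists => /forallP h.
  by apply/eqP/rowP=> j; rewrite [RHS]mxE; apply/eqP/negPn.
have colE p (B : 'M['F_2]_(p, m)) : B *m col j (cokermx A) = col j (B *m cokermx A).
  by rewrite !colE mulmxA.
exists (col j (cokermx A)); first by rewrite colE mulmx_coker; apply/matrixP=> ? ?; rewrite !mxE.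
by rewrite /dotp colE mxE; apply: F2_eq1.
Qed.

(** Induction on the degree. A functional separating a missing class from the pairs of degree
    dividing [deg u] kills all binomials of smaller degree by induction, so [(u, w)] would extend
    the maximal family. *)
Lemma pair_span (u w : exps) : deg u = deg w ->
  ((red u + red w)%R <= pair_mx (fun d => (d <= deg u)%MM))%MS.
Proof.
have [N] := ubnP (mdeg (deg u)); elim: N u w => // N IH u w; rewrite ltnS => leN duw.
apply/negPn/negP=> nsub; have [mu Amu zmu] := separating_functional nsub.
have killU z (D : pred 'X_{1..n}) : (forall d, D d -> (d <= deg u)%MM) ->
    (z <= pair_mx D)%MS -> dotp z mu = 0.
  move=> hD /(fun h => submx_trans h (pair_mxS hD))/submxP[c ->].
  by rewrite /dotp -mulmxA Amu mulmx0 mxE.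
have low : kills_below mu (deg u).
  move=> u' w' d' le' ne'.
  apply: (killU _ (fun d => (d <= deg u')%MM)) => [d led|]; first exact: lepm_trans le'.
  apply: IH => //; apply: leq_trans leN; rewrite -(submK le') mdegD -{1}[mdeg (deg u')]add0n.
  rewrite ltn_add2r lt0n mdeg_eq0; apply: contra ne' => /eqP h0.
  by rewrite -(submK le') h0 add0m.
have killS l : (l < size s)%N -> (deg (nth (0%MM, 0%MM) s l).1 <= deg u)%MM ->
    dotp (pair_vec (nth (0%MM, 0%MM) s l)) mu = 0.
  move=> ltl ledl; apply: (killU _ (fun d => (d <= deg u)%MM)) => //.
  have := row_sub (Ordinal ltl) (pair_mx (fun d => (d <= deg u)%MM)).
  by rewrite row_pair_mx /pair_deg !(tnth_nth (0%MM, 0%MM)) /= ledl.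
case: (maxs (p := (u, w))); have [lam hlam] := gs.
(* The old functionals of the same degree are corrected by a multiple of [mu] to vanish on the new
   pair; [mu] kills the old pairs of that degree, so their values there do not change. *)
exists (fun j => if j == size s then mu else
          if deg (nth (0%MM, 0%MM) s j).1 == deg u then
            lam j - dotp (pair_vec (u, w)) (lam j) *: mu else lam j) => j.
rewrite size_rcons ltnS => lej /=; rewrite nth_rcons.
case: (eqVneq j (size s)) => [->|nj].
  rewrite ltnn /=; split=> // l; rewrite ltnS => lel nl; rewrite nth_rcons.
  have ltl : (l < size s)%N by rewrite ltn_neqAle nl.
  by rewrite ltl => dl; apply: killS; rewrite ?dl ?lepm_refl.
have ltj : (j < size s)%N by rewrite ltn_neqAle nj.
rewrite ltj; have [dj lowj onej offj] := hlam j ltj.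
case: eqP => [dju|ndju].
  split=> //.
  - move=> u' w' d' le' ne'; rewrite dotpBr lowj // low ?mulr0 ?subr0 // -?dju //.
  - by rewrite dotpBr onej killS ?mulr0 ?subr0 // dju lepm_refl.
  move=> l; rewrite ltnS => lel nl; rewrite nth_rcons.
  case: (ltnP l (size s)) => ltl.
    by move=> dl; rewrite dotpBr offj // killS ?mulr0 ?subr0 // dl dju lepm_refl.
  have -> : l == size s by rewrite eqn_leq lel ltl.
  by move=> _; rewrite dotpBr zmu mulr1 subrr.
split=> // l; rewrite ltnS => lel nl; rewrite nth_rcons.
case: (ltnP l (size s)) => ltl; first exact: offj.
have -> : l == size s by rewrite eqn_leq lel ltl.
by move=> /= du; case: ndju.
Qed.

Lemma pair_span_pred (D : pred 'X_{1..n}) (u w : exps) : deg u = deg w ->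
  (forall d, (d <= deg u)%MM -> D d) -> ((red u + red w)%R <= pair_mx D)%MS.
Proof. by move=> duw hD; apply: submx_trans (pair_span duw) (pair_mxS _). Qed.

Lemma pair_mx_ann (D : pred 'X_{1..n}) (z : 'rV_m) (mu : 'cV_m) :
  (forall u w : exps, deg u = deg w -> D (deg u) -> (red u + red w) *m mu = 0) ->
  (z <= pair_mx D)%MS -> z *m mu = 0.
Proof.
move=> h /submxP[c ->]; rewrite -mulmxA; suff -> : pair_mx D *m mu = 0 by rewrite mulmx0.
apply/row_matrixP=> l; rewrite row_mul row_pair_mx row0; case: ifP => Dl; last by rewrite mul0mx.
by apply: h => //; apply: good_pair_deg.
Qed.

Hypothesis conn : connected_graph e.
Variable C : {set 'I_n}.
Hypothesis hC : odd_hole e C.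

(* On the edge xy the functional is f x + f y + kappa, where f is a potential computed along
   walks from a root and kappa is the common value on the odd closed walks at the root. *)
Lemma pair_mx_rank : (m - n <= \rank (pair_mx predT))%N.
Proof.
have n0 := proj1 conn; pose r : 'I_n := Ordinal n0.
have [p0 [cyc0 op0]] := odd_closed_walk_through esym conn hC r.
have /fin_all_exists[q hq] v : exists q, [/\ path e r q, last r q = v & v = r -> q = [::]].
  case: (eqVneq v r) => [->|nvr]; first by exists [::].
  have /connectP[q pq lq] := proj2 conn r v.
  by exists q; split=> // evr; rewrite evr eqxx in nvr.
(* The potential vanishes at the root, so the root's column is free to carry the constant kappa.
   Hence [n] parameters suffice. *)
pose M : 'M['F_2]_(m, n) := \matrix_(i, v) if v == r then 1 else (incidence i v)%:R.
have kermM (lam : 'cV['F_2]_m) : pair_mx predT *m lam = 0 -> exists g : 'cV['F_2]_n, lam = M *m g.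
  move=> hlam; pose L x p := dotp (wsum e x p) lam.
  have killp (u w : exps) : deg u = deg w -> dotp (red u + red w) lam = 0.
    move=> duw; have /submxP[c ->] := pair_span_pred (D := predT) duw (fun _ _ => isT).
    by rewrite /dotp -mulmxA hlam mulmx0 mxE.
  have closed0 p : path e r p -> last r p = r -> ~~ odd (size p) -> L r p = 0.
    move=> pp lp op; have [d1 d2] := closed_walk_degrees esym eirr pp lp op.
    by rewrite /L -(red_pairing esym eirr pp); apply: killp; rewrite d1 d2.
  pose kappa := L r (rcons p0 r).
  have closed p : path e r p -> last r p = r -> L r p = (odd (size p))%:R * kappa.
    move=> pp lp; case: (boolP (odd (size p))) => op; last by rewrite mul0r closed0.
    have : L r (p ++ rcons p0 r) = 0.
      apply: closed0; rewrite ?cat_path ?last_cat ?lp ?last_rcons ?pp //.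
      by rewrite size_cat size_rcons oddD /= op (negPf op0).
    rewrite /L wsum_cat lp dotpD mul1r => /eqP.
    by rewrite addr_eq0 F2_opp => /eqP.
  pose f v := L r (q v) + (odd (size (q v)))%:R * kappa.
  exists (\col_v if v == r then kappa else f v).
  have fr : f r = 0.
    by have [_ _ /(_ erefl) q0] := hq r; rewrite /f q0 /L /= /dotp mul0mx mxE mul0r addr0.
  apply/colP=> i; rewrite !mxE.
  have -> : \sum_j M i j * (\col_v (if v == r then kappa else f v)) j 0 =
      kappa + \sum_v (incidence i v)%:R * f v.
    rewrite (bigD1 r) //= !mxE eqxx mul1r; congr (_ + _).
    rewrite [RHS](bigD1 r) //= fr mulr0 add0r; apply: eq_bigr => v /negPf nvr.
    by rewrite !mxE nvr.
  set x := (ed i).1; set y := (ed i).2.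
  have -> : \sum_v (incidence i v)%:R * f v = f x + f y.
    have one t : \sum_v (t == v)%:R * f v = f t.
      rewrite (bigD1 t) //= eqxx mul1r big1 ?addr0 // => v.
      by rewrite eq_sym => /negPf->; rewrite mul0r.
    rewrite -(one x) -(one y) -big_split; apply: eq_bigr => v _ /=.
    by rewrite /incidence natrD mulrDl.
  have [px lx _] := hq x; have [py ly _] := hq y.
  have exy : e x y := ed_edge i.
  pose w := q x ++ y :: rev (belast r (q y)).
  have pw : path e r w.
    by rewrite /w cat_path px lx /= exy; have := rcons_path_rev esym py; rewrite ly.
  have lw : last r w = r.
    rewrite /w last_cat lx /=; move: ly; case: (q y) => //= z p _.
    by rewrite rev_cons last_rcons.
  have Lw : L r w = L r (q x) + (lam i 0 + L r (q y)).
    have := wsum_rev e r (q y); rewrite ly => wrev.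
    rewrite /L /w wsum_cat lx dotpD /= dotpD wrev; congr (_ + (_ + _)).
    rewrite /dotp mxE (bigD1 i) //= mxE /is_ed -surjective_pairing eqxx mul1r big1 ?addr0 // => j nij.
    rewrite mxE; case: (boolP (is_ed j x y)) => [hj|_]; last by rewrite mul0r.
    by rewrite (is_ed_inj hj (ed_is_ed i)) eqxx in nij.
  have sw : odd (size w) = ~~ (odd (size (q x)) (+) odd (size (q y))).
    by rewrite /w size_cat /= size_rev size_belast addnS /= oddD.
  by apply: F2_edge; rewrite -sw -closed // Lw.
rewrite leq_subLR addnC -leq_subLR -mxrank_coker -mxrank_tr.
suff sub : ((cokermx (pair_mx predT))^T <= M^T)%MS.
  exact: leq_trans (mxrankS sub) (rank_leq_row _).
apply/row_subP=> j; rewrite -tr_col.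
have [|g ->] := kermM (col j (cokermx (pair_mx predT))).
  by rewrite colE mulmxA mulmx_coker mul0mx.
by rewrite trmx_mul submxMl.
Qed.

Hypothesis few : (size s <= m - n)%N.

Lemma pair_mx_free : row_free (pair_mx predT).
Proof.
by rewrite /row_free eqn_leq rank_leq_row (leq_trans few pair_mx_rank).
Qed.

Lemma pair_mx_coord (D : pred 'X_{1..n}) (z : 'rV_m) : (z <= pair_mx D)%MS ->
  exists2 c : 'rV_(size s), z = c *m pair_mx predT & forall l, ~~ D (pair_deg l) -> c 0 l = 0.
Proof.
case/submxP=> c ->; exists (\row_l if D (pair_deg l) then c 0 l else 0).
  apply/rowP=> i; rewrite !mxE; apply: eq_bigr => l _; rewrite !mxE.
  by case: ifP; rewrite ?mulr0 ?mul0r.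
by move=> l /negPf nD; rewrite mxE nD.
Qed.

Lemma coord_pair_mx (D : pred 'X_{1..n}) (c : 'rV_(size s)) :
  (forall l, ~~ D (pair_deg l) -> c 0 l = 0) -> (c *m pair_mx predT <= pair_mx D)%MS.
Proof.
move=> h; suff -> : c *m pair_mx predT = c *m pair_mx D by apply: submxMl.
apply/rowP=> i; rewrite !mxE; apply: eq_bigr => l _; rewrite !mxE.
by case: (boolP (D _)) => // nD; rewrite (h l nD) !mul0r.
Qed.

Lemma pair_span_system : span_system (fun D z => (z <= pair_mx D)%MS).
Proof.
split.
- exact: pair_span_pred.
- exact: pair_mx_ann.
- move=> D1 D2 D3 z1 z2 z3 /pair_mx_coord[c1 -> s1] /pair_mx_coord[c2 -> s2].
  case/pair_mx_coord=> c3 -> s3; rewrite -mulmxDl => /(row_free_inj pair_mx_free) ec.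
  (* Rows are independent, so c1 = c2 + c3. Keep the coordinates of [c1] in [D2]; outside [D2] the
     vector [c2] is zero and [c1] agrees with [c3]. *)
  pose c := \row_l (if D2 (pair_deg l) then c1 0 l else 0).
  exists (c *m pair_mx predT), ((c1 - c) *m pair_mx predT); split.
  + apply: coord_pair_mx => l /=; rewrite negb_and mxE => /orP[/s1->|/negPf->//].
    exact: if_same.
  + apply: coord_pair_mx => l /=; rewrite negb_and !mxE; case: ifP => D2l; first by rewrite subrr.
    rewrite subr0 => /orP[/s1//|/s3 c3l]; by rewrite ec mxE c3l s2 ?D2l // addr0.
  by rewrite -mulmxDl addrC subrK.
- by move=> D D' z sDD hz; apply: submx_trans hz (pair_mxS sDD).
by move=> D; apply: sub0mx.
Qed.

End MinimalGenerators.

Local Open Scope nat_scope.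

Theorem theorem6p7 (K : fieldType) (n : nat) (e : rel 'I_n) :
  simple_graph e -> connected_graph e ->
  complete_intersection_ideal (@toric_ideal K n e) ->
  (@edge_ring_normal K n e <->
     ((forall B1 B2, nonbip_block e B1 -> nonbip_block e B2 -> B1 = B2) \/
      (exists B1 B2 : {set 'I_n}, B1 <> B2 /\ nonbip_block e B1 /\ nonbip_block e B2 /\
         (forall B, nonbip_block e B -> B = B1 \/ B = B2) /\
         strongly_contiguous e B1 B2))).
Proof.
move=> [esymm eirr] conn [gens [gen hgt]].
(* Without odd holes both sides hold at once. This case is separate because the height bound |E| -
   |V| relies on an odd hole: for a connected bipartite graph the height is |E| - |V| + 1. *)
case: (classic (exists C, odd_hole e C)) => [[C hC]|nohole]; last first.
  split=> _.
    by left=> B1 B2 /(nonbip_block_hole esymm eirr)[C hC _]; case: nohole; exists C.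
  by apply: (odd_cycle_condition_normal esymm eirr) => C C' hC; case: nohole; exists C.
have few := toric_height esymm eirr conn hC hgt.
have [s gs maxs] := maximal_good_family (fun s => good_family_size gen (s := s)).
have few_s : size s <= size (edges e) - n.
  apply: leq_trans (good_family_size gen gs) _.
  by rewrite -[size gens](addnK n) leq_sub2r.
have HZ := pair_span_system esymm eirr gs maxs conn hC few_s.
split=> [norm|blocks].
  exact: (odd_cycle_condition_blocks esymm eirr HZ (normal_odd_cycle_condition esymm eirr conn norm)).
apply: (odd_cycle_condition_normal esymm eirr).
exact: (blocks_odd_cycle_condition esymm eirr HZ blocks).
Qed.
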